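(* Let $p$ be the number of concurrent threads that are modifying a concurrent interpolation search tree (C-IST). Then the worst-case depth of a C-IST that contains $n$ keys is $O(p+\log n)$.
   Context: MODEL. At most $p$ asynchronous threads take arbitrarily interleaved atomic steps on a shared memory; nodes are freshly allocated and never reused. Atomic primitives: READ, WRITE, CAS, FETCH_AND_ADD, and $\mathrm{DCSS}(x,o,w,y,o')$, which atomically writes $w$ to address $x$ and returns SUCCESS if $x$ holds $o$ and $y$ holds $o'$, and otherwise changes nothing and returns FAILED_MAIN_ADDRESS (if $x$ did not match) or FAILED_AUX_ADDRESS (if $y$ did not match). Entries of children arrays are read atomically. The depth of a C-IST is the maximal length of a path from the root to a leaf. DATA. Keys come from a totally ordered set. A node is one of: Empty; Single(key, val); Inner(initSize, degree $d$, keys $k_0<\dots<k_{d-2}$, children[$0..d-1$], status, count, nextMark), where status is a triple (integer, boolean, boolean), initially $[0,\bot,\bot]$, count and nextMark are initially $0$, initSize is the number of keys in the subtree at the node's creation; Rebuild(target: Inner, newTarget: node pointer, initially null, parent: Inner, index: int). Apart from children entries, status, count and nextMark, fields of an Inner node do not change once the node has been completely built. A C-IST $I$ has a field root, pointing to a permanent sentinel Inner node of degree 1 (no keys) whose single child is Empty in a newly created C-IST. An ideal C-IST on $n$ keys is: Empty if $n=0$, Single if $n=1$, and otherwise an Inner node of degree $\lfloor\sqrt n\rfloor$ or $\lceil\sqrt n\rceil$ whose child subtrees are ideal, each with $\lfloor\sqrt n\rfloor$ or $\lceil\sqrt n\rceil$ keys. In each Inner node, children[$i$] is responsible for the keys in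 $[k_{i-1},k_i)$ (within the parent's interval). The rebuild threshold is $R=1/4$; $T$ (COLLABORATION_THRESHOLD) is a fixed constant. interpolationSearch($k,n$) returns the index $i$ with $k_{i-1}\le k<k_i$ in $n$'s keys (with $k_{-1}=-\infty$, $k_{d-1}=+\infty$). OPERATIONS. insert($I,k,v$): path := empty list; $n:=I.\mathrm{root}$; loop: $i:=$ interpolationSearch($k,n$); $c:=n.\mathrm{children}[i]$. If $c$ is Inner: $n:=c$ and append $(c,i)$ to path. If $c$ is Rebuild: helpRebuild($c$), then restart insert from the root. If $c$ is Empty or Single: create $r$, which is Single($k,v$) if $c$ is Empty or has key $k$, and otherwise an Inner node of degree 2, initSize 2, with the two Single children holding the key of $c$ and the key $k$ in order; execute DCSS($n$.children[$i$], $c$, $r$, $n$.status, $[0,\bot,\bot]$). On FAILED_MAIN_ADDRESS repeat the loop from the same $n$; on FAILED_AUX_ADDRESS restart from the root; on SUCCESS, FETCH_AND_ADD($m$.count, 1) for every $m$ in path, then going down the path find the first $(m,j)$ with $m.\mathrm{count}\ge R\cdot m.\mathrm{initSize}$, if any, and call rebuild($m$, parent, $j$), where parent is the predecessor of $m$ on the path ($I$.root for the first); return. delete($I,k$): the same, except that if $c$ is Empty or a Single with key $\ne k$ it returns without changing anything, and if $c$ is a Single with key $k$ then $r$ is a new Empty node. lookup($I,k$): $n:=I.\mathrm{root}$; loop: if $n$ is Inner, $n:=n.\mathrm{children}[\text{interpolationSearch}(k,n)]$; if $n$ is Single, return its value if its key is $k$ and null otherwise; if $n$ is Empty return null; if $n$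 is Rebuild, $n:=n.\mathrm{target}$. rebuild($u,q,i$): op := new Rebuild with target $u$, parent $q$, index $i$; if DCSS($q$.children[$i$], $u$, op, $q$.status, $[0,\bot,\bot]$) succeeds then helpRebuild(op). helpRebuild(op): keyCount := markAndCountCollaborative(op.target); ideal := createIdealCollaborative(op, keyCount); $q$ := op.parent; DCSS($q$.children[op.index], op, ideal, $q$.status, $[0,\bot,\bot]$). markAndCountCollaborative($u$) [MCC]: if $u$ is Empty return 0; if Single return 1; if Rebuild return MCC($u$.target). Otherwise: CAS($u$.status, $[0,\bot,\bot]$, $[0,\bot,\top]$); if $u.\mathrm{degree}>T$, repeat: index := FETCH_AND_ADD($u$.nextMark, 1), stop repeating if index $\ge u.\mathrm{degree}$, else MCC($u$.children[index]). Then keyCount := 0; for each index read the child $c$: if $c$ is Inner, read its status $[\text{count},\text{finished},\text{started}]$ and add count if finished, else add MCC($c$); if $c$ is Rebuild add MCC($c$); if $c$ is Single add 1. Then CAS($u$.status, $[0,\bot,\top]$, $[\text{keyCount},\top,\top]$) and return keyCount. createIdeal(target, from, cnt): returns a newly allocated ideal C-IST on the cnt keys of ranks from, ..., from+cnt$-1$ (ranks start at 0) among the sorted keys in the subtree of target; createIdeal(target, cnt) means from $=0$. createIdealCollaborative(op, keyCount): if keyCount $<T$, newTarget := createIdeal(op.target, keyCount); else newTarget := new Inner with initSize = keyCount, degree = 0, a keys array of length $\lfloor\sqrt{\text{keyCount}}\rfloor-1$, a children array of $\lfloor\sqrt{\text{keyCount}}\rfloor$ null pointers, status $[0,\bot,\bot]$,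 count = nextMark = 0. If CAS(op.newTarget, null, newTarget) fails, newTarget := READ(op.newTarget). If keyCount $\ge T$: (a) repeat: index := READ(newTarget.degree); stop repeating if index equals the length of newTarget.children; if CAS(newTarget.degree, index, index+1) succeeds and rebuildAndSetChild(op, keyCount, index) returns false, return newTarget; (b) for each index, if newTarget.children[index] is null and rebuildAndSetChild(op, keyCount, index) returns false, return newTarget. Return newTarget. rebuildAndSetChild(op, keyCount, index): $t:=\lfloor\sqrt{\text{keyCount}}\rfloor$; $s:=\lfloor\text{keyCount}/t\rfloor$; $\rho:=\text{keyCount} \bmod t$; from $:=s\cdot\text{index}+\min(\text{index},\rho)$; cnt $:=s+1$ if index $<\rho$, else $s$; child := createIdeal(op.target, from, cnt); if index $>0$, WRITE into op.newTarget.keys[index$-1$] the key of rank from in op.target; result := DCSS(op.newTarget.children[index], null, child, op.newTarget.status, $[0,\bot,\bot]$); return (result $\ne$ FAILED_AUX_ADDRESS).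
   Formalization: Inner nodes of ideal C-ISTs are required to have degree at least 2 (read literally, two keys allow unbounded chains of degree-1 nodes, making the claim false); also T ≥ 1 and p ≥ 1 are assumed. *)

(* Defs.v *)
From Stdlib Require Import PeanoNat.
From mathcomp Require Import all_boot all_order.
Set Implicit Arguments.
Unset Strict Implicit.
Unset Printing Implicit Defensive.
Import Order.TTheory.

Section CIST.

Context {disp : Order.disp_t} (K : orderType disp) (V : Type).

(* ------------------------------ shared memory ------------------------------ *)

(* [None] is the null pointer; an address is a position in the heap. *)
Definition ptr := option nat.
Definition null : ptr := None.

(* [count, finished, started] *)
Definition status_t := (nat * bool * bool)%type.
Definition clean : status_t := (0, false, false).

(* Both arrays have a fixed length.  An entry [None] of [keys] is a slot that
   has not been written yet; it only occurs in a node under construction. *)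
Record inner := MkInner {
  initSize : nat;
  degree : nat;
  keys : seq (option K);
  children : seq ptr;
  status : status_t;
  count : nat;
  nextMark : nat
}.

Inductive node :=
| Empty
| Single (k : K) (v : V)
| Inner (u : inner)
| Rebuild (target newTarget parent : ptr) (index : nat).

(* Nodes are allocated at the end of the heap and never freed, so an address
   is never reused. *)
Definition heap := seq node.

Definition node_at (h : heap) (a : ptr) : option node := obind (onth h) a.

Definition inner_at (h : heap) (a : ptr) : option inner :=
  if node_at h a is Some (Inner u) then Some u else None.

Definition update (h : heap) (a : ptr) (f : node -> node) : heap :=
  match a, node_at h a with
  | Some b, Some x => set_nth Empty h b (f x)
  | _, _ => h
  end.

Definition update_inner (h : heap) (a : ptr) (f : inner -> inner) : heap :=
  update h a (fun x => if x is Inner u then Inner (f u) else x).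

Inductive nat_loc :=
| Degree of ptr
| Count of ptr
| NextMark of ptr.

Inductive loc :=
| NatLoc of nat_loc
| Key of ptr & nat
| Child of ptr & nat
| Status of ptr
| NewTarget of ptr.

Definition loc_type (l : loc) : Type :=
  match l with
  | NatLoc _ => nat
  | Key _ _ => option K
  | Child _ _ => ptr
  | Status _ => status_t
  | NewTarget _ => ptr
  end.

Definition get (h : heap) (l : loc) : option (loc_type l) :=
  match l return option (loc_type l) with
  | NatLoc (Degree a) => omap degree (inner_at h a)
  | NatLoc (Count a) => omap count (inner_at h a)
  | NatLoc (NextMark a) => omap nextMark (inner_at h a)
  | Key a i => obind (fun u => onth (keys u) i) (inner_at h a)
  | Child a i => obind (fun u => onth (children u) i) (inner_at h a)
  | Status a => omap status (inner_at h a)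
  | NewTarget a =>
      if node_at h a is Some (Rebuild _ w _ _) then Some w else None
  end.

(* Only used on a location [l] for which [get h l] is defined. *)
Definition set (h : heap) (l : loc) : loc_type l -> heap :=
  match l return loc_type l -> heap with
  | NatLoc (Degree a) => fun x => update_inner h a (fun u =>
      MkInner (initSize u) x (keys u) (children u) (status u) (count u)
        (nextMark u))
  | NatLoc (Count a) => fun x => update_inner h a (fun u =>
      MkInner (initSize u) (degree u) (keys u) (children u) (status u) x
        (nextMark u))
  | NatLoc (NextMark a) => fun x => update_inner h a (fun u =>
      MkInner (initSize u) (degree u) (keys u) (children u) (status u)
        (count u) x)
  | Key a i => fun x => update_inner h a (fun u =>
      MkInner (initSize u) (degree u) (set_nth None (keys u) i x) (children u)
        (status u) (count u) (nextMark u))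
  | Child a i => fun x => update_inner h a (fun u =>
      MkInner (initSize u) (degree u) (keys u) (set_nth null (children u) i x)
        (status u) (count u) (nextMark u))
  | Status a => fun x => update_inner h a (fun u =>
      MkInner (initSize u) (degree u) (keys u) (children u) x (count u)
        (nextMark u))
  | NewTarget a => fun x => update h a (fun y =>
      if y is Rebuild u _ q i then Rebuild u x q i else y)
  end.

(* ------------------- contents and depth of a subtree ------------------- *)

(* [entries h a s]: [s] lists the key-value pairs of the Single nodes in the
   subtree of [a], from left to right.  Like the searches, it enters a Rebuild
   node through its target: newTarget is not part of the tree before it is
   installed in place of the Rebuild node. *)
Inductive entries (h : heap) : ptr -> seq (K * V) -> Prop :=
| entries_empty a :
    node_at h a = Some Empty -> entries h a [::]
| entries_single a k v :
    node_at h a = Some (Single k v) -> entries h a [:: (k, v)]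
| entries_inner a u (ss : seq (seq (K * V))) :
    node_at h a = Some (Inner u) ->
    size ss = size (children u) ->
    (forall i, i < size ss ->
      entries h (nth null (children u) i) (nth [::] ss i)) ->
    entries h a (flatten ss)
| entries_rebuild a t w q i s :
    node_at h a = Some (Rebuild t w q i) ->
    entries h t s -> entries h a s.

(* [leaf_path h a l]: some path of [l] edges goes from [a] to a leaf. *)
Inductive leaf_path (h : heap) : ptr -> nat -> Prop :=
| leaf_path_empty a :
    node_at h a = Some Empty -> leaf_path h a 0
| leaf_path_single a k v :
    node_at h a = Some (Single k v) -> leaf_path h a 0
| leaf_path_inner a u i l :
    node_at h a = Some (Inner u) ->
    i < size (children u) ->
    leaf_path h (nth null (children u) i) l -> leaf_path h a l.+1
| leaf_path_rebuild a t w q i l :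
    node_at h a = Some (Rebuild t w q i) ->
    leaf_path h t l -> leaf_path h a l.+1.

Definition sort_entries (s : seq (K * V)) : seq (K * V) :=
  sort (fun x y => (x.1 <= y.1)%O) s.

(* ---------------------------- fresh subtrees ---------------------------- *)

Inductive tree :=
| TEmpty
| TSingle (k : K) (v : V)
| TInner (ks : seq K) (ts : seq tree).

Fixpoint tree_size (t : tree) : nat :=
  match t with
  | TEmpty => 0
  | TSingle _ _ => 1
  | TInner _ ts => sumn (map tree_size ts)
  end.

Fixpoint alloc (t : tree) (h : heap) : heap * ptr :=
  match t with
  | TEmpty => (rcons h Empty, Some (size h))
  | TSingle k v => (rcons h (Single k v), Some (size h))
  | TInner ks ts =>
      let: (h', cs) :=
        (fix alloc_seq ts h := match ts with
         | [::] => (h, [::])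
         | t :: ts' =>
             let: (h1, c) := alloc t h in
             let: (h2, cs) := alloc_seq ts' h1 in
             (h2, c :: cs)
         end) ts h in
      (rcons h' (Inner (MkInner (tree_size t) (size ts) (map Some ks) cs
                          clean 0 0)),
       Some (size h'))
  end.

(* [floor_or_ceil_sqrt n m]: [m] is the square root of [n] rounded down or up *)
Definition floor_or_ceil_sqrt (n m : nat) : bool :=
  (m == Nat.sqrt n) || (m == Nat.sqrt_up n).

(* The i-th child holds the keys in [k_{i-1}, k_i): its keys are below [k_j]
   exactly when [i <= j].  The condition [1 < size ts] only matters for two
   keys, whose square root rounds down to 1: it excludes a root of degree 1
   above an ideal tree on the same two keys, which could otherwise be repeated
   arbitrarily often. *)
Inductive ideal : seq (K * V) -> tree -> Prop :=
| ideal_empty : ideal [::] TEmpty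
| ideal_single k v : ideal [:: (k, v)] (TSingle k v)
| ideal_inner (ss : seq (seq (K * V))) (ks : seq K) (ts : seq tree) :
    let n := size (flatten ss) in
    1 < n ->
    1 < size ts ->
    floor_or_ceil_sqrt n (size ts) ->
    all (fun s => floor_or_ceil_sqrt n (size s)) ss ->
    size ss = size ts ->
    size ts = (size ks).+1 ->
    (forall i j k, i < size ss -> onth ks j = Some k ->
      all (fun x => (x.1 < k)%O == (i <= j)) (nth [::] ss i)) ->
    (forall i, i < size ss -> ideal (nth [::] ss i) (nth TEmpty ts i)) ->
    ideal (flatten ss) (TInner ks ts).

(* --------------------------- atomic primitives --------------------------- *)

(* The part of a node that is fixed once it has been built. *)
Inductive view :=
| VEmpty
| VSingle (k : K) (v : V)
| VInner (initSize degree : nat) (keys : seq (option K)) (length : nat)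
| VRebuild (target parent : ptr) (index : nat).

Definition view_of (x : node) : view :=
  match x with
  | Empty => VEmpty
  | Single k v => VSingle k v
  | Inner u => VInner (initSize u) (degree u) (keys u) (size (children u))
  | Rebuild t _ q i => VRebuild t q i
  end.

Inductive dcss_result := Success | FailedMain | FailedAux.

(* [CreateIdeal] and [KeyOfRank] inspect the subtree of a node in one step:
   they are only used on a subtree whose Inner nodes have all been marked by
   [MarkAndCount], and which therefore no longer changes. *)
Inductive prim :=
| Peek (a : ptr)
| Read (x : loc)
| Write (x : loc) (w : loc_type x)
| CAS (x : loc) (o w : loc_type x)
| FetchAndAdd (x : nat_loc) (m : nat)
| DCSS (x : loc) (o w : loc_type x) (y : loc) (o' : loc_type y)
| New (x : node)
| NewTree (t : tree)
| CreateIdeal (target : ptr) (from cnt : nat)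
| KeyOfRank (target : ptr) (r : nat).

Definition prim_res (c : prim) : Type :=
  match c with
  | Peek _ => view
  | Read x => loc_type x
  | Write _ _ => unit
  | CAS _ _ _ => bool
  | FetchAndAdd _ _ => nat
  | DCSS _ _ _ _ _ => dcss_result
  | New _ => ptr
  | NewTree _ => ptr
  | CreateIdeal _ _ _ => ptr
  | KeyOfRank _ _ => K
  end.

(* [exec h c r h']: in memory [h], the primitive [c] may return [r] and leave
   the memory [h'].  A DCSS both of whose addresses mismatch may return either
   failure code.  Dereferencing null is not possible. *)
Definition exec (h : heap) (c : prim) : prim_res c -> heap -> Prop :=
  match c return prim_res c -> heap -> Prop with
  | Peek a => fun r h' => omap view_of (node_at h a) = Some r /\ h' = h
  | Read x => fun r h' => get h x = Some r /\ h' = h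
  | Write x w => fun _ h' => get h x <> None /\ h' = set h w
  | CAS x o w => fun r h' => exists2 v, get h x = Some v &
      if r then v = o /\ h' = set h w else v <> o /\ h' = h
  | FetchAndAdd x m => fun r h' =>
      get h (NatLoc x) = Some r /\ h' = @set h (NatLoc x) (r + m)
  | DCSS x o w y o' => fun r h' => exists v v',
      [/\ get h x = Some v, get h y = Some v' &
        match r with
        | Success => [/\ v = o, v' = o' & h' = set h w]
        | FailedMain => v <> o /\ h' = h
        | FailedAux => v' <> o' /\ h' = h
        end]
  | New x => fun r h' => r = Some (size h) /\ h' = rcons h x
  | NewTree t => fun r h' => (h', r) = alloc t h
  | CreateIdeal a from cnt => fun r h' => exists s t,
      [/\ entries h a s, ideal (take cnt (drop from (sort_entries s))) t &
        (h', r) = alloc t h]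
  | KeyOfRank a i => fun r h' => exists s v,
      [/\ entries h a s, onth (sort_entries s) i = Some (r, v) & h' = h]
  end.

(* ------------------------------- programs ------------------------------- *)

Inductive modification :=
| Insert (k : K) (v : V)
| Delete (k : K).

Definition key_of (m : modification) : K :=
  match m with Insert k _ => k | Delete k => k end.

(* An entry (m, i) records that [m] was read from slot [i] of its parent. *)
Definition path_t := seq (ptr * nat).

Inductive proc :=
| Modify (m : modification)
| ModifyFrom (m : modification) (n : ptr) (path : path_t)
| Lookup (k : K)
| LookupFrom (k : K) (n : ptr)
| StartRebuild (u q : ptr) (i : nat)
| HelpRebuild (op : ptr)
| MarkAndCount (u : ptr)
| MarkLoop (u : ptr) (deg : nat)
| CreateIdealCollaborative (op : ptr) (keyCount : nat)
| FillLoop (op newTarget : ptr) (keyCount len : nat).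

Definition proc_res (f : proc) : Type :=
  match f with
  | Modify _ | ModifyFrom _ _ _ | StartRebuild _ _ _ | HelpRebuild _
  | MarkLoop _ _ => unit
  | Lookup _ | LookupFrom _ _ => option V
  | MarkAndCount _ => nat
  | CreateIdealCollaborative _ _ => ptr
  | FillLoop _ _ _ _ => bool
  end.

(* Loops and recursion go through [Call], which a thread unfolds step by
   step, so that no termination is assumed. *)
Inductive prog (A : Type) : Type :=
| Ret (x : A)
| Do (c : prim) (k : prim_res c -> prog A)
| Call (f : proc) (k : proc_res f -> prog A).

Fixpoint bind A B (m : prog A) (f : A -> prog B) : prog B :=
  match m with
  | Ret x => f x
  | Do c k => Do (fun r => bind (k r) f)
  | Call g k => Call (fun r => bind (k r) f)
  end.

Definition act (c : prim) : prog (prim_res c) := Do (fun r => Ret r).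
Definition call (f : proc) : prog (proc_res f) := Call (fun r => Ret r).

Local Notation "'let!' x ':=' m 'in' f" := (bind m (fun x => f))
  (at level 200, x name, m at level 200, f at level 200).
Local Notation "m ';;' f" := (bind m (fun _ => f))
  (at level 199, right associativity).

Variable T : nat. (* COLLABORATION_THRESHOLD *)

Definition root_ptr : ptr := Some 0.

Definition interpolationSearch (k : K) (ks : seq (option K)) : nat :=
  find (fun o => if o is Some x then (k < x)%O else false) ks.

(* The subtree that replaces a leaf with view [c], or [None] if the operation
   returns without changing anything. *)
Definition replacement (m : modification) (c : view) : option tree :=
  match m, c with
  | Insert k v, VSingle k' v' =>
      Some (if k == k' then TSingle k v
            else if (k < k')%O
            then TInner [:: k'] [:: TSingle k v; TSingle k' v']
            else TInner [:: k] [:: TSingle k' v'; TSingle k v])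
  | Insert k v, _ => Some (TSingle k v)
  | Delete k, VSingle k' _ => if k == k' then Some TEmpty else None
  | Delete _, _ => None
  end.

Fixpoint incrementCounts (path : path_t) : prog unit :=
  if path is (m, _) :: path' then
    act (FetchAndAdd (Count m) 1) ;; incrementCounts path'
  else Ret tt.

(* [n.initSize <= 4 * n.count] is [n.count >= R * n.initSize] for R = 1/4. *)
Fixpoint rebuildFirst (parent : ptr) (path : path_t) : prog unit :=
  if path is (m, j) :: path' then
    let! x := act (Peek m) in
    let! cnt := act (Read (NatLoc (Count m))) in
    if x is VInner size0 _ _ _ then
      if size0 <= 4 * cnt then call (StartRebuild m parent j)
      else rebuildFirst m path'
    else Ret tt
  else Ret tt.

Definition modifyFrom (m : modification) (n : ptr) (path : path_t) :
    prog unit :=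
  let! x := act (Peek n) in
  if x is VInner _ _ ks _ then
    let i := interpolationSearch (key_of m) ks in
    let! c := act (Read (Child n i)) in
    let! y := act (Peek c) in
    match y with
    | VInner _ _ _ _ => call (ModifyFrom m c (rcons path (c, i)))
    | VRebuild _ _ _ => call (HelpRebuild c) ;; call (Modify m)
    | _ =>
        if replacement m y is Some t then
          let! r := act (NewTree t) in
          let! res := act (@DCSS (Child n i) c r (Status n) clean) in
          match res with
          | FailedMain => call (ModifyFrom m n path)
          | FailedAux => call (Modify m)
          | Success => incrementCounts path ;; rebuildFirst root_ptr path
          end
        else Ret tt
    end
  else Ret tt.

Definition lookupFrom (k : K) (n : ptr) : prog (option V) :=
  let! x := act (Peek n) in
  match x with
  | VEmpty => Ret None
  | VSingle k' v => Ret (if k == k' then Some v else None)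
  | VInner _ _ ks _ =>
      let! c := act (Read (Child n (interpolationSearch k ks))) in
      call (LookupFrom k c)
  | VRebuild t _ _ => call (LookupFrom k t)
  end.

Definition startRebuild (u q : ptr) (i : nat) : prog unit :=
  let! op := act (New (Rebuild u null q i)) in
  let! res := act (@DCSS (Child q i) u op (Status q) clean) in
  if res is Success then call (HelpRebuild op) else Ret tt.

Definition helpRebuild (op : ptr) : prog unit :=
  let! x := act (Peek op) in
  if x is VRebuild target q i then
    let! keyCount := call (MarkAndCount target) in
    let! new := call (CreateIdealCollaborative op keyCount) in
    act (@DCSS (Child q i) op new (Status q) clean) ;; Ret tt
  else Ret tt.

Fixpoint countChildren (u : ptr) (js : seq nat) (keyCount : nat) : prog nat :=
  if js is j :: js' then
    let! c := act (Read (Child u j)) in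
    let! y := act (Peek c) in
    let! m := match y with
      | VEmpty => Ret 0
      | VSingle _ _ => Ret 1
      | VInner _ _ _ _ =>
          let! st := act (Read (Status c)) in
          let: (cnt, finished, _) := st in
          if finished then Ret cnt else call (MarkAndCount c)
      | VRebuild _ _ _ => call (MarkAndCount c)
      end in
    countChildren u js' (keyCount + m)
  else Ret keyCount.

Definition markAndCount (u : ptr) : prog nat :=
  let! x := act (Peek u) in
  match x with
  | VEmpty => Ret 0
  | VSingle _ _ => Ret 1
  | VRebuild t _ _ => call (MarkAndCount t)
  | VInner _ deg _ _ =>
      act (@CAS (Status u) clean (0, false, true)) ;;
      (if T < deg then call (MarkLoop u deg) else Ret tt) ;;
      let! keyCount := countChildren u (iota 0 deg) 0 in
      act (@CAS (Status u) (0, false, true) (keyCount, true, true)) ;;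
      Ret keyCount
  end.

Definition markLoop (u : ptr) (deg : nat) : prog unit :=
  let! index := act (FetchAndAdd (NextMark u) 1) in
  if deg <= index then Ret tt else
  let! c := act (Read (Child u index)) in
  call (MarkAndCount c) ;; call (MarkLoop u deg).

Definition rebuildAndSetChild (op : ptr) (keyCount index : nat) : prog bool :=
  let t := Nat.sqrt keyCount in
  let s := keyCount %/ t in
  let rho := keyCount %% t in
  let from := s * index + minn index rho in
  let cnt := if index < rho then s.+1 else s in
  let! x := act (Peek op) in
  if x is VRebuild target _ _ then
    let! child := act (CreateIdeal target from cnt) in
    (if 0 < index then
       let! k := act (KeyOfRank target from) in
       let! nt := act (Read (NewTarget op)) in
       act (@Write (Key nt index.-1) (Some k))
     else Ret tt) ;;
    let! nt := act (Read (NewTarget op)) in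
    let! res := act (@DCSS (Child nt index) null child (Status nt) clean) in
    Ret (if res is FailedAux then false else true)
  else Ret false.

(* Part (a): claim the children one by one. *)
Definition fillLoop (op newTarget : ptr) (keyCount len : nat) : prog bool :=
  let! index := act (Read (NatLoc (Degree newTarget))) in
  if index == len then Ret true else
  let! ok := act (@CAS (NatLoc (Degree newTarget)) index index.+1) in
  if ok then
    let! b := rebuildAndSetChild op keyCount index in
    if b then call (FillLoop op newTarget keyCount len) else Ret false
  else call (FillLoop op newTarget keyCount len).

(* Part (b): build the children that are still missing. *)
Fixpoint fillMissing (op newTarget : ptr) (keyCount : nat) (js : seq nat) :
    prog unit :=
  if js is j :: js' then
    let! c := act (Read (Child newTarget j)) in
    let! b := if c is None then rebuildAndSetChild op keyCount j
              else Ret true in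
    if b then fillMissing op newTarget keyCount js' else Ret tt
  else Ret tt.

Definition createIdealCollaborative (op : ptr) (keyCount : nat) : prog ptr :=
  let! x := act (Peek op) in
  if x is VRebuild target _ _ then
    let t := Nat.sqrt keyCount in
    let! mine :=
      if keyCount < T then act (CreateIdeal target 0 keyCount)
      else act (New (Inner (MkInner keyCount 0 (nseq t.-1 None) (nseq t null)
                              clean 0 0))) in
    let! ok := act (@CAS (NewTarget op) null mine) in
    let! newTarget := if ok then Ret mine else act (Read (NewTarget op)) in
    if T <= keyCount then
      let! y := act (Peek newTarget) in
      if y is VInner _ _ _ len then
        let! b := call (FillLoop op newTarget keyCount len) in
        if b then fillMissing op newTarget keyCount (iota 0 len) ;;
                  Ret newTarget
        else Ret newTarget
      else Ret newTarget
    else Ret newTarget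
  else Ret null.

Definition body (f : proc) : prog (proc_res f) :=
  match f return prog (proc_res f) with
  | Modify m => call (ModifyFrom m root_ptr [::])
  | ModifyFrom m n path => modifyFrom m n path
  | Lookup k => call (LookupFrom k root_ptr)
  | LookupFrom k n => lookupFrom k n
  | StartRebuild u q i => startRebuild u q i
  | HelpRebuild op => helpRebuild op
  | MarkAndCount u => markAndCount u
  | MarkLoop u deg => markLoop u deg
  | CreateIdealCollaborative op keyCount =>
      createIdealCollaborative op keyCount
  | FillLoop op newTarget keyCount len => fillLoop op newTarget keyCount len
  end.

(* ------------------------------ executions ------------------------------ *)

(* A thread that has returned from an operation ([Ret tt]) may invoke any
   other one, at any time. *)
Inductive thread_step : heap -> prog unit -> heap -> prog unit -> Prop :=
| thread_do h c (k : prim_res c -> prog unit) r h' :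
    exec h r h' -> thread_step h (Do k) h' (k r)
| thread_call h f (k : proc_res f -> prog unit) :
    thread_step h (Call k) h (bind (body f) k)
| thread_modify h m :
    thread_step h (Ret tt) h (call (Modify m))
| thread_lookup h k :
    thread_step h (Ret tt) h (call (Lookup k) ;; Ret tt).

Record config (p : nat) := Config {
  memory : heap;
  threads : 'I_p -> prog unit
}.

(* The initSize of the sentinel root is never read. *)
Definition initial (p : nat) : config p :=
  Config [:: Inner (MkInner 0 1 [::] [:: Some 1] clean 0 0); Empty]
         (fun _ => Ret tt).

Inductive reachable (p : nat) : config p -> Prop :=
| reachable_initial : reachable (initial p)
| reachable_step (c : config p) (t : 'I_p) h' q :
    reachable c ->
    thread_step (memory c) (threads c t) h' q ->
    reachable (Config h' (fun t' => if t' == t then q else threads c t')).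

(* Every Single node of the tree holds one key. *)
Definition contains_keys p (c : config p) (n : nat) : Prop :=
  exists2 s, entries (memory c) root_ptr s & size s = n.

Definition has_depth p (c : config p) (d : nat) : Prop :=
  leaf_path (memory c) root_ptr d /\
  forall l, leaf_path (memory c) root_ptr l -> l <= d.

End CIST.

(* Main.v *)
From Stdlib Require Import PeanoNat Classical.
Require Import Defs.
From mathcomp Require Import all_boot all_order zify.
Set Implicit Arguments.
Unset Strict Implicit.
Unset Printing Implicit Defensive.

(* An update that succeeds below an Inner node [u] increments the counts on its
   path and then tries to rebuild the topmost node whose count has reached a
   quarter of its initial size.  Charge it at [u] either to the comparison that
   found the count of [u] below the threshold, which happens less than
   [initSize u / 4] times, or else to its thread.  A thread is charged at most
   once: when its attempt to rebuild a node at or above [u] is over, some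
   ancestor of [u] has been replaced in its slot, and no later descent from the
   root reaches [u].  So the numbers of keys and of leaves below [u] stay within
   [initSize u / 4 + p] of [initSize u], also across rebuilds, which preserve
   the number of keys.  Hence the initial size [x] of a node and that of a child
   [y] satisfy [y <= sqrt x + 3 + x / 4 + p], which is at most [x / 2] as long as
   [x >= 100 (p + 1)].  After O(log (n + p)) such levels there remain O(p)
   leaves, and all nodes of a path but one have at least two children.

   Interference is treated by rely-guarantee reasoning over states that carry
   ghost data: each step of a thread preserves a global invariant and the facts
   that the other threads rely on. *)

(** Deletions leave Empty leaves behind, so two counts are needed: [initSize] is bounded by the
    number of keys, and the number of leaves by [initSize], each up to the slack. A rebuild keeps
    the [k] keys and turns [l >= maxn 1 k] leaves into [maxn 1 k], so it costs nothing in either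
    direction. The bounds speak of every weight that a subtree happens to have. As [weight] is
    inductive, a newTarget with a null slot has none, and the bounds on its totals hold vacuously
    until it is complete; existence of a weight is only supplied at the end, by the hypothesis on
    the contents of the tree. The home and the ancestors of a node are fixed at its allocation, for
    the slot it is meant for. They therefore survive all later replacements, and a charge made at a
    node keeps its meaning however late its thread continues. Nodes with one child come from the
    collaborative construction, when [Nat.sqrt k] is 1 for [k <= 3]. A chain of them would be deep
    with few leaves, which is why nodes of initial size at most 4 are treated apart. *)

Lemma onth_set_nth A (x0 x : A) (s : seq A) b a :
  b < size s -> onth (set_nth x0 s b x) a = if a == b then Some x else onth s a.
Proof.
elim: s b a => [|y s IH] [|b] [|a] //= ltbs.
by rewrite eqSS; apply: IH.
Qed.

Lemma onth_ltn A (s : seq A) a x : onth s a = Some x -> a < size s.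
Proof. by move=> E; rewrite -onthTE E. Qed.

Lemma seq_choice A (x0 : A) (P : nat -> A -> Prop) n :
  (forall i, i < n -> exists x, P i x) ->
  exists s, size s = n /\ forall i, i < n -> P i (nth x0 s i).
Proof.
elim: n => [|n IH] H; first by exists [::].
have [i ltin|s [size_s Hs]] := IH; first exact/H/ltnW.
have [x Px] := H n (ltnSn n).
exists (rcons s x); split; first by rewrite size_rcons size_s.
move=> i; rewrite ltnS leq_eqVlt nth_rcons size_s => /predU1P [-> | lt_in].
  by rewrite ltnn eqxx.
by rewrite lt_in; apply: Hs.
Qed.

(** Stated additively because subtraction on [nat] truncates. *)
Lemma sumn_one (s s' : seq nat) j :
  size s = size s' -> j < size s ->
  (forall i, i < size s -> i != j -> nth 0 s i = nth 0 s' i) ->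
  sumn s + nth 0 s' j = sumn s' + nth 0 s j.
Proof.
elim: s s' j => [|x s IH] [|x' s'] [|j] //= [size_ss'] lt_j H.
  have -> : s = s' by apply: (@eq_from_nth _ 0) => // i lt_i; apply: (H i.+1).
  lia.
have -> : x = x' by apply: (H 0).
have := IH s' j size_ss' lt_j (fun i lt_i => H i.+1 lt_i); lia.
Qed.

Section Execution.

Context {disp : Order.disp_t} (K : orderType disp) (V : Type) (p T : nat).

Local Notation heap := (heap K V).
Local Notation node := (node K V).
Local Notation inner := (inner K).
Local Notation tree := (tree K V).
Local Notation TEmpty := (TEmpty K V).
Local Notation prim := (prim K V).
Local Notation proc := (proc K V).
Local Notation prog := (prog K V).

(** * Sizes of subtrees *)

(** Retains only what [weight] depends on: keys, statuses, counts and newTarget pointers change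
    without affecting any weight. *)
Inductive skeleton := SEmpty | SSingle | SInner of seq ptr | SRebuild of ptr.

Definition skeleton_of (x : node) : skeleton :=
  match x with
  | Empty => SEmpty
  | Single _ _ => SSingle
  | Inner u => SInner (children u)
  | Rebuild t _ _ _ => SRebuild t
  end.

Definition skel (h : heap) (c : ptr) : option skeleton :=
  omap skeleton_of (node_at h c).

(* [weight h e c k]: the leaves below [c] have total weight [k], where a Single
   weighs 1 and an Empty weighs [e]; [e = 0] counts keys, [e = 1] leaves. *)
Inductive weight (h : heap) (e : nat) : ptr -> nat -> Prop :=
| weight_empty c : skel h c = Some SEmpty -> weight h e c e
| weight_single c : skel h c = Some SSingle -> weight h e c 1
| weight_inner c cs ks : skel h c = Some (SInner cs) -> size ks = size cs ->
    (forall i, i < size cs -> weight h e (nth null cs i) (nth 0 ks i)) ->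
    weight h e c (sumn ks)
| weight_rebuild c t k : skel h c = Some (SRebuild t) -> weight h e t k ->
    weight h e c k.

Lemma weight_inv h e c k : weight h e c k ->
  match skel h c with
  | Some SEmpty => k = e
  | Some SSingle => k = 1
  | Some (SInner cs) => exists ks, [/\ k = sumn ks, size ks = size cs &
      forall i, i < size cs -> weight h e (nth null cs i) (nth 0 ks i)]
  | Some (SRebuild t) => weight h e t k
  | None => False
  end.
Proof. by case=> {c k} [c ->|c ->|c cs ks -> ? ?|c t k ->] //; exists ks. Qed.

Lemma weight_det h e c k k' : weight h e c k -> weight h e c k' -> k = k'.
Proof.
move=> W; elim: W k' => {c k} [c E|c E|c cs ks E sz _ IH|c t k E _ IH] k'
    /weight_inv; rewrite E //; last exact: IH.
move=> [ks' [-> sz' H]]; congr sumn; apply: (@eq_from_nth _ 0); first lia.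
by move=> i; rewrite sz => lti; apply/IH/H.
Qed.

(** [P] is closed under descending, so a subtree that starts in [P] only meets nodes on which the
    two heaps agree. *)
Lemma weight_restrict h h' e (P : ptr -> Prop) :
  (forall c, P c -> skel h c = skel h' c) ->
  (forall c cs j, P c -> skel h c = Some (SInner cs) -> j < size cs ->
    P (nth null cs j)) ->
  (forall c t, P c -> skel h c = Some (SRebuild t) -> P t) ->
  forall c k, weight h e c k -> P c -> weight h' e c k.
Proof.
move=> Hs Hi Hr c k; elim=> {c k} [c E|c E|c cs ks E sz _ IH|c t k E _ IH] Pc.
- by apply: weight_empty; rewrite -Hs.
- by apply: weight_single; rewrite -Hs.
- apply: (@weight_inner _ _ _ cs) => // [|i lti]; first by rewrite -Hs.
  by apply: IH => //; apply: Hi E _.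
- apply: (@weight_rebuild _ _ _ t); first by rewrite -Hs.
  by apply/IH/(Hr c).
Qed.

(* The subtrees in [P] do not change; those in [Q] contain the modified slot
   [i] of [n] at most once. *)
Lemma weight_update h h' e n cs i c' (P Q : ptr -> Prop) (R : nat -> nat -> Prop) :
  skel h n = Some (SInner cs) ->
  skel h' n = Some (SInner (set_nth null cs i c')) -> i < size cs ->
  (forall j, j < size cs -> j != i -> P (nth null cs j)) ->
  (forall c k, P c -> weight h e c k -> weight h' e c k) ->
  (forall x, weight h e (nth null cs i) x ->
    exists2 x', weight h' e c' x' & R x x') ->
  (forall c, Q c -> c <> n -> skel h c = skel h' c) ->
  (forall c ds, Q c -> c <> n -> skel h c = Some (SInner ds) -> exists j0, 
    [/\ forall j, j < size ds -> j != j0 -> P (nth null ds j) &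
     (j0 < size ds -> P (nth null ds j0) \/ Q (nth null ds j0))]) ->
  (forall c t, Q c -> skel h c = Some (SRebuild t) -> Q t) ->
  forall c k, weight h e c k -> Q c ->
  exists2 k', weight h' e c k' &
    k' = k \/ exists x x', R x x' /\ k + x' = k' + x.
Proof.
move=> En En' lti Pn HP Hc Hs Hi Hr c k.
elim=> {c k} [c E|c E|c ds ks E sz W IH|c t k E _ IH] Qc.
- exists e; last by left.
  by apply: weight_empty; rewrite -Hs // => Ec; rewrite Ec En in E.
- exists 1; last by left.
  by apply: weight_single; rewrite -Hs // => Ec; rewrite Ec En in E.
- have [Ec|Nc] : c = n \/ c <> n.
    by case: (c =P n); [left|right].
    have Ed : ds = cs by move: E; rewrite Ec En => -[].
    rewrite {}Ed in E sz W IH; rewrite {}Ec in Qc E *.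
    have [x' Wx' Rx] := Hc _ (W i lti).
    exists (sumn (set_nth 0 ks i x')).
      apply: (weight_inner En').
        by rewrite !size_set_nth sz.
      move=> j; rewrite size_set_nth (maxn_idPr lti) => ltj.
      rewrite !nth_set_nth /=; case: eqP => [_ //|/eqP Nj].
      by apply: HP; [exact: Pn|exact: W].
    right; exists (nth 0 ks i), x'; split=> //.
    have -> : x' = nth 0 (set_nth 0 ks i x') i by rewrite nth_set_nth /= eqxx.
    rewrite [in RHS]nth_set_nth /= eqxx.
    apply: sumn_one; first by rewrite size_set_nth sz (maxn_idPr lti).
      by rewrite sz.
    by move=> j _ /negPf Nj; rewrite nth_set_nth /= Nj.
  have [j0 [Hj Hj0]] := Hi c ds Qc Nc E.
  have E' : skel h' c = Some (SInner ds) by rewrite -Hs.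
  have [lt0|ge0] := ltnP j0 (size ds); last first.
    exists (sumn ks); last by left.
    apply: (weight_inner E') => // j ltj; apply: HP; last exact: W.
    by apply: Hj => //; apply/eqP => Ej; rewrite -Ej leqNgt ltj in ge0.
  have [Pj|Qj] := Hj0 lt0.
    exists (sumn ks); last by left.
    apply: (weight_inner E') => // j ltj; apply: HP; last exact: W.
    by have [->//|/eqP Nj] := j =P j0; apply: Hj.
  have [k' Wk' Hk'] := IH j0 lt0 Qj.
  exists (sumn (set_nth 0 ks j0 k')).
    apply: (weight_inner E'); first by rewrite size_set_nth sz (maxn_idPr lt0).
    move=> j ltj; rewrite nth_set_nth /=; case: eqP => [->//|/eqP Nj].
    by apply: HP; [exact: Hj|exact: W].
  have S : sumn ks + k' = sumn (set_nth 0 ks j0 k') + nth 0 ks j0.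
    rewrite -[X in _ + X = _](_ : nth 0 (set_nth 0 ks j0 k') j0 = k').
      apply: sumn_one; first by rewrite size_set_nth sz (maxn_idPr lt0).
        by rewrite sz.
      by move=> j _ /negPf Nj; rewrite nth_set_nth /= Nj.
    by rewrite nth_set_nth /= eqxx.
  case: Hk' => [Ek|[x [x' [Rx Hx]]]]; [left|right].
    by move: S; rewrite Ek; lia.
  by exists x, x'; split=> //; lia.
- have [k' Wk' Hk'] := IH (Hr c t Qc E).
  exists k' => //; apply: (weight_rebuild _ Wk').
  by rewrite -Hs // => Ec; rewrite Ec En in E.
Qed.

Lemma entries_weight h e c s : entries h c s ->
  (forall c, skel h c = Some SEmpty -> e = 0) -> weight h e c (size s).
Proof.
move=> H He; elim: H => {c s} [c E|c k v E|c u ss E sz _ IH|c t w q i s E _ IH].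
- have S : skel h c = Some SEmpty by rewrite /skel E.
  by rewrite /= -(He c S); apply: weight_empty.
- by apply: weight_single; rewrite /skel E.
- rewrite size_flatten; apply: (@weight_inner _ _ _ (children u)).
  + by rewrite /skel E.
  + by rewrite size_map.
  + by move=> i lti; rewrite (nth_map [::]) ?sz //; apply: IH; rewrite sz.
- by apply: (@weight_rebuild _ _ _ t); rewrite // /skel E.
Qed.

Lemma entries_keys h c s : entries h c s -> weight h 0 c (size s).
Proof. by move/entries_weight; apply. Qed.

Lemma entries_leaves h c s : entries h c s -> exists l, weight h 1 c l.
Proof.
elim=> {c s} [c E|c k v E|c u ss E sz _ IH|c t w q i s E _ [l W]].
- by exists 1; apply: weight_empty; rewrite /skel E.
- by exists 1; apply: weight_single; rewrite /skel E.
- have [|ks [szk W]] := @seq_choice _ 0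
    (fun i k => weight h 1 (nth null (children u) i) k) (size ss).
    by move=> i lti; apply: IH.
  exists (sumn ks); apply: (@weight_inner _ _ _ (children u)).
  + by rewrite /skel E.
  + by rewrite szk sz.
  + by move=> i lti; apply: W; rewrite sz.
- by exists l; apply: (@weight_rebuild _ _ _ t); rewrite // /skel E.
Qed.

Definition marked (u : inner) : Prop := status u <> clean.

(** Every DCSS on a child requires a clean status of its node, so a subtree whose Inner nodes are
    all marked never changes again. The number is its key count. Requiring a child excludes Inner
    nodes without any leaf. *)
Inductive frozen (h : heap) : ptr -> nat -> Prop :=
| frozen_empty c : node_at h c = Some (Empty K V) -> frozen h c 0
| frozen_single c k v : node_at h c = Some (Single k v) -> frozen h c 1
| frozen_inner c u ks : node_at h c = Some (Inner V u) -> marked u ->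
    0 < size (children u) -> size ks = size (children u) ->
    (forall i, i < size ks -> frozen h (nth null (children u) i) (nth 0 ks i)) ->
    frozen h c (sumn ks)
| frozen_rebuild c t w q i k : node_at h c = Some (Rebuild K V t w q i) ->
    frozen h t k -> frozen h c k.

Lemma frozen_keys h c k : frozen h c k -> weight h 0 c k.
Proof.
elim=> {c k} [c E|c k v E|c u ks E _ _ sz _ IH|c t w q i k E _ IH].
- by apply: weight_empty; rewrite /skel E.
- by apply: weight_single; rewrite /skel E.
- apply: (@weight_inner _ _ _ (children u)) => //; first by rewrite /skel E.
  by move=> i lti; apply: IH; rewrite sz.
- by apply: (@weight_rebuild _ _ _ t); rewrite // /skel E.
Qed.

(** Every Inner node has a child, so there is at least one leaf, and each key has a leaf of its own.
    An ideal tree on these keys has exactly [maxn 1 k] leaves, so it can take the place of the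
    subtree without increasing the number of leaves. *)
Lemma frozen_leaves h c k : frozen h c k -> exists2 l, weight h 1 c l & maxn 1 k <= l.
Proof.
elim=> {c k} [c E|c k v E|c u ks E _ pos sz _ IH|c t w q i k E _ [l W lel]].
- by exists 1 => //; apply: weight_empty; rewrite /skel E.
- by exists 1 => //; apply: weight_single; rewrite /skel E.
- have [|ls [szl W]] := @seq_choice _ 0 (fun i l =>
    weight h 1 (nth null (children u) i) l /\ maxn 1 (nth 0 ks i) <= l) (size ks).
    by move=> i /IH [l]; exists l.
  exists (sumn ls).
    apply: (@weight_inner _ _ _ (children u)); [by rewrite /skel E|lia|].
    by move=> i lti; apply: (W i _).1; rewrite sz.
  have H i : i < size ks -> maxn 1 (nth 0 ks i) <= nth 0 ls i by move/W => [].
  have : 0 < size ks by rewrite sz.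
  move: szl H; clear; elim: ks ls => [|x ks IH] [|y ls] //= [szl] H _.
  have := H 0 isT; case: ks szl IH H => [|x' ks] szl IH H /=; first lia.
  have /= := IH ls szl (fun i lti => H i.+1 lti) isT; lia.
- by exists l => //; apply: (@weight_rebuild _ _ _ t); rewrite // /skel E.
Qed.

(** * Ghost state and invariant *)

(* [KPriv t]: only known to thread [t]; [KSub op]: part of the newTarget of
   [op], not yet installed; [KPub]: installed at some time; [KDead]: garbage, or
   not allocated. *)
Inductive kind := KDead | KPriv of 'I_p | KSub of nat | KPub.

(* [an a]: the Inner ancestors of [a] and [a] itself, from the top, without the
   sentinel 0; [hm a]: the node and the index of the slot where [a] is, was or
   will be installed; [dn a]: the number of updates below [a] whose thread found
   the count of [a] below the threshold; [eg a]: the threads that are charged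
   one more update below [a]; [ic a]: those threads that have incremented the
   count of [a] for an update and not yet compared it. *)
Record state := State {
  hp : heap;
  kd : nat -> kind;
  an : nat -> seq nat;
  hm : nat -> nat * nat;
  dn : nat -> nat;
  eg : nat -> {set 'I_p};
  ic : nat -> {set 'I_p}
}.

Definition slot (h : heap) (x : nat * nat) : ptr :=
  if onth h x.1 is Some (Inner u) then nth null (children u) x.2 else null.

(** Rebuild nodes are transparent here: a slot taken over by a Rebuild node still leads to the
    target, so that parenthood among Inner nodes survives the start of a rebuild. *)
Definition inner_child (h : heap) (c : ptr) : option nat :=
  if c is Some b then
    match onth h b with
    | Some (Inner _) => Some b
    | Some (Rebuild t _ _ _) => t
    | _ => None
    end
  else None.

Definition new_target (h : heap) (b : nat) : ptr :=
  if onth h b is Some (Rebuild _ w _ _) then w else null.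

Definition complete (u : inner) : Prop :=
  degree u = size (children u) /\
  forall j, j < size (children u) -> nth null (children u) j <> null.

(* [closedx s L y]: an ancestor of [y] outside [L] has been replaced in its slot,
   possibly by a Rebuild node.  This is final, so a descent that starts from the
   root now, or has only passed nodes in [L], does not reach [y]. *)
Definition closedx (s : state) (L : seq nat) (y : nat) : Prop :=
  kd s y = KPub /\ exists x, [/\ x \in an s y, x \notin L, kd s x = KPub &
    slot (hp s) (hm s x) <> Some x].

Local Notation closed s y := (closedx s [::] y).

Definition up_kind (k k' : kind) : Prop :=
  match k with
  | KDead => True
  | KPriv t => [\/ k' = KPriv t, k' = KPub | exists op, k' = KSub op]
  | KSub op => k' = KSub op \/ k' = KPub
  | KPub => k' = KPub
  end.

(** As [hm] is a function, an Inner node cannot sit in two slots, which excludes sharing of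
    subtrees. Leaves are left free: they are immutable and have nothing below them. *)
Definition child_inv (s : state) (a j b : nat) : Prop :=
  match onth (hp s) b with
  | None => False
  | Some (Inner _) => [/\ kd s b = kd s a, hm s b = (a, j) & b <> 0]
  | Some (Rebuild _ _ _ _) => [/\ kd s a = KPub, kd s b = KPub & hm s b = (a, j)]
  | _ => True
  end.

(* In [nd_sub], the exception is the newTarget whose children are being built. *)
Record node_inv (s : state) (a : nat) (u : inner) : Prop := {
  nd_deg : degree u <= size (children u);
  nd_pos : 0 < size (children u);
  nd_up : a <> 0 -> exists v, [/\ onth (hp s) (hm s a).1 = Some (Inner V v),
    (hm s a).2 < size (children v), an s a = rcons (an s (hm s a).1) a &
    up_kind (kd s a) (kd s (hm s a).1)];
  nd_child : forall j b, nth null (children u) j = Some b -> child_inv s a j b;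
  nd_pub : kd s a = KPub -> complete u;
  nd_sub : forall op, kd s a = KSub op ->
    complete u \/ new_target (hp s) op = Some a;
  nd_marked : marked u -> closed s a;
  nd_fin : forall k b, status u = (k, true, b) -> frozen (hp s) (Some a) k
}.

(* [cnt] in [rebuildAndSetChild] *)
Definition share (k j : nat) : nat :=
  let t := Nat.sqrt k in if j < k %% t then (k %/ t).+1 else k %/ t.

Definition new_size (s : state) (b w k : nat) : Prop :=
  if k < T then kd s w = KSub b ->
    [/\ weight (hp s) 0 (Some w) k, weight (hp s) 1 (Some w) (maxn 1 k) &
      forall u, onth (hp s) w = Some (Inner V u) -> complete u]
  else exists u, [/\ onth (hp s) w = Some (Inner V u), initSize u = k,
    size (children u) = Nat.sqrt k &
    kd s w = KSub b -> forall j c e, e < 2 -> nth null (children u) j = Some c ->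
      weight (hp s) e (Some c) (share k j)].

(** Once the newTarget is public, the Rebuild node has left its slot. This is final, so a late
    helper cannot install the newTarget a second time. *)
Definition new_inv (s : state) (b v w : nat) : Prop :=
  [/\ w < size (hp s), kd s w = KSub b \/ kd s w = KPub,
      kd s w = KPub -> slot (hp s) (hm s b) <> Some b,
      forall u, onth (hp s) w = Some (Inner V u) -> hm s w = hm s b /\ w <> 0
    & exists2 k, frozen (hp s) (Some v) k & new_size s b w k].

Definition reb_inv (s : state) (b : nat) (t w q : ptr) (i : nat) : Prop :=
  exists v, [/\ t = Some v, q = Some (hm s b).1 /\ i = (hm s b).2,
    hm s v = hm s b /\ v <> 0,
    [/\ exists u, onth (hp s) v = Some (Inner V u), kd s v = KPub &
      slot (hp s) (hm s v) <> Some v] & forall w', w = Some w' -> new_inv s b v w'].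

Record struct_inv (s : state) : Prop := {
  i_alloc : forall a, kd s a <> KDead -> a < size (hp s);
  i_root : exists u, [/\ onth (hp s) 0 = Some (Inner V u), kd s 0 = KPub & an s 0 = [::]];
  i_ghost0 : forall a, kd s a <> KPub -> [/\ dn s a = 0, eg s a = set0 & ic s a = set0];
  i_node : forall a u, kd s a <> KDead -> onth (hp s) a = Some (Inner V u) -> node_inv s a u;
  i_reb : forall b t w q i, kd s b = KPub ->
    onth (hp s) b = Some (Rebuild K V t w q i) -> reb_inv s b t w q i;
  i_noreb : forall b op t w q i, kd s b = KSub op ->
    onth (hp s) b <> Some (Rebuild K V t w q i)
}.

Definition slack (s : state) (a : nat) := dn s a + #|eg s a|.

(* A child of an ideal tree on [n] keys gets at most [sqrt n + 1] keys, and one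
   built by [rebuildAndSetChild] at most [n / t + 1 <= t + 3] for [t = sqrt n]. *)
Definition slot_bound (n : nat) : nat := Nat.sqrt n + 3.

(* Rebuilds below a node of initial size at most 4 do not occur: each update
   below it makes its own count reach the threshold. *)
Record bound_inv (s : state) (a : nat) (u : inner) : Prop := {
  bd_low : forall k, weight (hp s) 0 (Some a) k -> initSize u <= k + slack s a;
  bd_up : forall l, weight (hp s) 1 (Some a) l -> l <= initSize u + slack s a;
  bd_slot : forall j l, j < size (children u) ->
    weight (hp s) 1 (nth null (children u) j) l ->
    l <= slot_bound (initSize u) + slack s a;
  bd_child : forall j v u', inner_child (hp s) (nth null (children u) j) = Some v ->
    onth (hp s) v = Some (Inner V u') ->
    initSize u' <= slot_bound (initSize u) + slack s a;
  bd_small : forall j b, initSize u <= 4 -> nth null (children u) j = Some b ->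
    match onth (hp s) b with
    | Some (Inner u') => initSize u' <= 4 /\ 1 < size (children u')
    | Some (Rebuild _ _ _ _) => False
    | _ => True
    end;
  bd_size : 1 < size (children u) \/ initSize u <= 4;
  bd_dn : dn s a = 0 \/ 4 * dn s a < initSize u;
  bd_count : dn s a + #|ic s a| <= Defs.count u
}.

Record tree_inv (s : state) : Prop := {
  inv_struct :> struct_inv s;
  inv_bound : forall a u, a <> 0 -> kd s a <> KDead ->
    onth (hp s) a = Some (Inner V u) -> bound_inv s a u
}.

(** The irreversible part of the evolution of a node. A marked node keeps its children because every
    DCSS on them requires a clean status, and null is never written into a slot. *)
Record inner_le (u u' : inner) : Prop := {
  le_init : initSize u' = initSize u;
  le_size : size (children u') = size (children u);
  le_deg : degree u <= degree u';
  le_count : Defs.count u <= Defs.count u';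
  le_marked : marked u -> marked u' /\ children u' = children u;
  le_nonnull : forall j, nth null (children u) j <> null ->
    nth null (children u') j <> null
}.

Definition node_le (x x' : node) : Prop :=
  match x with
  | Inner u => exists2 u', x' = Inner V u' & inner_le u u'
  | Rebuild t w q i => exists2 w', x' = Rebuild K V t w' q i & w = null \/ w' = w
  | _ => x' = x
  end.

Definition heap_le (h h' : heap) : Prop :=
  forall a x, onth h a = Some x -> exists2 x', onth h' a = Some x' & node_le x x'.

Definition shared (k : kind) : bool :=
  match k with KSub _ | KPub => true | _ => false end.

(** Holds across all steps, including those of the thread under consideration, and so is what
    remains after a call. [x_slot] expresses that being replaced is final. *)
Record ext (s s' : state) : Prop := {
  x_heap : heap_le (hp s) (hp s');
  x_pub : forall a, kd s a = KPub -> kd s' a = KPub;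
  x_sub : forall a op, kd s a = KSub op -> kd s' a = KSub op \/ kd s' a = KPub;
  x_an : forall a, shared (kd s a) -> an s' a = an s a;
  x_hm : forall a, shared (kd s a) -> hm s' a = hm s a;
  x_slot : forall a, kd s a = KPub -> slot (hp s) (hm s a) <> Some a ->
    slot (hp s') (hm s' a) <> Some a
}.

Definition same_own (t : 'I_p) (s s' : state) : Prop :=
  forall y, (t \in eg s' y) = (t \in eg s y) /\ (t \in ic s' y) = (t \in ic s y).

(** Adds to [ext] what no thread but [t] may change: the charges of [t] and its private nodes. This
    is what holds between two consecutive steps of [t]. *)
Record rely (t : 'I_p) (s s' : state) : Prop := {
  r_ext :> ext s s';
  r_own : same_own t s s';
  r_kd : forall a, kd s' a = KPriv t <-> kd s a = KPriv t;
  r_priv : forall a, kd s a = KPriv t ->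
    [/\ onth (hp s') a = onth (hp s) a, an s' a = an s a & hm s' a = hm s a]
}.

(** * Preorders on nodes, heaps and states *)

Lemma inner_le_refl u : inner_le u u.
Proof. by split. Qed.

Lemma inner_le_trans u v w : inner_le u v -> inner_le v w -> inner_le u w.
Proof.
move=> [a1 a2 a3 a4 a5 a6] [b1 b2 b3 b4 b5 b6]; split; try congruence.
- exact: leq_trans b3.
- exact: leq_trans b4.
- by move=> /a5 [/b5 [? ->]].
- by move=> j /a6 /b6.
Qed.

Lemma node_le_refl x : node_le x x.
Proof.
case: x => //= [u|t w q i]; first by exists u => //; apply: inner_le_refl.
by exists w => //; right.
Qed.

Lemma node_le_trans x y z : node_le x y -> node_le y z -> node_le x z.
Proof.
case: x => [|k v|u|t w q i] /=; try by move=> ->.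
  move=> [u' -> le1] /= [u'' -> le2]; exists u'' => //.
  exact: inner_le_trans le2.
move=> [w' -> le1] /= [w'' -> le2]; exists w'' => //.
case: le1 => [->|<-]; [by left|by []].
Qed.

Lemma ext_refl s : ext s s.
Proof. by split=> // [a x E|a op E]; [exists x => //; apply: node_le_refl|left]. Qed.

Lemma ext_shared s s' a : ext s s' -> shared (kd s a) -> shared (kd s' a).
Proof.
move=> X; case E: (kd s a) => [|t|op|] //= _.
  by case: (x_sub X E) => ->.
by rewrite (x_pub X E).
Qed.

Lemma ext_trans s s' s'' : ext s s' -> ext s' s'' -> ext s s''.
Proof.
move=> X Y; split.
- move=> a x E; have [x' E' le] := x_heap X E.
  have [x'' E'' le'] := x_heap Y E'; exists x'' => //; exact: node_le_trans le'.
- by move=> a /(x_pub X) /(x_pub Y).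
- move=> a op /(x_sub X) [/(x_sub Y)//|/(x_pub Y)]; by right.
- by move=> a S; rewrite (x_an Y) ?(x_an X) //; apply: ext_shared S.
- by move=> a S; rewrite (x_hm Y) ?(x_hm X) //; apply: ext_shared S.
- by move=> a P N; apply: (x_slot Y); [exact: (x_pub X)|exact: (x_slot X)].
Qed.

Lemma rely_refl t s : rely t s s.
Proof. by split=> //; apply: ext_refl. Qed.

Lemma rely_trans t s s' s'' : rely t s s' -> rely t s' s'' -> rely t s s''.
Proof.
move=> X Y; split; first exact: (ext_trans X Y).
- move=> y; have [e1 e2] := r_own Y y; have [e3 e4] := r_own X y; by rewrite e1 e2.
- by move=> a; rewrite (r_kd Y) (r_kd X).
- move=> a /[dup] E /(r_priv X) [e1 e2 e3].
  have /(r_priv Y) [f1 f2 f3] : kd s' a = KPriv t by apply/(r_kd X).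
  by rewrite f1 f2 f3.
Qed.

Lemma ext_inner s s' a u : ext s s' -> onth (hp s) a = Some (Inner V u) ->
  exists2 u', onth (hp s') a = Some (Inner V u') & inner_le u u'.
Proof. by move=> X /(x_heap X) [x' E [u' Ex le]]; exists u' => //; rewrite E Ex. Qed.

Lemma ext_rebuild s s' a t w q i : ext s s' ->
  onth (hp s) a = Some (Rebuild K V t w q i) ->
  exists2 w', onth (hp s') a = Some (Rebuild K V t w' q i) & w = null \/ w' = w.
Proof. by move=> X /(x_heap X) [x' E [w' Ex le]]; exists w' => //; rewrite E Ex. Qed.

Lemma frozen_le h h' c k : heap_le h h' -> frozen h c k -> frozen h' c k.
Proof.
move=> X; elim=> {c k} [[c|] E|[c|] k v E|[c|] u ks E M pos sz _ IH|[c|] t w q i k E _ IH] //.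
- by apply: frozen_empty; have [x' /= -> ->] := X _ _ E.
- by apply: (@frozen_single _ _ k v); have [x' /= -> ->] := X _ _ E.
- have [x' /= E' [u' Eu le]] := X _ _ E; have [M' Ec] := le_marked le M.
  apply: (@frozen_inner _ _ u') => //; rewrite ?Ec //.
  by rewrite /= E' Eu.
- have [x' /= E' [w' Eu le]] := X _ _ E.
  by apply: (@frozen_rebuild _ _ t w' q i); rewrite /= ?E' ?Eu.
Qed.

Lemma closedx_ext s s' L y : ext s s' -> closedx s L y -> closedx s' L y.
Proof.
move=> X [P [x [x1 x2 x3 x4]]]; split; first exact: (x_pub X).
exists x; split=> //; first by rewrite (x_an X) // P.
  exact: (x_pub X).
exact: (x_slot X).
Qed.

(** * Ancestors and disjoint subtrees *)

Section Struct.
Variable s : state.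
Hypothesis I : struct_inv s.

Lemma root_an : an s 0 = [::].
Proof. by have [u []] := i_root I. Qed.

Lemma tracked_pub a : kd s a = KPub -> kd s a <> KDead.
Proof. by move=> ->. Qed.

(** Induction along the homes: the list of a node is the list of its home followed by the node, and
    the home of a public node is public. *)
Lemma anc_pub a u : kd s a = KPub -> onth (hp s) a = Some (Inner V u) ->
  forall v, v \in an s a -> [/\ kd s v = KPub, v <> 0,
    exists u', onth (hp s) v = Some (Inner V u'),
    exists r, an s a = an s v ++ r & v \in an s v].
Proof.
move Em: (size (an s a)) => m; elim: m a u Em => [|m IH] a u Em Pa Ea v.
  by move: (an s a) Em => [].
have [a0|/eqP a0] := eqVneq a 0; first by rewrite a0 root_an.
have N := i_node I (tracked_pub Pa) Ea.
have [w [Ew _ Ean Uq]] := nd_up N a0.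
rewrite Pa /= in Uq.
rewrite Ean mem_rcons inE => /predU1P [->|vq].
  split=> //; [by exists u|by exists [::]; rewrite cats0 Ean|].
  by rewrite Ean mem_rcons inE eqxx.
have [|Pv v0 Ev [r Er] vv] := IH _ _ _ Uq Ew v vq.
  by move: Em; rewrite Ean size_rcons => -[].
by split=> //; exists (rcons r a); rewrite Er rcons_cat.
Qed.

Lemma an_self a u : kd s a <> KDead -> onth (hp s) a = Some (Inner V u) -> a <> 0 -> a \in an s a.
Proof.
move=> Pa Ea a0; have [v [_ _ -> _]] := nd_up (i_node I Pa Ea) a0.
by rewrite mem_rcons inE eqxx.
Qed.

(** Looking through a Rebuild node is harmless, as it shares its kind and its home with its
    target. *)
Lemma inner_child_inv a u j v : kd s a <> KDead -> onth (hp s) a = Some (Inner V u) ->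
  inner_child (hp s) (nth null (children u) j) = Some v ->
  [/\ v <> 0, kd s v = kd s a, hm s v = (a, j), an s v = rcons (an s a) v &
    exists u', onth (hp s) v = Some (Inner V u')].
Proof.
move=> Pa Ea; have N := i_node I Pa Ea.
case Ec: (nth _ _ _) => [b|] //=; have := nd_child N Ec; rewrite /child_inv.
case Eb: (onth _ b) => [[|||t w q i]|] //=.
  move=> [P H b0] [<-]; split=> //; last by eexists; exact: Eb.
  have Pb : kd s b <> KDead by rewrite P.
  by have [? [_ _ -> _]] := nd_up (i_node I Pb Eb) b0; rewrite H.
move=> [Pa' Pb H] Et.
have [v' [Ev [_ _] [H' v0] [[u' Ev'] Pv _] _]] := i_reb I Pb Eb.
move: Ev; rewrite Et => -[Ev]; rewrite -{v'}Ev in H' v0 Ev' Pv.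
split=> //; rewrite ?Pa' ?Pv //; first by rewrite H'.
  have [w' [_ _ -> _]] := nd_up (i_node I (tracked_pub Pv) Ev') v0.
  by rewrite H' H.
by exists u'.
Qed.

Definition ok_ptr (c : ptr) : Prop := forall v, inner_child (hp s) c = Some v ->
  kd s v <> KDead /\ exists u, onth (hp s) v = Some (Inner V u).

Lemma ok_child a u j : kd s a <> KDead -> onth (hp s) a = Some (Inner V u) ->
  ok_ptr (nth null (children u) j).
Proof.
move=> Pa Ea v Ev; have [_ -> _ _ H] := inner_child_inv Pa Ea Ev.
by split.
Qed.

Lemma ok_self a u : kd s a <> KDead -> onth (hp s) a = Some (Inner V u) -> ok_ptr (Some a).
Proof. by move=> Pa Ea v; rewrite /= Ea => -[<-]; split=> //; exists u. Qed.

(** [A] contains the parents of its members, so a descent that starts outside [A] never enters it,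
    and outside [A] the two heaps agree. *)
Lemma weight_avoid (h' : heap) (A : nat -> Prop) e c k :
  (forall b, ~ A b -> skel (hp s) (Some b) = skel h' (Some b)) ->
  (forall a, A a -> exists u, onth (hp s) a = Some (Inner V u)) ->
  (forall a u j v, kd s a <> KDead -> onth (hp s) a = Some (Inner V u) ->
     inner_child (hp s) (nth null (children u) j) = Some v -> A v -> A a) ->
  ok_ptr c -> (forall v, inner_child (hp s) c = Some v -> ~ A v) ->
  weight (hp s) e c k -> weight h' e c k.
Proof.
move=> Hs HA Hup ok av W.
apply: (@weight_restrict (hp s) h' e
  (fun c => ok_ptr c /\ forall v, inner_child (hp s) c = Some v -> ~ A v)) W _ => //.
- move=> {ok av}[b|] //= [ok av]; apply: Hs => Ab.
  have [u Eb] := HA _ Ab; by apply: (av b) => //=; rewrite Eb.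
- move=> {ok av}[b|] //= cs j [ok av]; rewrite /skel /=.
  case Eb: (onth _ b) => [[||u|]|] //= [<-] ltj.
  have /ok [Pb _] : inner_child (hp s) (Some b) = Some b by rewrite /= Eb.
  split; first exact: (ok_child Pb Eb).
  move=> v Ev Av; apply: (av b); first by rewrite /= Eb.
  exact: (Hup b u j v Pb Eb Ev Av).
- move=> {ok av}[b|] //= t [ok av]; rewrite /skel /=.
  case Eb: (onth _ b) => [[||u|t' w q i]|] //= [Et].
  move: ok av; rewrite /ok_ptr /= Eb {}Et => ok av.
  case: t ok av => [v|] //= ok av.
  have [Pv [u Ev]] := ok v erefl; rewrite Ev.
  by split=> v' [<-]; [split=> //; exists u|exact: av].
Qed.

Definition on_path (n v : nat) : Prop := v \in 0 :: an s n.

Lemma on_path_up n un : kd s n = KPub -> onth (hp s) n = Some (Inner V un) ->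
  forall a u j v, kd s a <> KDead -> onth (hp s) a = Some (Inner V u) ->
     inner_child (hp s) (nth null (children u) j) = Some v ->
     on_path n v -> kd s a = KPub /\ on_path n a /\ (a = n -> False).
Proof.
move=> Pn En a u j v Pa Ea Ev; rewrite /on_path inE => /predU1P [v0|vn].
  by have [] := inner_child_inv Pa Ea Ev.
have [v0 Pv Hv Av [u' Eu']] := inner_child_inv Pa Ea Ev.
have [Pv' _ _ [r Er] _] := anc_pub Pn En vn.
split; first by rewrite -Pv.
have Ean : an s n = an s a ++ v :: r by rewrite Er Av cat_rcons.
split; last first.
  by move=> Ea'; move: (congr1 size Ean); rewrite Ea' size_cat /=; lia.
rewrite inE; have [//|/eqP a0 /=] := eqVneq a 0.
by rewrite Ean mem_cat (an_self Pa Ea a0).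
Qed.

Lemma on_path_inner n un : kd s n = KPub -> onth (hp s) n = Some (Inner V un) ->
  forall v, on_path n v -> kd s v = KPub /\ exists u, onth (hp s) v = Some (Inner V u).
Proof.
move=> Pn En v; rewrite /on_path inE => /predU1P [->|vn].
  by have [u [? ? _]] := i_root I; split=> //; exists u.
by have [? _ ? _ _] := anc_pub Pn En vn.
Qed.

Lemma on_path_self n un : kd s n = KPub -> onth (hp s) n = Some (Inner V un) -> on_path n n.
Proof.
move=> Pn En; rewrite /on_path inE; have [//|/eqP n0 /=] := eqVneq n 0.
exact: an_self (tracked_pub Pn) En n0.
Qed.

Lemma weight_off_path n un (h' : heap) e c k :
  kd s n = KPub -> onth (hp s) n = Some (Inner V un) ->
  (forall b, b <> n -> skel (hp s) (Some b) = skel h' (Some b)) ->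
  ok_ptr c -> (forall v, inner_child (hp s) c = Some v -> ~ on_path n v) ->
  weight (hp s) e c k -> weight h' e c k.
Proof.
move=> Pn En Hs; apply: weight_avoid.
- by move=> b nb; apply: Hs => Eb; apply: nb; rewrite Eb; apply: on_path_self En.
- by move=> a /(on_path_inner Pn En) [].
- by move=> a u j v Pa Ea Ev /(on_path_up Pn En Pa Ea Ev) [_ []].
Qed.

(** Two children of [a] on the path extend the list of [a] by one entry to prefixes of the list of
    [n]. Prefixes of equal length coincide, hence so do the children and their homes. *)
Lemma on_path_child n un a u j v j' v' :
  kd s n = KPub -> onth (hp s) n = Some (Inner V un) ->
  kd s a <> KDead -> onth (hp s) a = Some (Inner V u) ->
  inner_child (hp s) (nth null (children u) j) = Some v -> on_path n v ->
  inner_child (hp s) (nth null (children u) j') = Some v' -> on_path n v' ->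
  j = j'.
Proof.
move=> Pn En Pa Ea Ev; rewrite /on_path !inE => ov Ev' ov'.
have [v0 _ Hv Av _] := inner_child_inv Pa Ea Ev.
have [v0' _ Hv' Av' _] := inner_child_inv Pa Ea Ev'.
move: ov ov' => /predU1P [//|ov] /predU1P [//|ov'].
have [_ _ _ [r Er] _] := anc_pub Pn En ov.
have [_ _ _ [r' Er'] _] := anc_pub Pn En ov'.
have : an s v ++ r = an s v' ++ r' by rewrite -Er -Er'.
rewrite Av Av' !cat_rcons => /eqP; rewrite eqseq_cat // eqxx /= eqseq_cons.
by move=> /andP [/eqP Evv _]; move: Hv'; rewrite -Evv Hv => -[].
Qed.

(** In [weight_update], the nodes on the path to [n] form [Q], and whatever hangs beside the path
    forms [P]. *)
Lemma weight_on_path n un (h' : heap) e i c' (R : nat -> nat -> Prop) c k :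
  kd s n = KPub -> onth (hp s) n = Some (Inner V un) -> i < size (children un) ->
  (forall b, b <> n -> skel (hp s) (Some b) = skel h' (Some b)) ->
  skel h' (Some n) = Some (SInner (set_nth null (children un) i c')) ->
  (forall x, weight (hp s) e (nth null (children un) i) x ->
    exists2 x', weight h' e c' x' & R x x') ->
  weight (hp s) e c k ->
  (exists2 v, inner_child (hp s) c = Some v & on_path n v) ->
  exists2 k', weight h' e c k' &
    k' = k \/ exists x x', R x x' /\ k + x' = k' + x.
Proof.
move=> Pn En lti Hs Hs' Hc W Qc.
have sk a u : onth (hp s) a = Some (Inner V u) -> skel (hp s) (Some a) = Some (SInner (children u)).
  by rewrite /skel /= => ->.
apply: (@weight_update (hp s) h' e (Some n) (children un) i c'
  (fun c => ok_ptr c /\ forall v, inner_child (hp s) c = Some v -> ~ on_path n v)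
  (fun c => exists2 v, inner_child (hp s) c = Some v & on_path n v) R
  (sk _ _ En) Hs' lti _ _ Hc _ _ _ _ _ W Qc) => {c k W Qc}.
- move=> j ltj Nj; split; first exact: (ok_child (tracked_pub Pn) En).
  by move=> v Ev ov; have [_ [_ []]] := on_path_up Pn En (tracked_pub Pn) En Ev ov.
- by move=> c k [ok av]; apply: (weight_off_path Pn En).
- by move=> [b|] // _ Nb; apply: Hs => Eb; apply: Nb; rewrite Eb.
- move=> [b|] //= ds [v Ev ov] Nb; rewrite /skel /=.
  move: Ev; case Eb: (onth _ b) => [[||u|]|] //= [Ev] [<-].
  rewrite -{v}Ev in ov; have [Pb _] := on_path_inner Pn En ov.
  have Pb' := tracked_pub Pb.
  (* [A j]: slot [j] continues the path to [n]. No slot does if the next ancestor of [n] has been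
     replaced. *)
  pose A j := if inner_child (hp s) (nth null (children u) j) is Some v then
    v \in 0 :: an s n else false.
  have [/hasP [j0 _ Aj]|] := boolP (has A (iota 0 (size (children u)))).
    exists j0; split; last first.
      move=> _; right; move: Aj; rewrite /A; case E: (inner_child _ _) => [v|] // ov'.
      by exists v.
    move=> j ltj /eqP Nj; split; first exact: (ok_child Pb' Eb).
    move=> v Ev ov'; apply: Nj; move: Aj; rewrite /A.
    by case E: (inner_child _ _) => [v0|] // ov0; apply: on_path_child Ev ov' E ov0; eassumption.
  move=> /hasPn NA; exists 0.
  have H j : j < size (children u) -> ok_ptr (nth null (children u) j) /\
     (forall v, inner_child (hp s) (nth null (children u) j) = Some v -> ~ on_path n v).
    move=> ltj; split; first exact: (ok_child Pb' Eb).
    have := NA j; rewrite mem_iota ltj /A => /(_ isT) + v Ev; rewrite Ev.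
    by move/negP.
  by split=> [j ltj _|lt0]; [exact: H|left; exact: H].
- move=> [b|] //= t [v Ev ov]; rewrite /skel /=.
  move: Ev; case Eb: (onth _ b) => [[||u|t' w q i']|] //= -> [<-].
  have [Pv [u Ev]] := on_path_inner Pn En ov.
  by exists v => //=; rewrite Ev.
Qed.

End Struct.

(** * Changing a node in place *)

Definition replaced (h : heap) (a : nat) (x : node) (h' : heap) : Prop :=
  size h' = size h /\
  forall b, onth h' b = if b == a then Some x else onth h b.

Lemma replaced_update h a x f : onth h a = Some x ->
  replaced h a (f x) (update h (Some a) f).
Proof.
move=> E; have lta := onth_ltn E; rewrite /update /= E; split.
  by rewrite size_set_nth (maxn_idPr lta).
by move=> b; apply: onth_set_nth.
Qed.

Lemma replaced_inner h a u f : onth h a = Some (Inner V u) ->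
  replaced h a (Inner V (f u)) (update_inner h (Some a) f).
Proof. by move=> E; apply: replaced_update E. Qed.

Lemma weight_mono (h h' : heap) e c k :
  (forall c x, skel h c = Some x -> skel h' c = Some x) ->
  weight h e c k -> weight h' e c k.
Proof.
move=> H; elim=> {c k} [c /H E|c /H E|c cs ks /H E sz _ IH|c t k /H E _ IH].
- exact: weight_empty.
- exact: weight_single.
- exact: weight_inner IH.
- exact: weight_rebuild IH.
Qed.

Lemma replaced_le h a u u' h' : onth h a = Some (Inner V u) -> inner_le u u' ->
  replaced h a (Inner V u') h' -> heap_le h h'.
Proof.
move=> E le [_ H] b x Eb; rewrite H; case: (b =P a) Eb => [->|_] Eb.
  by exists (Inner V u') => //; move: Eb; rewrite E => -[<-]; exists u'.
by exists x => //; apply: node_le_refl.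
Qed.

Definition with_heap (s : state) (h : heap) : state :=
  State h (kd s) (an s) (hm s) (dn s) (eg s) (ic s).

Lemma closedx_static (s s' : state) L y :
  kd s' =1 kd s -> an s' =1 an s -> hm s' =1 hm s ->
  (forall x, slot (hp s') x = slot (hp s) x) ->
  closedx s L y -> closedx s' L y.
Proof.
move=> Ek Ea Eh Es [P [x [x1 x2 x3 x4]]]; split; first by rewrite Ek.
by exists x; rewrite Ea Ek Eh Es.
Qed.

(** * Attributes other than the children *)

Section Attr.
Variables (s : state) (a : nat) (u u' : inner) (h' : heap).
Hypotheses (I : tree_inv s) (Ea : onth (hp s) a = Some (Inner V u)).
Hypotheses (R : replaced (hp s) a (Inner V u') h') (le : inner_le u u').
Hypothesis Ech : children u' = children u.
Let s' := with_heap s h'.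

Lemma attr_onth b : b <> a -> onth h' b = onth (hp s) b.
Proof. by move=> /eqP /negPf N; rewrite R.2 N. Qed.

Lemma attr_self : onth h' a = Some (Inner V u').
Proof. by rewrite R.2 eqxx. Qed.

Lemma attr_skel c : skel h' c = skel (hp s) c.
Proof.
case: c => [b|] //; rewrite /skel /= R.2; case: (b =P a) => [->|//].
by rewrite Ea /= Ech.
Qed.

Lemma attr_slot x : slot h' x = slot (hp s) x.
Proof. by rewrite /slot R.2; case: (x.1 =P a) => [->|//]; rewrite Ea Ech. Qed.

Lemma attr_child c : inner_child h' c = inner_child (hp s) c.
Proof. by case: c => [b|] //=; rewrite R.2; case: (b =P a) => [->|//]; rewrite Ea. Qed.

Lemma attr_target b : new_target h' b = new_target (hp s) b.
Proof. by rewrite /new_target R.2; case: (b =P a) => [->|//]; rewrite Ea. Qed.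

Lemma attr_weight e c k : weight h' e c k <-> weight (hp s) e c k.
Proof. by split; apply: weight_mono => d x; rewrite attr_skel. Qed.

Lemma attr_inner b v : onth h' b = Some (Inner V v) ->
  exists v0, [/\ onth (hp s) b = Some (Inner V v0), children v = children v0,
    initSize v = initSize v0, Defs.count v0 <= Defs.count v & b <> a -> v = v0].
Proof.
rewrite R.2; case: (b =P a) => [->|Nb].
  by move=> [<-]; exists u; rewrite Ea Ech (le_init le) (le_count le).
by move=> ->; exists v.
Qed.

Lemma attr_inner_le b v : onth (hp s) b = Some (Inner V v) ->
  exists v0, [/\ onth h' b = Some (Inner V v0), children v0 = children v &
    initSize v0 = initSize v].
Proof.
rewrite R.2; case: (b =P a) => [->|Nb].
  by rewrite Ea => -[<-]; exists u'; rewrite (le_init le).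
by move=> ->; exists v.
Qed.

Lemma attr_heap_le : heap_le (hp s) h'.
Proof. exact: replaced_le Ea le R. Qed.

Lemma attr_ext : ext s s'.
Proof.
split=> //=; [exact: attr_heap_le|by left|].
by move=> b Pb; rewrite attr_slot.
Qed.

Hypotheses (Pa : shared (kd s a)) (Hdeg : degree u' <= size (children u))
 (Hpub : kd s a = KPub -> degree u' = degree u)
 (Hm : marked u' -> closed s a)
 (Hf : forall k b, status u' = (k, true, b) -> frozen h' (Some a) k).

Lemma attr_complete b v v0 : onth h' b = Some (Inner V v) ->
  onth (hp s) b = Some (Inner V v0) -> complete v0 -> complete v.
Proof.
rewrite R.2; case: (b =P a) => [->|_]; last by move=> -> [->].
rewrite Ea => -[<-] [<-] [D C]; split; last by rewrite Ech.
by apply/eqP; rewrite eqn_leq Ech Hdeg -D; apply: (le_deg le).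
Qed.

Lemma attr_inv : tree_inv s'.
Proof.
split; first split=> /=.
- by move=> b /(i_alloc I); rewrite R.1.
- have [v [Ev P0 A0]] := i_root I.
  by have [v0 [Ev0 _ _]] := attr_inner_le Ev; exists v0.
- exact: (i_ghost0 I).
- move=> b v Pb Ev; have [v0 [Ev0 Ec Ei _ Ev1]] := attr_inner Ev.
  have N := i_node I Pb Ev0.
  have le0 : inner_le v0 v.
    case: (b =P a) => [Eb|/Ev1 ->]; last exact: inner_le_refl.
    by move: Ev Ev0; rewrite Eb attr_self Ea => -[<-] [<-].
  have dle : degree v <= size (children v).
    case: (b =P a) => [Eb|/Ev1 ->]; last exact: nd_deg N.
    by move: Ev; rewrite Eb attr_self => -[<-]; rewrite Ech.
  split=> //.
  + by rewrite Ec; apply: nd_pos N.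
  + move=> b0; have [w [Ew ? ? ?]] := nd_up N b0.
    by have [w0 [Ew0 Ew1 _]] := attr_inner_le Ew; exists w0; rewrite Ew1.
  + move=> j c; rewrite Ec => /(nd_child N); rewrite /child_inv /= R.2.
    by case: (c =P a) => [->|//]; rewrite Ea.
  + move=> Pub; have [D C] := nd_pub N Pub; split; last by rewrite Ec.
    apply/eqP; rewrite eqn_leq dle /= Ec -D; exact: le_deg.
  + move=> op Sub; have [[D C]|Tg] := nd_sub N Sub; [left|by right; rewrite attr_target].
    split; last by rewrite Ec.
    apply/eqP; rewrite eqn_leq dle /= Ec -D; exact: le_deg.
  + have S : closed s b -> closed s' b by apply: closedx_static => // x; apply: attr_slot.
    case: (b =P a) => [Eb|/Ev1 Eb M]; last by apply/S/(nd_marked N); rewrite -Eb.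
    by move: Ev; rewrite Eb attr_self => -[<-] /Hm; rewrite -Eb.
  + case: (b =P a) => [Eb|/Ev1 Eb k y Est].
      by move: Ev; rewrite Eb attr_self => -[<-]; apply: Hf.
    by apply: frozen_le attr_heap_le _; apply: (nd_fin N (b := y)); rewrite -Eb.
- move=> b t w q i Pb; rewrite R.2; case: (b =P a) => // _ Eb.
  have [v [E1 E2 E3 [[uv Ev] Pv Sv] Hw]] := i_reb I Pb Eb.
  exists v; split=> //.
    split=> //; last by rewrite attr_slot.
    by have [v0 [Ev0 _ _]] := attr_inner_le Ev; exists v0.
  move=> w' /Hw [w1 w2 w3 w4 [k Fr Nk]]; split=> //=.
  + by rewrite R.1.
  + by rewrite attr_slot.
  + by move=> v1 /attr_inner [v0 [/w4]].
  exists k; first exact: frozen_le attr_heap_le _.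
  move: Nk; rewrite /new_size /=; case: ifP => _.
    move=> H Sw; have [H0 H1 H2] := H Sw; split; rewrite ?attr_weight //.
    move=> v1 Ev1; have [v2 [Ev2 _ _ _ _]] := attr_inner Ev1.
    exact: attr_complete Ev1 Ev2 (H2 _ Ev2).
  move=> [u1 [Eu1 n1 n2 n3]]; have [u2 [Eu2 m1 m2]] := attr_inner_le Eu1.
  exists u2; rewrite m1 m2; split=> // Sw j c e lte Ec.
  by rewrite attr_weight; apply: n3.
- move=> b op t w q i Sb; rewrite R.2; case: (b =P a) => // _.
  exact: (i_noreb I Sb).
move=> b v b0 Pb Ev; have [v0 [Ev0 Ec Ei Lc Ev1]] := attr_inner Ev.
have B := inv_bound I b0 Pb Ev0.
split; rewrite ?Ei ?Ec.
- by move=> k; rewrite attr_weight; apply: (bd_low B).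
- by move=> k; rewrite attr_weight; apply: (bd_up B).
- by move=> j l ltj; rewrite attr_weight; apply: (bd_slot B).
- move=> j w w' /=; rewrite attr_child => Ew /attr_inner [w0 [Ew0 _ -> _ _]].
  exact: (bd_child B) Ew Ew0.
- move=> j c le4 /(bd_small B le4) /=; rewrite R.2.
  by case: (c =P a) => [->|//]; rewrite Ea (le_init le) (le_size le).
- exact: bd_size B.
- exact: bd_dn B.
- exact: leq_trans (bd_count B) Lc.
Qed.

Lemma attr_rely t : rely t s s'.
Proof.
split=> //=; first exact: attr_ext.
move=> b Pb; split=> //; apply: attr_onth => Eb.
by move: Pa; rewrite -Eb Pb.
Qed.

End Attr.

(** * Changes of the ghost state only *)

Section Ghosts.
Variables (s : state) (dn' : nat -> nat) (eg' ic' : nat -> {set 'I_p}).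
Let s' : state := State (hp s) (kd s) (an s) (hm s) dn' eg' ic'.
Hypothesis I : tree_inv s.
Hypothesis H0 : forall a, kd s a <> KPub -> [/\ dn' a = 0, eg' a = set0 & ic' a = set0].
Hypothesis H1 : forall a u, a <> 0 -> kd s a = KPub -> onth (hp s) a = Some (Inner V u) ->
  [/\ slack s a <= dn' a + #|eg' a|, dn' a = 0 \/ 4 * dn' a < initSize u &
   dn' a + #|ic' a| <= Defs.count u].

Lemma ghost_inv : tree_inv s'.
Proof.
split; first split=> /=.
- exact: (i_alloc I).
- exact: (i_root I).
- exact: H0.
- by move=> a u Pa Ea; case: (i_node I Pa Ea) => *; split.
- by move=> b t w q i Pb Eb; apply: (i_reb I).
- by move=> b op t w q i Sb; apply: (i_noreb I Sb).
move=> a u a0 Pa Ea; have B := inv_bound I a0 Pa Ea.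
have [le Hd Hc] : [/\ slack s a <= dn' a + #|eg' a|, dn' a = 0 \/ 4 * dn' a < initSize u &
   dn' a + #|ic' a| <= Defs.count u].
  have [Pub|NP] : kd s a = KPub \/ kd s a <> KPub.
  - by case: (kd s a) => [|t|op|]; by [right|left].
  - exact: (H1 a0).
  - have [e1 e2 e3] := H0 NP; have [f1 f2 f3] := i_ghost0 I NP.
    by rewrite /slack e1 e2 e3 f1 f2 cards0; split=> //; left.
case: B => b1 b2 b3 b4 b5 b6 b7 b8; split=> //.
- by move=> k /b1 L; apply: leq_trans L _; rewrite leq_add2l.
- by move=> k /b2 L; apply: leq_trans L _; rewrite leq_add2l.
- by move=> j l ltj /(b3 j l ltj) L; apply: leq_trans L _; rewrite leq_add2l.
- by move=> j w w' Ew Ew'; apply: leq_trans (b4 j w w' Ew Ew') _; rewrite leq_add2l.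
Qed.

Lemma ghost_ext : ext s s'.
Proof. by have [] := ext_refl s; split. Qed.

Lemma ghost_rely t : (forall y, (t \in eg' y) = (t \in eg s y) /\ (t \in ic' y) = (t \in ic s y)) ->
  rely t s s'.
Proof. by split=> //; apply: ghost_ext. Qed.

End Ghosts.

(** * Changing a slot *)

(* Slot [i] of [n] receives [r], and all nodes of kind [k0] become public.  This
   covers the three DCSS operations on the tree: an update ([k0 = KPriv t] and
   [e = 1]), the installation of a Rebuild node ([k0 = KPriv t] and [e = 0]) and
   of its newTarget ([k0 = KSub op] and [e = 0]). *)
Section Slot.

Definition same_kind (k k' : kind) : bool :=
  match k, k' with
  | KDead, KDead | KPub, KPub => true
  | KPriv t, KPriv t' => t == t'
  | KSub b, KSub b' => b == b'
  | _, _ => false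
  end.

Lemma same_kindP k k' : reflect (k = k') (same_kind k k').
Proof.
apply: (iffP idP) => [|->].
  by case: k k' => [|t|b|] [|t'|b'|] //= /eqP ->.
by case: k' => //= *; rewrite eqxx.
Qed.

Definition move_kind (k0 k1 : kind) (f : nat -> kind) (a : nat) : kind :=
  if same_kind (f a) k0 then k1 else f a.

Lemma move_kind_in k0 k1 f a : f a = k0 -> move_kind k0 k1 f a = k1.
Proof. by move=> E; rewrite /move_kind; case: same_kindP. Qed.

Lemma move_kind_out k0 k1 f a : f a <> k0 -> move_kind k0 k1 f a = f a.
Proof. by move=> E; rewrite /move_kind; case: same_kindP. Qed.

Definition set_child (u : inner) (i : nat) (c : ptr) : inner :=
  MkInner (initSize u) (degree u) (keys u) (set_nth null (children u) i c)
    (status u) (Defs.count u) (nextMark u).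

Variables (s : state) (n i r e : nat) (un : inner) (h' : heap).
Variables (eg' : nat -> {set 'I_p}) (k0 : kind).

Let s' : state := State h' (move_kind k0 KPub (kd s)) (an s) (hm s) (dn s) eg' (ic s).
Let c := nth null (children un) i.

Hypotheses (I : tree_inv s) (Pn : kd s n = KPub).
Hypotheses (En : onth (hp s) n = Some (Inner V un)) (lti : i < size (children un)).
Hypothesis clean_n : status un = clean.
Hypothesis R : replaced (hp s) n (Inner V (set_child un i (Some r))) h'.
Hypothesis k0_unpub : k0 <> KPub /\ k0 <> KDead.
Hypothesis C1 : forall a u, kd s a = k0 -> onth (hp s) a = Some (Inner V u) -> complete u.
Hypothesis C2 : forall a u, kd s a = k0 -> onth (hp s) a = Some (Inner V u) ->
  kd s (hm s a).1 = k0 \/ kd s (hm s a).1 = KPub.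
Hypothesis C3 : forall b t w q j, kd s b = k0 -> onth (hp s) b = Some (Rebuild K V t w q j) ->
  exists v, [/\ t = Some v /\ w = null, q = Some (hm s b).1 /\ j = (hm s b).2,
    hm s v = hm s b /\ v <> 0, (exists u, onth (hp s) v = Some (Inner V u)) /\ kd s v = KPub &
    hm s v = (n, i)].
Hypothesis Kr : kd s r = k0.
Hypothesis C4 : match onth (hp s) r with
  | Some (Inner _) => hm s r = (n, i) /\ r <> 0
  | Some (Rebuild _ _ _ _) => hm s r = (n, i)
  | Some _ => True
  | None => False end.
Hypothesis C6 : forall op, k0 = KSub op -> hm s op = (n, i).
Hypothesis R0 : forall x', weight h' 0 (Some r) x' ->
  exists2 x, weight (hp s) 0 c x & x <= x' + e.
Hypothesis R1 : forall x', weight h' 1 (Some r) x' ->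
  exists2 x, weight (hp s) 1 c x & x' <= x + e.
Hypothesis E1 : forall a, a <> 0 -> on_path s n a -> #|eg' a| = #|eg s a| + e.
Hypothesis E2 : forall a, ~ on_path s n a -> eg' a = eg s a.
Hypothesis C7 : n <> 0 -> forall v u', inner_child (hp s) (Some r) = Some v ->
  onth (hp s) v = Some (Inner V u') ->
  initSize u' <= slot_bound (initSize un) + slack s n + e.
Hypothesis C8 : n <> 0 -> initSize un <= 4 -> match onth (hp s) r with
    | Some (Inner u') => initSize u' <= 4 /\ 1 < size (children u')
    | Some (Rebuild _ _ _ _) => False
    | _ => True
    end.

Lemma slot_other b : b <> n -> onth h' b = onth (hp s) b.
Proof. by move=> /eqP /negPf N; rewrite R.2 N. Qed.

Lemma slot_self : onth h' n = Some (Inner V (set_child un i (Some r))).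
Proof. by rewrite R.2 eqxx. Qed.

Lemma size_set_child : size (children (set_child un i (Some r))) = size (children un).
Proof. by rewrite /= size_set_nth (maxn_idPr lti). Qed.

Lemma nth_set_child j :
  nth null (children (set_child un i (Some r))) j = if j == i then Some r else nth null (children un) j.
Proof. by rewrite /= nth_set_nth. Qed.

Lemma set_child_le : inner_le un (set_child un i (Some r)).
Proof.
split=> //; first exact: size_set_child.
by move=> j; rewrite nth_set_child; case: eqP.
Qed.

Lemma slot_heap_le : heap_le (hp s) h'.
Proof. exact: replaced_le En set_child_le R. Qed.

Lemma slot_kind_r : forall b, kd s b = KPub -> b <> r.
Proof. by move=> b Pb Eb; case: k0_unpub => + _; rewrite -Kr -Eb Pb. Qed.

Lemma slot_slot x : slot h' x = if x == (n, i) then Some r else slot (hp s) x.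
Proof.
rewrite /slot R.2; case: x => x1 x2 /=; rewrite xpair_eqE.
case: (x1 =P n) => [->|//] /=; by rewrite nth_set_nth /= En.
Qed.

Lemma slot_persist b : kd s b = KPub -> slot (hp s) (hm s b) <> Some b ->
  slot h' (hm s b) <> Some b.
Proof.
move=> Pb; rewrite slot_slot; case: eqP => // _ _ [Er].
by case: (slot_kind_r Pb).
Qed.

Lemma slot_child d : inner_child h' d = inner_child (hp s) d.
Proof. by case: d => [b|] //=; rewrite R.2; case: (b =P n) => [->|//]; rewrite En. Qed.

Lemma slot_target b : new_target h' b = new_target (hp s) b.
Proof. by rewrite /new_target R.2; case: (b =P n) => [->|//]; rewrite En. Qed.

Lemma slot_skel b : b <> n -> skel (hp s) (Some b) = skel h' (Some b).
Proof. by move=> nb; rewrite /skel /= slot_other. Qed.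

Lemma slot_inner b v : onth h' b = Some (Inner V v) ->
  exists v0, [/\ onth (hp s) b = Some (Inner V v0), initSize v = initSize v0,
    Defs.count v = Defs.count v0, size (children v) = size (children v0) &
    degree v = degree v0 /\ status v = status v0].
Proof.
rewrite R.2; case: (b =P n) => [->|Nb].
  by move=> [<-]; exists un; rewrite En size_set_child.
by move=> ->; exists v.
Qed.

Lemma slot_inner_le b v : onth (hp s) b = Some (Inner V v) ->
  exists v0, [/\ onth h' b = Some (Inner V v0), size (children v0) = size (children v) &
    initSize v0 = initSize v].
Proof.
rewrite R.2; case: (b =P n) => [->|Nb].
  by rewrite En => -[<-]; exists (set_child un i (Some r)); rewrite size_set_child.
by move=> ->; exists v.
Qed.

Lemma slot_children b v v0 j : onth h' b = Some (Inner V v) -> onth (hp s) b = Some (Inner V v0) ->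
  nth null (children v) j = nth null (children v0) j \/
  [/\ b = n, j = i, v0 = un & nth null (children v) j = Some r].
Proof.
rewrite R.2; case: (b =P n) => [->|Nb].
  rewrite En => -[<-] [<-]; rewrite nth_set_child.
  by case: (j =P i) => [->|_]; [right|left].
by move=> -> [->]; left.
Qed.

Lemma slot_pub b : kd s b = KPub -> move_kind k0 KPub (kd s) b = KPub.
Proof. by move=> Pb; rewrite /move_kind Pb; case: ifP. Qed.

Lemma slot_kd b : (kd s b = k0 /\ move_kind k0 KPub (kd s) b = KPub) \/
  (kd s b <> k0 /\ move_kind k0 KPub (kd s) b = kd s b).
Proof. by rewrite /move_kind; case: same_kindP; [left|right]. Qed.

Lemma slot_pubE b : move_kind k0 KPub (kd s) b = KPub -> kd s b = KPub \/ kd s b = k0.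
Proof. by have [[-> _]|[_ ->]] := slot_kd b; [right|left]. Qed.

Lemma slot_tracked b : move_kind k0 KPub (kd s) b <> KDead -> kd s b <> KDead.
Proof.
have [[-> _]|[_ ->]] := slot_kd b => //.
by case: k0_unpub.
Qed.

Lemma slot_ext : ext s s'.
Proof.
split=> //=.
- exact: slot_heap_le.
- exact: slot_pub.
- move=> b op Sb; have [[_ ->]|[_ ->]] := slot_kd b; by [right|left].
- exact: slot_persist.
Qed.

Lemma slot_complete b v v0 : onth h' b = Some (Inner V v) ->
  onth (hp s) b = Some (Inner V v0) -> complete v0 -> complete v.
Proof.
move=> Ev Ev0 [D C]; have [v1 [Ev1 _ _ Esz [Ed _]]] := slot_inner Ev.
move: Ev1; rewrite Ev0 => -[Ev1]; rewrite -{}Ev1 in Esz Ed.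
split=> [|j]; first by rewrite Ed Esz.
have [-> |[_ _ _ -> //]] := slot_children j Ev Ev0.
by rewrite Esz; apply: C.
Qed.

(** Kept apart from [slot_inv], where the comparison of weights already uses the structural
    invariant of the new state. *)
Lemma slot_struct : struct_inv s'.
Proof.
split=> /=.
- by move=> b /slot_tracked /(i_alloc I); rewrite R.1.
- have [v [Ev P0 A0]] := i_root I.
  have [v0 [Ev0 _ _]] := slot_inner_le Ev; exists v0; split=> //.
  exact: slot_pub.
- move=> a Na; have Na' : kd s a <> KPub by move=> Pa; apply/Na/slot_pub.
  have [? ? ?] := i_ghost0 I Na'; rewrite E2 // => oa.
  by have [] := on_path_inner I Pn En oa.
- move=> b v /slot_tracked Pb Ev; have [v0 [Ev0 Ei Ect Esz [Ed Est]]] := slot_inner Ev.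
  have N := i_node I Pb Ev0.
  have Cpl : complete v0 -> complete v := slot_complete Ev Ev0.
  split=> //.
  + by rewrite Ed Esz (nd_deg N).
  + by rewrite Esz (nd_pos N).
  + move=> b0; have [w [Ew W2 W3 W4]] := nd_up N b0.
    have [w0 [Ew0 Ew1 _]] := slot_inner_le Ew; exists w0; rewrite Ew1; split=> //.
    rewrite /=; have [[Ek ->]|[Nk ->]] := slot_kd b.
      by have [/move_kind_in ->|/slot_pub ->] := C2 Ek Ev0.
    move: W4; have [[Eq ->]|[Nq ->]] := slot_kd (hm s b).1 => //.
    case: (kd s b) => [|t|op|] //=; rewrite ?Eq.
    * by move=> _; apply: Or32.
    * by right.
  + move=> j x; have [-> /(nd_child N)|[Eb Ej Ev1 ->] [<-]] := slot_children j Ev Ev0.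
      rewrite /child_inv /= R.2; case: (x =P n) => [->|_].
        rewrite En => -[E ? ?]; split=> //; rewrite /move_kind; by rewrite E.
      case: (onth _ x) => [[|? ?|?|t w q y]|] //.
        by move=> [E ? ?]; split=> //; rewrite /move_kind E.
      by move=> [Ea Ex ?]; split=> //; apply: slot_pub.
    rewrite /child_inv /= slot_other; last by move=> Er; have [] := slot_kind_r Pn.
    have Pr' : move_kind k0 KPub (kd s) r = KPub by apply: move_kind_in.
    move: C4; rewrite Eb Ej; case: (onth _ r) => [[|? ?|?|t w q y]|] //.
      by move=> [? ?]; split=> //; rewrite Pr' slot_pub.
    by move=> ?; split=> //; apply: slot_pub.
  + by move=> /slot_pubE [/(nd_pub N)|/C1 C]; [exact: Cpl|apply/Cpl/C].
  + move=> op /=; have [[_ ->] //|[_ -> /(nd_sub N)]] := slot_kd b.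
    by rewrite slot_target => -[/Cpl|]; [left|right].
  + by rewrite /marked Est => /(nd_marked N) /(closedx_ext slot_ext).
  + by move=> k y; rewrite Est => /(nd_fin N); apply: frozen_le slot_heap_le.
- move=> b t w q j /slot_pubE Pb; rewrite R.2; case: (b =P n) => // _ Eb.
  case: Pb => [Pb|Kb]; last first.
    have [v [[-> ->] Eq [Hv v0] [[u Ev] Pv] Hvn]] := C3 Kb Eb.
    exists v; split=> //; split.
    * by have [u' [Eu' _ _]] := slot_inner_le Ev; exists u'.
    * exact: slot_pub.
    * by rewrite /= slot_slot Hvn eqxx => -[Er]; case: (slot_kind_r Pv).
  have [v [Et Eq Hv [[u Ev] Pv Sv] Hw]] := i_reb I Pb Eb.
  exists v; split=> //.
    split; [|exact: slot_pub|exact: slot_persist].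
    by have [u' [Eu' _ _]] := slot_inner_le Ev; exists u'.
  move=> w' /Hw [w1 w2 w3 w4 [k Fr Nk]]; split=> //=.
  + by rewrite R.1.
  + by case: w2 => w2; have [[_ /= ->]|[_ /= ->]] := slot_kd w'; by [right|left].
  (* A newTarget that becomes public in this step does so by overwriting its own Rebuild node. *)
  + move=> /slot_pubE [/w3|Kw]; first exact: slot_persist.
    case: w2 => w2; last by apply: slot_persist => //; apply: w3.
    rewrite slot_slot (C6 (op := b)) ?eqxx -?Kw ?w2 // => -[].
    by move=> Er; case: (slot_kind_r Pb).
  + by move=> u1 /slot_inner [u2 [/w4]].
  exists k; first exact: frozen_le slot_heap_le _.
  have Wst : move_kind k0 KPub (kd s) w' = KSub b -> kd s w' = KSub b.
    by have [[_ ->] //|[_ ->]] := slot_kd w'.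
  have st d y k' : ok_ptr s d -> (forall v, inner_child (hp s) d = Some v -> kd s v <> KPub) ->
    weight (hp s) y d k' -> weight h' y d k'.
    move=> okd nP; apply: (weight_off_path I Pn En) => //; first exact: slot_skel.
    by move=> v' /nP nP' /(on_path_inner I Pn En) [].
  have stw u1 : kd s w' = KSub b -> onth (hp s) w' = Some (Inner V u1) ->
      forall j, ok_ptr s (nth null (children u1) j) /\
      (forall v, inner_child (hp s) (nth null (children u1) j) = Some v -> kd s v <> KPub).
    move=> Sw Ew j'; have Pw : kd s w' <> KDead by rewrite Sw.
    split; first exact: (ok_child I Pw Ew).
    by move=> v' /(inner_child_inv I Pw Ew) [_ -> _ _ _]; rewrite Sw.
  move: Nk; rewrite /new_size /=; case: ifP => _.
    move=> H /Wst Sw; have [H0 H1 H2] := H Sw.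
    have okw : ok_ptr s (Some w') /\ forall v, inner_child (hp s) (Some w') = Some v -> kd s v <> KPub.
      rewrite /ok_ptr /=; case Ew: (onth _ w') => [[||u1|t1 q1 w1' i1]|] //.
        split=> v' [<-]; rewrite Sw //; split=> //; by exists u1.
      by have [] := i_noreb I Sw Ew.
    split; try by apply: st; case: okw.
    move=> v1 Ev1; have [v2 [Ev2 _ _ _ _]] := slot_inner Ev1.
    exact: slot_complete Ev1 Ev2 (H2 _ Ev2).
  move=> [u1 [Eu1 n1 n2 n3]]; have [u2 [Eu2 m1 m2]] := slot_inner_le Eu1.
  exists u2; rewrite m1 m2; split=> // /Wst Sw j' c' e' lte Ec.
  have Ew0 : nth null (children u1) j' = Some c'.
    have [<- //|[Ew]] := slot_children j' Eu2 Eu1.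
    by move: Sw; rewrite Ew Pn.
  have [ok1 av1] := stw u1 Sw Eu1 j'; rewrite Ew0 in ok1 av1.
  by apply: st => //; apply: n3.
- move=> b op t w q j; have [[_ ->] //|[_ -> Sb]] := slot_kd b.
  rewrite R.2; case: (b =P n) => // _.
  exact: (i_noreb I Sb).
Qed.

(** Reads the step backwards: the old heap arises from the new one by putting [c] back into the
    slot. So an arbitrary weight after the step yields one before it, to which the old bounds
    apply. *)
Lemma slot_weight_back y d k' (Ry : nat -> nat -> Prop) :
  (forall x', weight h' y (Some r) x' -> exists2 x, weight (hp s) y c x & Ry x' x) ->
  ok_ptr s' d -> weight h' y d k' ->
  exists2 k, weight (hp s) y d k & k = k' \/
   (exists2 v, inner_child (hp s) d = Some v & on_path s n v) /\
   exists x' x, Ry x' x /\ k' + x = k + x'.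
Proof.
move=> HR okd W.
have I' := slot_struct.
have Pn' : kd s' n = KPub by apply: slot_pub.
have skels b : b <> n -> skel (hp s') (Some b) = skel (hp s) (Some b).
  by move=> nb; rewrite slot_skel.
have [/= on|off] : (exists2 v, inner_child (hp s') d = Some v & on_path s' n v) \/
   forall v, inner_child (hp s') d = Some v -> ~ on_path s' n v.
- case E: (inner_child (hp s') d) => [v|]; last by right.
  have [o|o] := boolP (v \in 0 :: an s n); first by left; exists v.
  by right=> v' [<-]; apply/negP.
- have self : skel (hp s) (Some n) = Some (SInner (set_nth null
      (children (set_child un i (Some r))) i c)).
    rewrite /skel /= En /= set_set_nth eqxx /c; congr (Some (SInner _)).
    apply: (@eq_from_nth _ null); first by rewrite size_set_nth (maxn_idPr lti).
    by move=> j _; rewrite nth_set_nth /=; case: eqP => [->|].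
  have lti' : i < size (children (set_child un i (Some r))) by rewrite size_set_child.
  have HR' x' : weight (hp s') y (nth null (children (set_child un i (Some r))) i) x' ->
      exists2 x, weight (hp s) y c x & Ry x' x.
    by rewrite nth_set_child eqxx; apply: HR.
  have [k Wk Hk] := weight_on_path I' Pn' slot_self lti' skels self HR' W on.
  exists k => //; case: Hk => [->|[x' [x [Rx Ex]]]]; [by left|right].
  split; last by exists x', x.
  by case: on => v Ev ov; exists v; rewrite // -slot_child.
- exists k'; last by left.
  exact: (weight_off_path I' Pn' slot_self skels okd off W).
Qed.

(** [R0] limits the loss of keys and [R1] the gain of leaves, the two directions that endanger the
    bounds. On the path to [n] a change by [e] is paid for by the growth of [eg']; elsewhere no
    weight changes. *)
Lemma slot_inv : tree_inv s'.
Proof.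
split; first exact: slot_struct.
move=> a u a0 Pa' Ea'; have Pa := slot_tracked Pa'.
have I' := slot_struct.
have [v0 [Ea Ei Ect Esz _]] := slot_inner Ea'.
have B := inv_bound I a0 Pa Ea.
have Nd := i_node I Pa Ea.
have slk : slack s a <= slack s' a.
  rewrite /slack /=; have [o|/negP o] := boolP (a \in 0 :: an s n).
    by rewrite E1 // addnA leq_addr.
  by rewrite E2.
have slk1 : on_path s n a -> slack s' a = slack s a + e.
  by move=> o; rewrite /slack /= E1 // addnA.
have back0 := slot_weight_back R0.
have back1 := slot_weight_back R1.
have oka : ok_ptr s' (Some a) := ok_self Pa' Ea'.
have okj j : ok_ptr s' (nth null (children u) j) by apply: (ok_child I' Pa' Ea').
have hit j : nth null (children u) j = nth null (children v0) j ->
    (exists2 v, inner_child (hp s) (nth null (children u) j) = Some v & on_path s n v) ->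
    on_path s n a.
  by move=> -> [v Ev ov]; have [_ []] := on_path_up I Pn En Pa Ea Ev ov.
split.
- move=> k' W; have [k /(bd_low B) L] := back0 _ _ oka W.
  rewrite Ei; move=> [Ek|[[v +]]]; first by lia.
  rewrite /= Ea => -[<-] /slk1 -> [x' [x [Rx Ex]]]; lia.
- move=> k' W; have [k /(bd_up B) L] := back1 _ _ oka W.
  rewrite Ei; move=> [Ek|[[v +]]]; first by lia.
  rewrite /= Ea => -[<-] /slk1 -> [x' [x [Rx Ex]]]; lia.
- move=> j l ltj W; rewrite Ei; rewrite Esz in ltj.
  have [Ec|[Ea0 Ej Ev Ec]] := slot_children j Ea' Ea.
    have [k] := back1 _ _ (okj j) W.
    rewrite {1}Ec => /(bd_slot B ltj) L [Ek|[H [x' [x [Rx Ex]]]]]; first by lia.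
    rewrite slk1; [lia|exact: hit H].
  rewrite Ec in W; have [x Wx le] := R1 W.
  rewrite slk1; last by rewrite Ea0; apply: (on_path_self I Pn En).
  by rewrite Ej in ltj; move: Wx; rewrite /c -Ev => /(bd_slot B ltj); lia.
- move=> j v u' /=; rewrite slot_child Ei.
  have [->|[Ea0 Ej Ev ->]] := slot_children j Ea' Ea.
    by move=> Ev /slot_inner [u1 [/(bd_child B Ev) L -> _ _ _]]; lia.
  move=> Er /slot_inner [u1 [Eu1 -> _ _ _]].
  have n0 : n <> 0 by rewrite -Ea0.
  have := C7 n0 Er Eu1; rewrite Ev slk1; last by rewrite Ea0; apply: (on_path_self I Pn En).
  by rewrite Ea0; lia.
- move=> j b; rewrite Ei => le4 Eb /=.
  have goal x : match onth (hp s) x with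
      | Some (Inner u') => initSize u' <= 4 /\ 1 < size (children u')
      | Some (Rebuild _ _ _ _) => False | _ => True end ->
      match onth h' x with
      | Some (Inner u') => initSize u' <= 4 /\ 1 < size (children u')
      | Some (Rebuild _ _ _ _) => False | _ => True end.
    rewrite R.2; case: (x =P n) => [->|//].
    by rewrite En /= size_set_nth (maxn_idPr lti).
  apply: goal; have [Ec|[Ea0 Ej Ev Ec]] := slot_children j Ea' Ea.
    by apply: (bd_small B le4 (j := j)); rewrite -Ec.
  move: Eb; rewrite Ec => -[<-]; apply: C8; first by rewrite -Ea0.
  by rewrite -Ev.
- by rewrite Esz Ei; apply: bd_size B.
- by rewrite Ei; apply: bd_dn B.
- by rewrite Ect; apply: bd_count B.
Qed.

Lemma slot_rely t : k0 <> KPriv t -> (forall y, (t \in eg' y) = (t \in eg s y)) -> rely t s s'.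
Proof.
move=> Nk He; split=> //=; first exact: slot_ext.
- move=> a; rewrite /move_kind; case: same_kindP => [->|//].
  by split=> // /Nk.
- move=> a Ka; split=> //; apply: slot_other => Ea.
  by move: Pn; rewrite -Ea Ka.
Qed.

End Slot.

(** * Allocation *)

Section Alloc.

Definition extends (h h' : heap) : Prop :=
  size h <= size h' /\ forall a, a < size h -> onth h' a = onth h a.

Lemma extends_trans h h' h'' : extends h h' -> extends h' h'' -> extends h h''.
Proof.
move=> [l e] [l' e']; split; first exact: leq_trans l'.
by move=> a lta; rewrite e' ?e // (leq_trans lta).
Qed.

Lemma extends_onth h h' a x : extends h h' -> onth h a = Some x -> onth h' a = Some x.
Proof. by move=> [_ e] E; rewrite e // (onth_ltn E). Qed.

Lemma extends_weight h h' e c k : extends h h' -> weight h e c k -> weight h' e c k.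
Proof.
move=> X; apply: weight_mono => -[b|] // x; rewrite /skel /=.
by case E: (onth h b) => [y|] //=; rewrite (extends_onth X E).
Qed.

Variables (s : state) (t : 'I_p) (h' : heap) (an' : nat -> seq nat) (hm' : nat -> nat * nat).

(* A thread that allocates has given up its earlier private nodes. *)
Definition alloc_kind (a : nat) : kind :=
  if a < size (hp s) then move_kind (KPriv t) KDead (kd s) a
  else if a < size h' then KPriv t else KDead.

Let s' : state := State h' alloc_kind an' hm' (dn s) (eg s) (ic s).

Hypotheses (I : tree_inv s) (X : extends (hp s) h').
Hypothesis Aan : forall a, a < size (hp s) -> an' a = an s a.
Hypothesis Ahm : forall a, a < size (hp s) -> hm' a = hm s a.

Lemma alloc_old a : kd s a <> KDead -> kd s a <> KPriv t -> alloc_kind a = kd s a.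
Proof. by move=> /(i_alloc I) lta N; rewrite /alloc_kind lta move_kind_out. Qed.

Lemma alloc_new a : size (hp s) <= a < size h' -> alloc_kind a = KPriv t.
Proof. by rewrite leqNgt /alloc_kind => /andP [/negPf -> ->]. Qed.

Lemma alloc_kind_inv a : alloc_kind a <> KDead ->
  [/\ a < size (hp s), kd s a <> KDead, kd s a <> KPriv t & alloc_kind a = kd s a] \/
  size (hp s) <= a < size h' /\ alloc_kind a = KPriv t.
Proof.
rewrite /alloc_kind; case: ltnP => [lta|gea]; last by case: ifP => //; right.
by rewrite /move_kind; case: same_kindP => // N D; left.
Qed.

Lemma alloc_pub a : kd s a = KPub -> alloc_kind a = KPub.
Proof. by move=> E; rewrite alloc_old ?E. Qed.

Lemma alloc_sub a op : kd s a = KSub op -> alloc_kind a = KSub op.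
Proof. by move=> E; rewrite alloc_old ?E. Qed.

Lemma alloc_pubE a : alloc_kind a = KPub -> kd s a = KPub.
Proof.
move=> E; have : alloc_kind a <> KDead by rewrite E.
by move=> /alloc_kind_inv [[_ _ _]|[_]]; rewrite E.
Qed.

Lemma alloc_heap_le : heap_le (hp s) h'.
Proof.
by move=> a x E; exists x; [exact: extends_onth X E|exact: node_le_refl].
Qed.

Hypothesis Anew : forall a u j b, size (hp s) <= a -> onth h' a = Some (Inner V u) ->
  nth null (children u) j = Some b -> size (hp s) <= b.
Hypothesis Ainv : forall a u, size (hp s) <= a -> onth h' a = Some (Inner V u) ->
  node_inv s' a u /\ bound_inv s' a u.

Lemma alloc_slot a : kd s a = KPub -> slot (hp s) (hm s a) <> Some a -> slot h' (hm' a) <> Some a.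
Proof.
move=> Pa; have lta : a < size (hp s) by apply: (i_alloc I); rewrite Pa.
rewrite Ahm //; case: (ltnP (hm s a).1 (size (hp s))) => [ltq|geq] N.
  by move: N; rewrite /slot X.2.
rewrite /slot; case E: (onth h' _) => [[|? ?|u|? ? ? ?]|] // Ea.
by have := Anew geq E Ea; rewrite leqNgt lta.
Qed.

Lemma alloc_onth a x : a < size (hp s) -> onth h' a = Some x -> onth (hp s) a = Some x.
Proof. by move=> lta; rewrite X.2. Qed.

Lemma alloc_ext : ext s s'.
Proof.
split=> /=.
- exact: alloc_heap_le.
- exact: alloc_pub.
- by move=> a op /alloc_sub ->; left.
- move=> a S; apply: Aan; apply: (i_alloc I); by case: (kd s a) S.
- move=> a S; apply: Ahm; apply: (i_alloc I); by case: (kd s a) S.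
- exact: alloc_slot.
Qed.

Lemma alloc_closed L a : closedx s L a -> closedx s' L a.
Proof. exact: closedx_ext alloc_ext. Qed.

Lemma alloc_weight_back e c k : ok_ptr s c -> (forall b, c = Some b -> b < size (hp s)) ->
  weight h' e c k -> weight (hp s) e c k.
Proof.
move=> ok lt W.
apply: (@weight_restrict h' (hp s) e
  (fun c => ok_ptr s c /\ forall b, c = Some b -> b < size (hp s))) W _ => //.
- by move=> [b|] // [_ /(_ b erefl) ltb]; rewrite /skel /= X.2.
- move=> [b|] // cs j [ok1 /(_ b erefl) ltb]; rewrite /skel /= X.2 //.
  case Eb: (onth _ b) => [[|? ?|u|? ? ? ?]|] //= [<-] ltj.
  have /ok1 [Pb _] : inner_child (hp s) (Some b) = Some b by rewrite /= Eb.
  split; first exact: (ok_child I Pb Eb).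
  move=> x /(nd_child (i_node I Pb Eb)); rewrite /child_inv.
  by case Ex: (onth _ x) => [y|] // _; apply: onth_ltn Ex.
- move=> [b|] // d [ok1 /(_ b erefl) ltb]; rewrite /skel /= X.2 //.
  case Eb: (onth _ b) => [[|? ?|u|d' w q i]|] //= [Ed].
  move: ok1; rewrite /ok_ptr /= Eb Ed; case: d {Ed} => [v|] // ok1.
  have [Pv [u Ev]] := ok1 v erefl; split.
    by move=> v'; rewrite /= Ev => -[<-]; split=> //; exists u.
  by move=> v' [<-]; apply: onth_ltn Ev.
Qed.

Lemma child_ltn a u j b : kd s a <> KDead -> onth (hp s) a = Some (Inner V u) ->
  nth null (children u) j = Some b -> b < size (hp s).
Proof.
move=> Pa Ea /(nd_child (i_node I Pa Ea)); rewrite /child_inv.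
by case Ex: (onth _ b) => [y|] // _; apply: onth_ltn Ex.
Qed.

Lemma alloc_up_kind k a : k <> KPriv t -> up_kind k (kd s a) -> up_kind k (alloc_kind a).
Proof.
case: k => [|t'|op|] //= N.
- move=> [E|E|[op E]]; [apply: Or31|apply: Or32|apply: Or33; exists op].
  + by rewrite alloc_old ?E.
  + by rewrite alloc_pub.
  + by rewrite (alloc_sub E).
- by case=> E; [left; apply: alloc_sub|right; apply: alloc_pub].
- exact: alloc_pub.
Qed.

Lemma alloc_inv : tree_inv s'.
Proof.
split; first split=> /=.
- move=> a /alloc_kind_inv [[lta _ _ _]|[/andP [_ //] _]].
  exact: leq_trans lta X.1.
- have [u [Eu Pu Au]] := i_root I; exists u; split; first exact: extends_onth X Eu.
    exact: alloc_pub.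
  by rewrite Aan // (onth_ltn Eu).
- by move=> a N; apply: (i_ghost0 I) => /alloc_pub.
- move=> a u /alloc_kind_inv [[lta Pa Na Ek]|[/andP [gea _] _] Ea]; last by have [] := Ainv gea Ea.
  move=> /(alloc_onth lta) Ea; have [n1 n2 n3 n4 n5 n6 n7 n8] := i_node I Pa Ea.
  split=> //.
  + move=> a0; have [v [Ev lt Ean Uk]] := n3 a0; exists v.
    have ltq := onth_ltn Ev.
    rewrite /= Ahm // !Aan //; split=> //; first exact: extends_onth X Ev.
    by rewrite Ek; apply: alloc_up_kind.
  + move=> j b /[dup] /(child_ltn Pa Ea) ltb /n4; rewrite /child_inv /= X.2 // Ek Ahm //.
    case: (onth _ b) => [[|? ?|v|d w q i]|] //.
      by move=> [Kb ? ?]; split=> //; rewrite -Kb alloc_old // Kb.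
    by move=> [? Kb ?]; split=> //; apply: alloc_pub.
  + by move=> /=; rewrite Ek; apply: n5.
  + move=> op /=; rewrite Ek => /n6 [|Tg]; [by left|right].
    by move: Tg; rewrite /new_target; case E: (onth (hp s) op) => [x|] //; rewrite (extends_onth X E).
  + by move=> /n7; apply: alloc_closed.
  + by move=> k b /n8; apply: frozen_le alloc_heap_le.
- move=> b d w q i /alloc_pubE Pb.
  have ltb : b < size (hp s) by apply: (i_alloc I); rewrite Pb.
  rewrite X.2 // => Eb; have [v [Ed Eq [Hv v0] [[u Ev] Pv Sv] Hw]] := i_reb I Pb Eb.
  have ltv := onth_ltn Ev.
  exists v; rewrite /= !Ahm //; split=> //.
    split; [by exists u; apply: extends_onth X Ev|exact: alloc_pub|].
    by rewrite -(Ahm ltv); apply: alloc_slot.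
  move=> w' /Hw [w1 w2 w3 w4 [k Fr Nk]]; split=> /=.
  + exact: leq_trans w1 X.1.
  + by case: w2 => [/alloc_sub|/alloc_pub]; [left|right].
  + by move=> /alloc_pubE /w3; apply: alloc_slot.
  + by move=> u1; rewrite X.2 // => /w4; rewrite !Ahm.
  exists k; first exact: frozen_le alloc_heap_le _.
  have SE : alloc_kind w' = KSub b -> kd s w' = KSub b.
    by case: w2 => [//|/alloc_pub ->].
  move: Nk; rewrite /new_size /= X.2 //; case: ifP => _.
    move=> H /SE /H [H0 H1 H2]; split; try exact: (extends_weight X).
    exact: H2.
  move=> [u1 [Eu1 m1 m2 m3]]; exists u1; split=> // /SE Sw j c e lte Ec.
  by apply: extends_weight X _; apply: m3.
- move=> b op d w q i Sb.
  have : alloc_kind b <> KDead by rewrite Sb.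
  move=> /alloc_kind_inv [[ltb _ _]|[_]]; rewrite Sb // => Ek.
  by rewrite X.2 //; apply: (i_noreb I (op := op)).
move=> a u a0 /alloc_kind_inv [[lta Pa Na Ek]|[/andP [gea _] _] Ea]; last by have [] := Ainv gea Ea.
move=> /(alloc_onth lta) Ea; have [b1 b2 b3 b4 b5 b6 b7 b8] := inv_bound I a0 Pa Ea.
split=> //.
- by move=> k /alloc_weight_back H; apply/b1/H; [exact: ok_self Ea|move=> b [<-]].
- by move=> k /alloc_weight_back H; apply/b2/H; [exact: ok_self Ea|move=> b [<-]].
- move=> j l ltj /alloc_weight_back H; apply: b3 ltj (H _ _).
    exact: (ok_child I Pa Ea).
  by move=> b; apply: child_ltn Pa Ea.
- move=> j v v'; rewrite /=; case Ec: (nth _ _ _) => [b|] //=.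
  have ltb := child_ltn Pa Ea Ec; rewrite X.2 // => Ev Ev'.
  have Ev1 : inner_child (hp s) (nth null (children u) j) = Some v by rewrite Ec.
  have [_ _ _ _ [v1 Ev2]] := inner_child_inv I Pa Ea Ev1.
  by apply: (b4 j v v' Ev1); rewrite -Ev' X.2 // (onth_ltn Ev2).
- move=> j b le4 Eb; have := b5 j b le4 Eb; rewrite /= X.2 //.
  exact: child_ltn Pa Ea Eb.
Qed.

Lemma alloc_rely t' : t' <> t -> rely t' s s'.
Proof.
move=> Nt; split=> //=; first exact: alloc_ext.
- move=> a; split=> [E|E].
    have : alloc_kind a <> KDead by rewrite E.
    move=> /alloc_kind_inv [[_ _ _ <-] //|[_]]; rewrite E => -[Et].
    by case: Nt.
  by rewrite alloc_old ?E // => -[].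
- move=> a Ka; have lta : a < size (hp s) by apply: (i_alloc I); rewrite Ka.
  by rewrite X.2 // Aan // Ahm.
Qed.

End Alloc.

(** * Building a newTarget *)

Lemma sqrt_gt0 k : 0 < k -> 0 < Nat.sqrt k.
Proof.
move=> k0; have := Nat.sqrt_spec k (Nat.le_0_l k).
case: (Nat.sqrt k) => [|m] //; lia.
Qed.

(** The first [m] shares add up to the expression for [from] in [rebuildAndSetChild]; for
    [m = Nat.sqrt k] this is the Euclidean division of [k]. *)
Lemma sum_share k : 0 < k -> sumn (mkseq (share k) (Nat.sqrt k)) = k.
Proof.
move=> k0; have t0 := sqrt_gt0 k0.
have ltr := ltn_pmod k t0.
have H m : m <= Nat.sqrt k ->
    sumn (mkseq (share k) m) = k %/ Nat.sqrt k * m + minn m (k %% Nat.sqrt k).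
  elim: m => [|m IH] ltm; first by rewrite muln0 min0n.
  rewrite /mkseq -[m.+1]addn1 iotaD map_cat sumn_cat -/(mkseq _ _) IH ?(ltnW ltm) //=.
  rewrite /share add0n addn0; case: ltnP => [lt|ge]; lia.
rewrite H // [RHS](divn_eq k (Nat.sqrt k)) (minn_idPr _) //; exact: ltnW.
Qed.

Lemma share_le k j : 0 < k -> j < Nat.sqrt k -> share k j <= k.
Proof.
move=> k0 ltj; rewrite -[leqRHS](sum_share k0).
have -> : share k j = nth 0 (mkseq (share k) (Nat.sqrt k)) j by rewrite nth_mkseq.
have : j < size (mkseq (share k) (Nat.sqrt k)) by rewrite size_mkseq.
elim: (mkseq _ _) j {ltj} => [|x l IH] [|j] //= lt; first lia.
have := IH j lt; lia.
Qed.

Lemma share_bound k j : 0 < k -> share k j <= slot_bound k.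
Proof.
move=> k0; have t0 := sqrt_gt0 k0.
have [_ lt] := Nat.sqrt_spec k (Nat.le_0_l k).
have : k %/ Nat.sqrt k < Nat.sqrt k + 3.
  (* With [t = Nat.sqrt k]: [k < (t + 1)^2 <= (t + 3) * t], because [t >= 1]. *)
  rewrite ltn_divLR //; nia.
rewrite /share /slot_bound; case: ifP => _; lia.
Qed.

Section Publish.

Variables (s : state) (t : 'I_p) (b : nat) (h' : heap).

(** A successful write into the Rebuild node [b] or into its newTarget makes the private nodes of
    [t] accessible to the other helpers of [b], though they are not yet in the tree. *)
Definition hand_over (a : nat) : kind := move_kind (KPriv t) (KSub b) (kd s) a.

Let s' : state := State h' hand_over (an s) (hm s) (dn s) (eg s) (ic s).

Hypotheses (I : tree_inv s).

Lemma hand_kd a : (kd s a = KPriv t /\ hand_over a = KSub b) \/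
  (kd s a <> KPriv t /\ hand_over a = kd s a).
Proof. by rewrite /hand_over /move_kind; case: same_kindP; [left|right]. Qed.

Lemma hand_pub a : hand_over a = KPub <-> kd s a = KPub.
Proof. by have [[-> ->]|[_ ->]] := hand_kd a. Qed.

Lemma hand_sub a op : kd s a = KSub op -> hand_over a = KSub op.
Proof. by move=> E; rewrite /hand_over move_kind_out // E. Qed.

Lemma hand_tracked a : hand_over a <> KDead <-> kd s a <> KDead.
Proof. by have [[-> ->]|[_ ->]] := hand_kd a. Qed.

Lemma hand_subE a op : op <> b -> hand_over a = KSub op -> kd s a = KSub op.
Proof. by move=> N; have [[_ ->] [/esym]|[_ ->]] := hand_kd a. Qed.

Hypothesis Hnr : forall a d w q i, kd s a = KPriv t -> onth (hp s) a <> Some (Rebuild K V d w q i).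

Lemma hand_up a : (kd s a = KPriv t ->
    [\/ kd s (hm s a).1 = KPriv t, kd s (hm s a).1 = KPub | kd s (hm s a).1 = KSub b]) ->
  up_kind (kd s a) (kd s (hm s a).1) -> up_kind (hand_over a) (hand_over (hm s a).1).
Proof.
move=> Hup; have [[Ka ->]|[Na ->]] := hand_kd a.
  move=> _; case: (Hup Ka) => E.
  - by left; have [[_ ->]|[/(_ E)]] := hand_kd (hm s a).1.
  - by right; apply/hand_pub.
  - by left; apply: hand_sub.
case: (kd s a) => [|t'|op|] //=; last by move=> ?; apply/hand_pub.
  move=> [E|E|[op E]].
  - have [[_ ->]|[_ ->]] := hand_kd (hm s a).1; last by apply: Or31.
    by apply: Or33; exists b.
  - by apply: Or32; apply/hand_pub.
  - by apply: Or33; exists op; apply: hand_sub.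
by move=> [/hand_sub|/hand_pub]; [left|right].
Qed.

(** * Setting the newTarget field *)

Section Target.
Variables (w k : nat) (d q : ptr) (i : nat) (v : nat).
Hypotheses (Pb : kd s b = KPub) (Eb : onth (hp s) b = Some (Rebuild K V (Some v) null q i)).
Hypothesis R : replaced (hp s) b (Rebuild K V (Some v) (Some w) q i) h'.
Hypotheses (Kw : kd s w = KPriv t).
Hypothesis Hw : forall u, onth (hp s) w = Some (Inner V u) -> hm s w = hm s b /\ w <> 0.
Hypothesis Hf : frozen (hp s) (Some v) k.
Hypothesis Hn : if k < T then
    [/\ weight (hp s) 0 (Some w) k, weight (hp s) 1 (Some w) (maxn 1 k) &
      forall u, onth (hp s) w = Some (Inner V u) -> complete u]
  else exists u, [/\ onth (hp s) w = Some (Inner V u), initSize u = k,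
    size (children u) = Nat.sqrt k & forall j c e, e < 2 ->
      nth null (children u) j = Some c -> weight (hp s) e (Some c) (share k j)].
Hypothesis Hc : forall a u, kd s a = KPriv t -> onth (hp s) a = Some (Inner V u) ->
  complete u \/ a = w.
Hypothesis Hup : forall a u, kd s a = KPriv t -> onth (hp s) a = Some (Inner V u) ->
  [\/ kd s (hm s a).1 = KPriv t, kd s (hm s a).1 = KPub | kd s (hm s a).1 = KSub b].

Lemma target_inner a u : onth h' a = Some (Inner V u) <-> onth (hp s) a = Some (Inner V u).
Proof. by rewrite R.2; case: (a =P b) => [->|//]; rewrite Eb. Qed.

Lemma target_skel c : skel h' c = skel (hp s) c.
Proof. by case: c => [a|] //; rewrite /skel /= R.2; case: (a =P b) => [->|//]; rewrite Eb. Qed.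

Lemma target_slot x : slot h' x = slot (hp s) x.
Proof. by rewrite /slot R.2; case: (x.1 =P b) => [->|//]; rewrite Eb. Qed.

Lemma target_child c : inner_child h' c = inner_child (hp s) c.
Proof. by case: c => [a|] //=; rewrite R.2; case: (a =P b) => [->|//]; rewrite Eb. Qed.

Lemma target_weight e c m : weight h' e c m <-> weight (hp s) e c m.
Proof. by split; apply: weight_mono => x y; rewrite target_skel. Qed.

Lemma target_heap_le : heap_le (hp s) h'.
Proof.
move=> a x Ea; rewrite R.2; case: (a =P b) Ea => [->|_] Ea.
  exists (Rebuild K V (Some v) (Some w) q i) => //; move: Ea; rewrite Eb => -[<-].
  by exists (Some w) => //; left.
by exists x => //; apply: node_le_refl.
Qed.

Lemma target_ext : ext s s'.
Proof.
split=> //=.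
- exact: target_heap_le.
- by move=> a /hand_pub.
- by move=> a op /hand_sub; left.
- by move=> a _; rewrite target_slot.
Qed.

Lemma target_inv : tree_inv s'.
Proof.
split; first split=> /=.
- by move=> a /hand_tracked /(i_alloc I); rewrite R.1.
- have [u [/target_inner Eu /hand_pub Pu Au]] := i_root I; by exists u.
- by move=> a N; apply: (i_ghost0 I) => /hand_pub.
- move=> a u /hand_tracked Pa /target_inner Ea.
  have [n1 n2 n3 n4 n5 n6 n7 n8] := i_node I Pa Ea.
  split=> //.
  + move=> a0; have [x [Ex lt Ean Uk]] := n3 a0; exists x; split=> //; first exact/target_inner.
    by apply: hand_up Uk => Ka; apply: Hup Ka Ea.
  + move=> j c /n4; rewrite /child_inv /= R.2; case: (c =P b) => [->|_].
      by rewrite Eb => -[? ? ?]; split=> //; apply/hand_pub.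
    case: (onth _ c) => [[|? ?|x|? ? ? ?]|] //.
      by move=> [Ec ? ?]; split=> //; rewrite /hand_over /move_kind Ec.
    by move=> [? ? ?]; split=> //; apply/hand_pub.
  + by move=> /hand_pub /n5.
  + move=> op /=; have [[Ka ->] [<-]|[_ -> /n6 [|Tg]]] := hand_kd a.
    * case: (Hc Ka Ea) => [|Ew]; [by left|right].
      by rewrite /new_target R.2 eqxx Ew.
    * by left.
    * right; move: Tg; rewrite /new_target R.2; case: (op =P b) => [->|//].
      by rewrite Eb.
  + by move=> /n7; apply: closedx_ext target_ext.
  + by move=> m y /n8; apply: frozen_le target_heap_le.
- move=> c d' w' q' j /hand_pub Pc; rewrite R.2; case: (c =P b) => [->|Nb] Ec.
    have [v1 [Ev1 Eq Hv [Iv Pv Sv] _]] := i_reb I Pb Eb.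
    case: Ec Ev1 => <- <- <- <- [Ev1]; exists v; rewrite -Ev1 in Hv Iv Pv Sv.
    split=> //.
      split; [by have [u /target_inner Eu] := Iv; exists u|exact/hand_pub|].
      by rewrite /= target_slot.
    move=> w1 [<-]; split=> /=.
    + by rewrite R.1; apply: (i_alloc I); rewrite Kw.
    + by left; apply: move_kind_in.
    + by move=> /hand_pub; rewrite Kw.
    + by move=> u /target_inner; apply: Hw.
    exists k; first exact: frozen_le target_heap_le _.
    move: Hn; rewrite /new_size; case: ifP => _.
      move=> [? ? H2] _; split; try exact/target_weight.
      by move=> u1 /target_inner; apply: H2.
    move=> [u [/target_inner Eu m1 m2 m3]]; exists u; split=> // _ j0 x e lte Ex.
    by apply/target_weight/m3.
  have [v1 [Ev1 Eq Hv [[u Iv] Pv Sv] Hw1]] := i_reb I Pc Ec.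
  exists v1; split=> //.
    split; [by exists u; apply/target_inner|exact/hand_pub|].
    by rewrite /= target_slot.
  move=> w1 /Hw1 [w2 w3 w4 w5 [k1 Fr Nk]]; split=> /=.
  + by rewrite R.1.
  + by case: w3 => [/hand_sub|/hand_pub]; [left|right].
  + by move=> /hand_pub; rewrite target_slot; apply: w4.
  + by move=> u1 /target_inner; apply: w5.
  exists k1; first exact: frozen_le target_heap_le _.
  move: Nk; rewrite /new_size /=; case: ifP => _.
    move=> H /(hand_subE Nb) /H [H0 H1 H2]; split; try exact/target_weight.
    by move=> u1 /target_inner; apply: H2.
  move=> [u1 [/target_inner Eu1 m1 m2 m3]]; exists u1; split=> // /(hand_subE Nb) Sw j0 x e lte Ex.
  by apply/target_weight/m3.
- move=> a op d' w' q' j; have [[Ka _] _|[_ ->] Sa] := hand_kd a; rewrite R.2.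
    by case: (a =P b) => [Eab|_]; [move: Ka; rewrite Eab Pb|exact: Hnr].
  case: (a =P b) => [Eab|_]; first by move: Sa; rewrite Eab Pb.
  exact: (i_noreb I Sa).
move=> a u a0 /hand_tracked Pa /target_inner Ea.
have [b1 b2 b3 b4 b5 b6 b7 b8] := inv_bound I a0 Pa Ea.
split=> //.
- by move=> m /target_weight /b1.
- by move=> m /target_weight /b2.
- by move=> j l ltj /target_weight; apply: b3.
- by move=> j x x'; rewrite target_child => Ex /target_inner; apply: b4 Ex.
- move=> j c le4 /(b5 _ _ le4); rewrite /= R.2; case: (c =P b) => [->|//].
  by rewrite Eb.
Qed.

Lemma target_rely t' : t' <> t -> rely t' s s'.
Proof.
move=> Nt; split=> //=; first exact: target_ext.
- move=> a; have [[-> ->]|[_ ->]] := hand_kd a => //.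
  by split=> // -[E]; case: Nt.
- move=> a Ka; split=> //; rewrite R.2; case: (a =P b) => // Eab.
  by move: Ka; rewrite Eab Pb.
Qed.

End Target.

Section Fill.
Variables (w i r : nat) (uw : inner).
Hypotheses (Pb : kd s b = KPub) (Tb : new_target (hp s) b = Some w).
Hypotheses (Kw : kd s w = KSub b) (Ew : onth (hp s) w = Some (Inner V uw)).
Hypotheses (lti : i < size (children uw)) (Ei : nth null (children uw) i = null).
Hypothesis R : replaced (hp s) w (Inner V (set_child uw i (Some r))) h'.
Hypotheses (Kr : kd s r = KPriv t).
Hypothesis Hr : match onth (hp s) r with
  | Some (Inner ur) => [/\ hm s r = (w, i), r <> 0,
      initSize ur <= share (initSize uw) i & 1 < size (children ur)]
  | Some (Rebuild _ _ _ _) => False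
  | Some _ => True
  | None => False end.
Hypothesis Wr : forall e, e < 2 -> weight (hp s) e (Some r) (share (initSize uw) i).
Hypothesis Hc : forall a u, kd s a = KPriv t -> onth (hp s) a = Some (Inner V u) -> complete u.
Hypothesis Hup : forall a u, kd s a = KPriv t -> onth (hp s) a = Some (Inner V u) ->
  [\/ kd s (hm s a).1 = KPriv t, kd s (hm s a).1 = KPub | kd s (hm s a).1 = KSub b].
Hypothesis T0 : 0 < T.

Lemma fill_tracked : kd s w <> KDead. Proof. by rewrite Kw. Qed.

(** Marked nodes are closed, and closed nodes are public. *)
Lemma fill_clean : ~ marked uw.
Proof.
move=> /(nd_marked (i_node I fill_tracked Ew)) [].
by rewrite Kw.
Qed.

Lemma fill_new : exists v, new_inv s b v w.
Proof.
move: Tb; rewrite /new_target; case Eb: (onth _ b) => [[|? ?|?|d w' q j]|] // Ew'.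
have [v [_ _ _ _ Hv]] := i_reb I Pb Eb; exists v; exact: Hv.
Qed.

Lemma fill_home : w <> 0 /\ kd s (hm s w).1 = KPub.
Proof.
have [v [_ _ _ H _]] := fill_new; have [Eh w0] := H _ Ew; split=> //.
move: Tb; rewrite /new_target; case Eb: (onth _ b) => [[|? ?|?|d w' q j]|] // Ew'.
have [v' [_ _ [Hv v0] [[u Ev] Pv _] _]] := i_reb I Pb Eb.
have [x [_ _ _ ]] := nd_up (i_node I (tracked_pub Pv) Ev) v0.
by rewrite Hv Pv /= Eh.
Qed.

Lemma fill_le : inner_le uw (set_child uw i (Some r)).
Proof.
split=> //; first by rewrite /= size_set_nth (maxn_idPr lti).
  by move=> M; case: fill_clean.
by move=> j; rewrite /= nth_set_nth /=; case: eqP.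
Qed.

Lemma fill_heap_le : heap_le (hp s) h'.
Proof. exact: replaced_le Ew fill_le R. Qed.

Lemma fill_onth a : a <> w -> onth h' a = onth (hp s) a.
Proof. by move=> /eqP /negPf N; rewrite R.2 N. Qed.

Lemma fill_self : onth h' w = Some (Inner V (set_child uw i (Some r))).
Proof. by rewrite R.2 eqxx. Qed.

Lemma fill_slot x : slot h' x = if x == (w, i) then Some r else slot (hp s) x.
Proof.
rewrite /slot R.2; case: x => x1 x2 /=; rewrite xpair_eqE.
case: (x1 =P w) => [->|//] /=; by rewrite nth_set_nth /= Ew.
Qed.

Lemma fill_ext : ext s s'.
Proof.
split=> //=.
- exact: fill_heap_le.
- by move=> a /hand_pub.
- by move=> a op /hand_sub; left.
- move=> a Pa; rewrite fill_slot; case: eqP => // _ _ [Ea].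
  by move: Pa; rewrite -Ea Kr.
Qed.

Lemma fill_child c : inner_child h' c = inner_child (hp s) c.
Proof. by case: c => [a|] //=; rewrite R.2; case: (a =P w) => [->|//]; rewrite Ew. Qed.

Lemma fill_target a : new_target h' a = new_target (hp s) a.
Proof. by rewrite /new_target R.2; case: (a =P w) => [->|//]; rewrite Ew. Qed.

Lemma fill_inner a v : onth h' a = Some (Inner V v) -> exists v0,
  [/\ onth (hp s) a = Some (Inner V v0), initSize v = initSize v0,
    size (children v) = size (children v0), Defs.count v = Defs.count v0 &
    a <> w -> v = v0].
Proof.
rewrite R.2; case: (a =P w) => [->|Na].
  by move=> [<-]; exists uw; rewrite Ew /= size_set_nth (maxn_idPr lti).
by move=> ->; exists v.
Qed.

Lemma fill_inner_le a v : onth (hp s) a = Some (Inner V v) -> exists v0,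
  [/\ onth h' a = Some (Inner V v0), initSize v0 = initSize v &
    size (children v0) = size (children v)].
Proof.
rewrite R.2; case: (a =P w) => [->|Na].
  rewrite Ew => -[<-]; exists (set_child uw i (Some r)).
  by rewrite /= size_set_nth (maxn_idPr lti).
by move=> ->; exists v.
Qed.

Lemma fill_weight e c k : ok_ptr s c -> inner_child (hp s) c <> Some w ->
  weight (hp s) e c k -> weight h' e c k.
Proof.
move=> ok av; apply: (weight_avoid I (A := eq w)) => //.
- by move=> a /nesym Na; rewrite /skel /= fill_onth.
- by move=> a <-; exists uw.
- move=> a u j v Pa Ea Ev Av; move: Ev; rewrite -Av => Ev.
  have [_ Kwa Hwa _ _] := inner_child_inv I Pa Ea Ev.
  by have [_] := fill_home; rewrite Hwa /= -Kwa Kw.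
- by move=> v Ev Av; apply: av; rewrite Av.
Qed.

(** A child has the kind of its parent, whereas [w] is not public and its home is. So [w] hangs in
    no slot yet, and filling it affects no weight but its own. *)
Lemma fill_not_child a u j : kd s a <> KDead -> onth (hp s) a = Some (Inner V u) ->
  inner_child (hp s) (nth null (children u) j) <> Some w.
Proof.
move=> Pa Ea Ev.
have [_ Kwa Hwa _ _] := inner_child_inv I Pa Ea Ev.
by have [_] := fill_home; rewrite Hwa /= -Kwa Kw.
Qed.

Lemma fill_rw : r <> w.
Proof. by move=> E; move: Kr; rewrite E Kw. Qed.

Lemma fill_weight_r e : e < 2 -> weight h' e (Some r) (share (initSize uw) i).
Proof.
move=> lte; apply: fill_weight; last exact: Wr.
  move=> v; move: Hr => /=; case Er: (onth _ r) => [[|? ?|ur|? ? ? ?]|] // _ [<-].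
  by rewrite Kr; split=> //; exists ur.
move: Hr => /=; case Er: (onth _ r) => [[|? ?|ur|? ? ? ?]|] // _ [].
exact: fill_rw.
Qed.

(** Below the threshold the newTarget would have a weight, which its null slot excludes. *)
Lemma fill_size : [/\ T <= initSize uw, size (children uw) = Nat.sqrt (initSize uw) &
  forall j c e, e < 2 -> nth null (children uw) j = Some c ->
    weight (hp s) e (Some c) (share (initSize uw) j)].
Proof.
have [v [_ _ _ _ [k Fr]]] := fill_new; rewrite /new_size.
case: ltnP => [_ /(_ Kw) [/weight_inv]|leT [u []]].
  rewrite {1}/skel /= Ew /= => -[ks [_ _ /(_ i lti)]].
  by rewrite Ei => /weight_inv.
by rewrite Ew => -[<-] Ek sz H; rewrite Ek; split=> //; apply: H.
Qed.

Lemma fill_struct : struct_inv s'.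
Proof.
split=> /=.
- by move=> a /hand_tracked /(i_alloc I); rewrite R.1.
- have [u [Eu /hand_pub Pu Au]] := i_root I.
  by have [u' [Eu' _ _]] := fill_inner_le Eu; exists u'.
- by move=> a N; apply: (i_ghost0 I) => /hand_pub.
- move=> a u /hand_tracked Pa Eu; have [v0 [Ea Eis Esz _ Eo]] := fill_inner Eu.
  have [n1 n2 n3 n4 n5 n6 n7 n8] := i_node I Pa Ea.
  have up : a <> 0 -> exists v : inner,
   [/\ onth h' (hm s a).1 = Some (Inner V v), (hm s a).2 < size (children v),
      an s a = rcons (an s (hm s a).1) a & up_kind (hand_over a) (hand_over (hm s a).1)].
    move=> a0; have [x [Ex lt Ean Uk]] := n3 a0.
    have [x' [Ex' _ Sx]] := fill_inner_le Ex; exists x'; rewrite Sx; split=> //.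
    by apply: hand_up Uk => Ka; apply: Hup Ka Ea.
  have ch j c : nth null (children v0) j = Some c -> child_inv s' a j c.
    move=> /n4; rewrite /child_inv /= R.2; case: (c =P w) => [->|_].
      by rewrite Ew => -[Ec ? ?]; split=> //; rewrite /hand_over /move_kind Ec.
    case: (onth _ c) => [[|? ?|x|? ? ? ?]|] //.
      by move=> [Ec ? ?]; split=> //; rewrite /hand_over /move_kind Ec.
    by move=> [? ? ?]; split=> //; apply/hand_pub.
  case: (a =P w) => [Eaw|/Eo Euv]; last first.
    rewrite Euv; split=> //=.
    + by move=> /hand_pub /n5.
    + move=> op; rewrite fill_target; have [[Ka ->] _|[_ -> /n6 //]] := hand_kd a.
      by left; apply: Hc Ka Ea.
    + by move=> /n7; apply: closedx_ext fill_ext.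
    + by move=> m y /n8; apply: frozen_le fill_heap_le.
  have Ev0 : v0 = uw by move: Ea; rewrite Eaw Ew => -[].
  have Eus : u = set_child uw i (Some r) by move: Eu; rewrite Eaw fill_self => -[].
  rewrite Ev0 in n1 n2 ch Esz.
  have Sw : hand_over w = KSub b by apply: hand_sub.
  rewrite Eus in Esz *; split=> //.
  + by rewrite Esz.
  + by rewrite Esz.
  + move=> j c; rewrite /= nth_set_nth /=; case: (j =P i) => [->|_ /ch //] [<-].
    rewrite /child_inv /= fill_onth; last exact: fill_rw.
    move: Hr; case: (onth _ r) => [[|? ?|x|? ? ? ?]|] // [? ? _ _].
    by rewrite Eaw Sw; split=> //; apply: move_kind_in.
  + by rewrite /= Eaw Sw.
  + by move=> op; rewrite /= Eaw Sw => -[<-]; right; rewrite fill_target.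
  + by move=> M; case: fill_clean.
  + move=> m y /= Est; case: fill_clean; by rewrite /marked Est.
- move=> c d' w' q' j /hand_pub Pc; rewrite R.2; case: (c =P w) => // Nw Ec.
  have [v1 [Ev1 Eq Hv [[u Iv] Pv Sv] Hw1]] := i_reb I Pc Ec.
  exists v1; split=> //.
    split; [by have [u' [Eu' _ _]] := fill_inner_le Iv; exists u'|exact/hand_pub|].
    exact: (x_slot fill_ext Pv).
  move=> w1 Ew1; have [w2 w3 w4 w5 [k1 Fr Nk]] := Hw1 w1 Ew1; split=> /=.
  + by rewrite R.1.
  + by case: w3 => [/hand_sub|/hand_pub]; [left|right].
  + by move=> /hand_pub /w4; apply: (x_slot fill_ext).
  + by move=> u1 /fill_inner [u2 [/w5]].
  exists k1; first exact: frozen_le fill_heap_le _.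
  have [Ecb|Ncb] := c =P b.
    have Eww : w1 = w.
      by move: Tb; rewrite /new_target -Ecb Ec Ew1 => -[].
    have [leT sz Hsz] := fill_size.
    rewrite Eww in Nk *; move: Nk; rewrite /new_size; case: ltnP => [lt|_].
      move=> /(_ (etrans Kw (congr1 _ (esym Ecb)))) [/weight_inv].
      rewrite {1}/skel /= Ew /= => -[ks [_ _ /(_ i lti)]].
      by rewrite Ei => /weight_inv.
    move=> [u1 []]; rewrite Ew => -[<-] Ek _ _; exists (set_child uw i (Some r)).
    rewrite fill_self -Ek; split=> //; first by rewrite /= size_set_nth (maxn_idPr lti).
    move=> _ j0 x e lte; rewrite /= nth_set_nth /=.
    case: (j0 =P i) => [-> [<-]|_ Ex]; first exact: fill_weight_r.
    apply: fill_weight; last exact: Hsz.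
      rewrite -Ex; exact: (ok_child I fill_tracked Ew).
    rewrite -Ex; exact: (fill_not_child fill_tracked Ew).
  have Sub1 : hand_over w1 = KSub c -> kd s w1 = KSub c /\ w1 <> w.
    move=> /(hand_subE Ncb) Kw1; split=> // Eww; apply: Ncb.
    by move: Kw1; rewrite Eww Kw => -[].
  move: Nk; rewrite /new_size /=; case: ifP => _.
    move=> H /Sub1 [Kw1 Nw1]; have [H0 H1 H2] := H Kw1.
    have okw : ok_ptr s (Some w1) /\ inner_child (hp s) (Some w1) <> Some w.
      rewrite /ok_ptr /=; case E1: (onth _ w1) => [[|? ?|u1|d1 q1 wz i1]|] //.
        split=> [v' [<-]|[/Nw1] //]; rewrite Kw1 //; split=> //; by exists u1.
      by have [] := i_noreb I Kw1 E1.
    case: okw => *; split; try exact: fill_weight.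
    by move=> u1; rewrite fill_onth //; apply: H2.
  move=> [u1 [Eu1 m1 m2 m3]]; have [u2 [Eu2 l1 l2]] := fill_inner_le Eu1.
  exists u2; rewrite l1 l2; split=> // /Sub1 [Kw1 Nw1] j0 x e lte Ex.
  have Pw1 : kd s w1 <> KDead by rewrite Kw1.
  have Eu12 : u2 = u1 by move: Eu2; rewrite fill_onth // Eu1 => -[].
  rewrite {}Eu12 in Eu2 Ex l1 l2.
  apply: fill_weight; last exact: m3.
    rewrite -Ex; exact: (ok_child I Pw1 Eu1).
  rewrite -Ex; exact: (fill_not_child Pw1 Eu1).
- move=> a op d' w' q' j; have [[Ka _] _|[_ ->] Sa] := hand_kd a; rewrite R.2.
    by case: (a =P w) => // _; exact: Hnr.
  case: (a =P w) => // _; exact: (i_noreb I Sa).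
Qed.

Lemma fill_weight_back a u e c k : kd s a <> KDead -> onth h' a = Some (Inner V u) -> a <> w ->
  c = Some a \/ (exists j, c = nth null (children u) j) ->
  weight h' e c k -> weight (hp s) e c k.
Proof.
move=> Pa Ea Na Hca; have I' := fill_struct.
have Pa' : kd s' a <> KDead by apply/hand_tracked.
have nc b0 u0 j : kd s' b0 <> KDead -> onth h' b0 = Some (Inner V u0) ->
    inner_child h' (nth null (children u0) j) = Some w -> False.
  move=> Pb0 Eb0 Ev; have [_ Kwa Hwa _ _] := inner_child_inv I' Pb0 Eb0 Ev.
  have Kw' : kd s' w = KSub b by apply: hand_sub.
  have [_] := fill_home; rewrite -[hm s w]/(hm s' w) Hwa => /hand_pub.
  by rewrite -[hand_over _]/(kd s' b0) -Kwa Kw'.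
apply: (weight_avoid I' (A := eq w)) => //=.
- by move=> b0 /nesym Nb; rewrite /skel /= fill_onth.
- by move=> b0 <-; exists (set_child uw i (Some r)); apply: fill_self.
- by move=> b0 u0 j v Pb0 Eb0 Ev Av; case: (nc b0 u0 j) => //; rewrite Av.
- case: Hca => [->|[j ->]]; first exact: (ok_self Pa' Ea).
  exact: (ok_child I' Pa' Ea).
- case: Hca => [->|[j ->]] v.
    by rewrite /= Ea => -[<-] /esym.
  by move=> Ev Av; case: (nc a u j) => //; rewrite Av.
Qed.

(** A weight exists only if no slot is null any more. Then every child has its share, and the shares
    add up. *)
Lemma fill_total e k : e < 2 -> weight h' e (Some w) k -> k = initSize uw.
Proof.
have sk : skel h' (Some w) = Some (SInner (children (set_child uw i (Some r)))).
  by rewrite /skel /= fill_self.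
move=> lte /weight_inv; rewrite sk.
have Esz : size (children (set_child uw i (Some r))) = size (children uw).
  by rewrite /= size_set_nth (maxn_idPr lti).
move=> [ks [-> sz]]; rewrite Esz in sz *; move=> H.
have [leT szu Hsz] := fill_size.
have k0 : 0 < initSize uw by apply: leq_trans leT.
rewrite -[RHS](sum_share k0) -szu -sz; congr sumn.
apply: (@eq_from_nth _ 0); first by rewrite size_mkseq.
rewrite sz => j ltj; rewrite nth_mkseq //.
have := H j ltj; rewrite /= nth_set_nth /=; case: (j =P i) => [->|_].
  by move=> /weight_det; apply; apply: fill_weight_r.
case Ec: (nth _ _ j) => [c|]; last by move/weight_inv.
move=> /weight_det; apply; apply: fill_weight; last exact: Hsz.
  rewrite -Ec; exact: (ok_child I fill_tracked Ew).
rewrite -Ec; exact: (fill_not_child fill_tracked Ew).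
Qed.

Lemma fill_inv : tree_inv s'.
Proof.
split; first exact: fill_struct.
move=> a u a0 /hand_tracked Pa Eu; have [v0 [Ea Eis Esz Ect Eo]] := fill_inner Eu.
have [b1 b2 b3 b4 b5 b6 b7 b8] := inv_bound I a0 Pa Ea.
have small x : match onth (hp s) x with
      | Some (Inner u') => initSize u' <= 4 /\ 1 < size (children u')
      | Some (Rebuild _ _ _ _) => False | _ => True end ->
      match onth h' x with
      | Some (Inner u') => initSize u' <= 4 /\ 1 < size (children u')
      | Some (Rebuild _ _ _ _) => False | _ => True end.
  rewrite R.2; case: (x =P w) => [->|//].
  by rewrite Ew /= size_set_nth (maxn_idPr lti).
case: (a =P w) => [Eaw|Na]; last first.
  have Euv := Eo Na; rewrite -Euv in b1 b2 b3 b4 b5 b6 b7 b8.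
  split=> //.
  - move=> k /(fill_weight_back Pa Eu Na) H; apply: b1; apply: H; by left.
  - move=> k /(fill_weight_back Pa Eu Na) H; apply: b2; apply: H; by left.
  - move=> j l ltj /(fill_weight_back Pa Eu Na) H; apply: (b3 j l ltj); apply: H.
    by right; exists j.
  - move=> j x u'; rewrite /= fill_child => Ex /fill_inner [u1 [Eu1 -> _ _ _]].
    exact: b4 Ex Eu1.
  - by move=> j x le4 /(b5 _ _ le4); apply: small.
have Ev0 : v0 = uw by move: Ea; rewrite Eaw Ew => -[].
have Eus : u = set_child uw i (Some r) by move: Eu; rewrite Eaw fill_self => -[].
have Esl : slack s' a = slack s a by [].
have [leT szu Hsz] := fill_size.
have k0 : 0 < initSize uw by apply: leq_trans leT.
rewrite Ev0 in Eis Esz Ect b1 b2 b3 b4 b5 b6 b7 b8.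
split; rewrite ?Esl ?Eis ?Esz ?Ect //.
- by move=> k; rewrite Eaw => /(fill_total (e := 0) isT) ->; apply: leq_addr.
- by move=> k; rewrite Eaw => /(fill_total (e := 1) isT) ->; apply: leq_addr.
- move=> j l ltj W; suff -> : l = share (initSize uw) j.
    by apply: leq_trans (leq_addr _ _); apply: share_bound.
  move: W; rewrite Eus /= nth_set_nth /=; case: (j =P i) => [->|_].
    by move=> /weight_det; apply; apply: fill_weight_r.
  case Ec: (nth _ _ j) => [c|]; last by move/weight_inv.
  move=> /weight_det; apply; apply: fill_weight; last exact: Hsz.
    rewrite -Ec; exact: (ok_child I fill_tracked Ew).
  rewrite -Ec; exact: (fill_not_child fill_tracked Ew).
- move=> j x u'; rewrite /= fill_child Eus /= nth_set_nth /=; case: (j =P i) => [_|_]; last first.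
    by move=> Ex /fill_inner [u1 [Eu1 -> _ _ _]]; apply: b4 Ex Eu1.
  move: Hr => /=; case Er: (onth _ r) => [[|? ?|ur|? ? ? ?]|] // [_ _ le _] [<-].
  rewrite fill_onth ?Er; last exact: fill_rw.
  move=> [<-]; apply: leq_trans le _; apply: leq_trans (leq_addr _ _).
  exact: share_bound.
- move=> j x le4; rewrite Eus /= nth_set_nth /=; case: (j =P i) => [_|_]; last first.
    by move=> /(b5 _ _ le4); apply: small.
  move=> [<-]; apply: small.
  move: Hr => /=; case Er: (onth _ r) => [[|? ?|ur|? ? ? ?]|] // [_ _ le sz]; split=> //.
  apply: leq_trans le (leq_trans _ le4); apply: share_le => //.
  by rewrite -szu.
Qed.

Lemma fill_rely t' : t' <> t -> rely t' s s'.
Proof.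
move=> Nt; split=> //=; first exact: fill_ext.
- move=> a; have [[-> ->]|[_ ->]] := hand_kd a => //.
  by split=> // -[E]; case: Nt.
- move=> a Ka; split=> //; apply: fill_onth => Eab.
  by move: Ka; rewrite Eab Kw.
Qed.

End Fill.
End Publish.

(** * Layout of fresh trees *)

Fixpoint tree_weight (e : nat) (t : tree) : nat :=
  match t with
  | Defs.TEmpty => e
  | TSingle _ _ => 1
  | TInner _ ts => sumn (map (tree_weight e) ts)
  end.

(** Names the local fixpoint inside [alloc], so that it can be reasoned about. *)
Fixpoint alloc_seq (ts : seq tree) (h : heap) : heap * seq ptr :=
  match ts with
  | [::] => (h, [::])
  | t :: ts' =>
      let: (h1, c) := alloc t h in
      let: (h2, cs) := alloc_seq ts' h1 in
      (h2, c :: cs)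
  end.

Lemma alloc_innerE ks ts h : alloc (TInner ks ts) h =
  let: (h', cs) := alloc_seq ts h in
  (rcons h' (Inner V (MkInner (tree_size (TInner ks ts)) (size ts) (map Some ks) cs clean 0 0)),
   Some (size h')).
Proof. by []. Qed.

(** What the invariant requires of a fresh tree; it covers the ideal trees and the trees made by
    updates. Equal weights for [e = 0] and [e = 1] mean that no Empty occurs below an Inner node. *)
Inductive good : tree -> Prop :=
| good_empty : good TEmpty
| good_single k v : good (TSingle k v)
| good_inner ks ts : let n := tree_size (TInner ks ts) in
    1 < size ts -> tree_weight 0 (TInner ks ts) = n -> tree_weight 1 (TInner ks ts) = n ->
    (forall i, i < size ts -> tree_size (nth TEmpty ts i) <= n /\
       tree_size (nth TEmpty ts i) <= slot_bound n /\
       tree_weight 1 (nth TEmpty ts i) <= slot_bound n) ->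
    (forall i, i < size ts -> good (nth TEmpty ts i)) ->
    good (TInner ks ts).

Definition fresh_node (h : heap) (hm : nat -> nat * nat) (lo a : nat) : Prop :=
  match onth h a with
  | Some (Inner u) =>
    [/\ [/\ complete u, status u = clean & 1 < size (children u)],
       forall j b, nth null (children u) j = Some b -> lo <= b < a /\ hm b = (a, j),
       forall e, e < 2 -> weight h e (Some a) (initSize u),
       forall j, j < size (children u) -> exists2 l,
         weight h 1 (nth null (children u) j) l & l <= slot_bound (initSize u) &
       forall j b u', nth null (children u) j = Some b -> onth h b = Some (Inner V u') ->
        [/\ initSize u' <= initSize u, initSize u' <= slot_bound (initSize u) &
         1 < size (children u')]]
  | Some (Rebuild _ _ _ _) | None => False
  | _ => True
  end.

Lemma fresh_node_ext h h' hm hm' lo lo' a : extends h h' -> a < size h -> lo' <= lo ->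
  (forall b, lo <= b < a -> hm' b = hm b) -> fresh_node h hm lo a -> fresh_node h' hm' lo' a.
Proof.
move=> X lta lel Hhm; rewrite /fresh_node X.2 //.
case: (onth h a) => [[|? ?|u|? ? ? ?]|] // [n1 n2 n3 n4 n5]; split=> //.
- move=> j b /n2 [ltb Hb]; rewrite Hhm //; split=> //; lia.
- by move=> e /n3; apply: extends_weight.
- by move=> j /n4 [l Wl le]; exists l => //; apply: (extends_weight X Wl).
- move=> j b u' Eb; rewrite X.2; first exact: (n5 j b u' Eb).
  have [/andP [_ ltb] _] := n2 j b Eb; exact: (ltn_trans ltb lta).
Qed.

Definition up_node (h : heap) (an : nat -> seq nat) (hm : nat -> nat * nat) (lo hi a : nat) : Prop :=
  exists v, [/\ onth h (hm a).1 = Some (Inner V v), lo <= (hm a).1 < hi,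
    (hm a).2 < size (children v) & an a = rcons (an (hm a).1) a].

Definition root_node (h : heap) (r : nat) (t : tree) : Prop :=
  match onth h r with
  | Some (Inner u) => initSize u = tree_size t /\ 1 < size (children u)
  | Some (Rebuild _ _ _ _) | None => False
  | _ => True
  end.

(** [alloc] numbers the nodes in postorder, so the root has the last address. The home [(q, i)] and
    the ancestors [P] of the root come from the caller, which knows the slot the tree is meant
    for. *)
Record placed (h h' : heap) (r : nat) (t : tree) (q i : nat) (P : seq nat)
  (an : nat -> seq nat) (hm : nat -> nat * nat) : Prop := {
  pl_ext : extends h h';
  pl_lo : size h <= r;
  pl_hi : r.+1 = size h';
  pl_hm : hm r = (q, i);
  pl_an : an r = rcons P r;
  pl_weight : forall e, weight h' e (Some r) (tree_weight e t);
  pl_root : root_node h' r t;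
  pl_node : forall a, size h <= a < size h' -> fresh_node h' hm (size h) a;
  pl_up : forall a, size h <= a < r -> up_node h' an hm (size h) (size h') a
}.

Record placed_seq (h h' : heap) (cs : seq ptr) (ts : seq tree) (q i : nat) (P : seq nat)
  (an : nat -> seq nat) (hm : nat -> nat * nat) : Prop := {
  ps_ext : extends h h';
  ps_size : size cs = size ts;
  ps_child : forall j, j < size ts -> exists b, [/\ nth null cs j = Some b,
    size h <= b < size h', hm b = (q, i + j), root_node h' b (nth TEmpty ts j) &
    forall e, weight h' e (Some b) (tree_weight e (nth TEmpty ts j))];
  ps_node : forall a, size h <= a < size h' -> fresh_node h' hm (size h) a;
  ps_up : forall a, size h <= a < size h' -> up_node h' an hm (size h) (size h') a \/
    exists j, [/\ j < size ts, hm a = (q, i + j) & an a = rcons P a]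
}.

Definition placeable (t : tree) : Prop := forall h h' r q i P, alloc t h = (h', r) ->
  exists r0 an hm, r = Some r0 /\ placed h h' r0 t q i P an hm.

(** Consecutive subtrees occupy consecutive ranges of addresses, so their ghost functions are pasted
    together at a boundary. *)
Definition glue A (m : nat) (f g : nat -> A) (a : nat) : A := if a < m then f a else g a.

Lemma extends_rcons h (x : node) : extends h (rcons h x).
Proof.
split; first by rewrite size_rcons leqnSn.
move=> a lta; rewrite -cats1 onth_cat lta //.
Qed.

Lemma onth_rcons_last h (x : node) : onth (rcons h x) (size h) = Some x.
Proof. by rewrite -cats1 onth_cat ltnn subnn. Qed.

Lemma placeable_leaf (t : tree) x :
  (forall h, alloc t h = (rcons h x, Some (size h))) ->
  (forall h e, weight (rcons h x) e (Some (size h)) (tree_weight e t)) ->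
  match x with Inner _ | Rebuild _ _ _ _ => False | _ => True end ->
  placeable t.
Proof.
move=> Ha Hw Hx h h' r q i P; rewrite Ha => -[<- <-].
exists (size h), (fun a => rcons P a), (fun _ => (q, i)); split=> //; split=> //.
- exact: extends_rcons.
- by rewrite size_rcons.
- by rewrite /root_node onth_rcons_last; case: (x) Hx.
- move=> a; rewrite size_rcons ltnS => /anti_leq <-.
  by rewrite /fresh_node onth_rcons_last; case: (x) Hx.
- by move=> a; rewrite ltnNge; case: leqP.
Qed.

Lemma placeable_seq ts : (forall i, i < size ts -> placeable (nth TEmpty ts i)) ->
  forall h h' cs q i P, alloc_seq ts h = (h', cs) ->
  exists an hm, placed_seq h h' cs ts q i P an hm.
Proof.
elim: ts => [|t ts IH] Hts h h' cs q i P /=.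
  move=> [<- <-]; exists (fun=> [::]), (fun=> (0, 0)); split=> //.
  - by move=> a; rewrite ltnNge; case: leqP.
  - by move=> a; rewrite ltnNge; case: leqP.
case E1: (alloc t h) => [h1 c]; case E2: (alloc_seq ts h1) => [h2 ds] [<- <-] {h' cs}.
have [r [an1 [hm1 [Ec P1]]]] := Hts 0 isT _ _ _ q i P E1.
have [|an2 [hm2 P2]] := IH _ _ _ _ q i.+1 P E2.
  by move=> j ltj; apply: (Hts j.+1).
have [x1 l1 hi1 hm1r an1r w1 rt1 nd1 up1] := P1.
have [x2 sz2 ch2 nd2 up2] := P2.
have le1 := x1.1; have le2 := x2.1; simpl in hi1.
exists (glue (size h1) an1 an2), (glue (size h1) hm1 hm2); split.
- exact: (extends_trans x1 x2).
- by rewrite /= sz2.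
- move=> [|j] ltj.
    exists r; split=> //.
    + by lia.
    + by rewrite /glue addn0 ifT //; lia.
    + by move: rt1; rewrite /root_node x2.2 //; lia.
    + by move=> e; apply: (extends_weight x2); apply: w1.
  have [b [e1 e2 e3 e4 e5]] := ch2 j ltj; exists b; split=> //.
  + lia.
  + by rewrite /glue ifF; [rewrite e3 addSnnS|lia].
- move=> a lta; have [lt|ge] := ltnP a (size h1).
    apply: (@fresh_node_ext h1 h2 hm1 _ (size h)) => //.
      by move=> b /andP [_ ltb]; rewrite /glue ifT //; lia.
    by apply: nd1; lia.
  apply: (@fresh_node_ext h2 h2 hm2 _ (size h1)) => //; [lia| |by apply: nd2; lia].
  by move=> b ltb; rewrite /glue ifF //; lia.
- move=> a lta; have [lt|ge] := ltnP a (size h1).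
    have [Ea|Na] := a =P r.
      right; exists 0; rewrite /glue lt Ea; split=> //; by rewrite ?addn0.
    left; have [|v [v1 v2 v3 v4]] := up1 a; first lia.
    have lt1 : (hm1 a).1 < size h1 by case/andP: v2.
    exists v; rewrite /up_node /glue lt lt1; split=> //; last by lia.
    by rewrite x2.2.
  rewrite /up_node /glue ltnNge ge /=.
  have [|[v [v1 v2 v3 v4]]|[j [ltj j2 j3]]] := up2 a; first lia.
    left; exists v; rewrite ifF; last by lia.
    by split=> //; lia.
  by right; exists j.+1; rewrite -addSnnS.
Qed.

Lemma good_placeable t : good t -> placeable t.
Proof.
elim=> {t} [|k v|ks ts n lts W0 W1 Hts _ IH].
- apply: (@placeable_leaf _ (Empty K V)) => // h e.
  by apply: weight_empty; rewrite /skel /= onth_rcons_last.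
- apply: (@placeable_leaf _ (Single k v)) => // h e.
  by apply: weight_single; rewrite /skel /= onth_rcons_last.
move=> h h' r q i P; rewrite alloc_innerE.
case E: (alloc_seq ts h) => [h1 cs] [<- <-].
(* The children are allocated before their parent, yet its future address [size h1] must be their
   home; [E] already determines [h1]. *)
have [an [hm [x1 sz ch nd up]]] := placeable_seq IH (size h1) 0 (rcons P (size h1)) E.
set u := MkInner _ _ _ _ _ _ _; set h2 := rcons h1 _.
have x2 : extends h1 h2 := extends_rcons _ _.
have le1 := x1.1.
have sz2 : size h2 = (size h1).+1 by rewrite size_rcons.
have Eu : onth h2 (size h1) = Some (Inner V u) by rewrite onth_rcons_last.
have Wu e : weight h2 e (Some (size h1)) (tree_weight e (TInner ks ts)).
  apply: (@weight_inner _ _ _ cs); rewrite ?size_map ?sz //.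
    by rewrite /skel /= Eu.
  move=> j ltj; have [b [-> _ _ _ Wb]] := ch j ltj.
  by rewrite (nth_map TEmpty) //; apply: (extends_weight x2).
exists (size h1), (glue (size h1) an (fun a => rcons P a)), (glue (size h1) hm (fun=> (q, i))).
have gl : forall A (f g : nat -> A) a, a < size h1 -> glue (size h1) f g a = f a.
  by move=> A f g a lta; rewrite /glue lta.
have gr : forall A (f g : nat -> A), glue (size h1) f g (size h1) = g (size h1).
  by move=> A f g; rewrite /glue ltnn.
split=> //; split=> //.
- exact: (extends_trans x1 x2).
- by rewrite /root_node Eu /= sz.
- move=> a; rewrite sz2 => lta.
  have [lt|ge] := ltnP a (size h1).
    apply: (@fresh_node_ext h1 h2 hm _ (size h)) => //.
      by move=> b ltb; rewrite gl //; lia.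
    by apply: nd; lia.
  have -> : a = size h1 by lia.
  rewrite /fresh_node Eu; split.
  + split=> //; rewrite /= ?sz //; split; rewrite /= ?sz //.
    by move=> j ltj; have [b [-> _ _ _ _]] := ch j ltj.
  + move=> j b /= Eb; have ltj : j < size ts.
      by rewrite -sz ltnNge; apply/negP => ge'; rewrite nth_default in Eb.
    have [b' [+ ltb Hb _ _]] := ch j ltj; rewrite Eb => -[Ebb].
    by rewrite gl Ebb //; lia.
  + by move=> [|[|]] // _; [have := Wu 0; rewrite W0|have := Wu 1; rewrite W1].
  + move=> j /=; rewrite sz => ltj; exists (tree_weight 1 (nth TEmpty ts j)).
      by have [b [-> _ _ _ Wb]] := ch j ltj; apply: (extends_weight x2).
    by have [_ []] := Hts j ltj.
  + move=> j b u' /= Eb; have ltj : j < size ts.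
      by rewrite -sz ltnNge; apply/negP => ge'; rewrite nth_default in Eb.
    have [b' [+ ltb _ rt _]] := ch j ltj; rewrite Eb => -[Ebb].
    rewrite x2.2; last by lia.
    move: rt; rewrite /root_node Ebb => + Eu'; rewrite Eu' => -[-> ?].
    by have [? []] := Hts j ltj.
- move=> a lta; have lta1 : a < size h1 by lia.
  rewrite /up_node (gl _ hm _ _ lta1) (gl _ an _ _ lta1).
  have [|[v [v1 v2 v3 v4]]|[j [ltj j2 j3]]] := up a; first lia.
    exists v; rewrite gl; last by lia.
    split=> //; [exact: extends_onth x2 v1|lia].
  exists u; rewrite j2 /= gr; split=> //; [lia|by rewrite add0n sz].
Qed.

Lemma ideal_size s (t : tree) : ideal s t -> tree_size t = size s.
Proof.
elim=> {s t} // ss ks ts n _ _ _ _ Hs _ _ _ IH /=.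
rewrite size_flatten; congr sumn; apply: (@eq_from_nth _ 0); first by rewrite !size_map.
move=> i; rewrite size_map => lti; rewrite (nth_map TEmpty) // (nth_map [::]) ?Hs //.
by apply: IH; rewrite Hs.
Qed.

(** A child of an ideal Inner node gets at least [Nat.sqrt n >= 1] keys, so Empty can only be the
    whole tree. *)
Lemma ideal_weight s (t : tree) e : ideal s t ->
  tree_weight e t = if size s == 0 then e else size s.
Proof.
elim=> {s t} // ss ks ts n n1 _ _ Hall Hs _ _ _ IH.
have pos i : i < size ss -> 0 < size (nth [::] ss i).
  move=> lti; have /(all_nthP [::])/(_ i lti) := Hall.
  have := sqrt_gt0 (ltnW n1); have := Nat.le_sqrt_sqrt_up n.
  by rewrite /floor_or_ceil_sqrt => ? ? /orP [/eqP ->|/eqP ->]; lia.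
rewrite ifF; last by rewrite -/n; apply/negbTE; rewrite -lt0n ltnW.
rewrite /= size_flatten; congr sumn; apply: (@eq_from_nth _ 0); first by rewrite !size_map.
move=> i; rewrite size_map => lti; rewrite (nth_map TEmpty) // (nth_map [::]) ?Hs //.
have lti' : i < size ss by rewrite Hs.
by rewrite IH // ifF //; apply/negbTE; rewrite -lt0n pos.
Qed.

Lemma floor_or_ceil_bound n m : floor_or_ceil_sqrt n m -> m <= slot_bound n.
Proof.
have := Nat.le_sqrt_up_succ_sqrt n.
by rewrite /floor_or_ceil_sqrt /slot_bound => ? /orP [/eqP ->|/eqP ->]; lia.
Qed.

Lemma leq_nth_sumn l i : nth 0 l i <= sumn l.
Proof.
elim: l i => [|x l IH] [|i] //=; first lia.
have := IH i; lia.
Qed.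

Lemma ideal_good s (t : tree) : ideal s t -> good t.
Proof.
elim=> {s t} [|k v|ss ks ts n n1 lts Hf Hall Hs Hks Hpart Hi IH]; try by constructor.
have Hid : ideal (flatten ss) (TInner ks ts) by apply: ideal_inner.
have En := ideal_size Hid.
have n0 : (size (flatten ss) == 0) = false by apply/negbTE; rewrite -lt0n ltnW.
apply: good_inner => //.
- by rewrite (ideal_weight 0 Hid) En n0.
- by rewrite (ideal_weight 1 Hid) En n0.
- move=> i lti; have lti' : i < size ss by rewrite Hs.
  have Hi' := Hi i lti'.
  have /(all_nthP [::])/(_ i lti') /floor_or_ceil_bound B := Hall.
  have Ei := ideal_size Hi'.
  rewrite En Ei (ideal_weight 1 Hi'); split.
    have := leq_nth_sumn (shape ss) i; rewrite (nth_map [::]) //.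
    by rewrite -size_flatten.
  split=> //; case: eqP => // _; rewrite /slot_bound; lia.
- by move=> i lti; apply: IH; rewrite Hs.
Qed.

Lemma replacement_good (m : modification K V) c t : replacement m c = Some t -> good t.
Proof.
case: m => [k v|k]; case: c => [|k' v'|? ? ? ?|? ? ?] //=.
- by move=> [<-]; constructor.
- case: ifP => _; first by move=> [<-]; constructor.
  by case: ifP => _ [<-]; apply: good_inner => // -[|[|]] //= _; constructor.
- by move=> [<-]; constructor.
- by move=> [<-]; constructor.
- by case: ifP => // _ [<-]; constructor.
Qed.

(** * Guarantees of a thread, and steps that allocate *)

Record stepped (t : 'I_p) (s s' : state) : Prop := {
  st_inv :> tree_inv s';
  st_ext : ext s s';
  st_rely : forall t', t' <> t -> rely t' s s'
}.

Lemma stepped_trans t s s' s'' : stepped t s s' -> stepped t s' s'' -> stepped t s s''.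
Proof.
move=> A B; split; first exact: B.
- exact: ext_trans (st_ext A) (st_ext B).
- move=> t' N; exact: rely_trans (st_rely A N) (st_rely B N).
Qed.

(** A publication affects all private nodes of [t] at once, so its hypotheses are kept for all of
    them. *)
Definition private_nodes (s : state) (t : 'I_p) (q i : nat) : Prop :=
  forall a, kd s a = KPriv t -> match onth (hp s) a with
    | Some (Inner u) => complete u /\ (kd s (hm s a).1 = KPriv t \/ hm s a = (q, i))
    | Some (Rebuild _ _ _ _) | None => False
    | _ => True
    end.

Record private_tree (s : state) (t : 'I_p) (r q i : nat) (t0 : tree) : Prop := {
  pt_kd : kd s r = KPriv t;
  pt_hm : hm s r = (q, i) /\ r <> 0;
  pt_weight : forall e, weight (hp s) e (Some r) (tree_weight e t0);
  pt_root : root_node (hp s) r t0;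
  pt_nodes : private_nodes s t q i
}.

(** The slot for which the tree is intended becomes the home of its root already here, whether or
    not the later DCSS succeeds. *)
Lemma alloc_tree_step s t (t0 : tree) h' r q i v : tree_inv s -> good t0 ->
  alloc t0 (hp s) = (h', r) ->
  onth (hp s) q = Some (Inner V v) -> i < size (children v) -> shared (kd s q) ->
  exists s' r0, [/\ hp s' = h', r = Some r0, stepped t s s', same_own t s s' &
    private_tree s' t r0 q i t0].
Proof.
move=> I G Ea Eq lti Sq.
have [r0 [an0 [hm0 [Er P]]]] := good_placeable G q i (an s q) Ea.
have [X lo hi Hr Ar W Rt Nd Up] := P.
pose an' a := if a < size (hp s) then an s a else an0 a.
pose hm' a := if a < size (hp s) then hm s a else hm0 a.
pose s' : state := State h' (alloc_kind s t h') an' hm' (dn s) (eg s) (ic s).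
have [u0 [E0 _ _]] := i_root I.
have pos := onth_ltn E0.
have ltq := onth_ltn Eq.
have Aan a : a < size (hp s) -> an' a = an s a by rewrite /an' => ->.
have Ahm a : a < size (hp s) -> hm' a = hm s a by rewrite /hm' => ->.
have Ban a : size (hp s) <= a -> an' a = an0 a by rewrite /an' ltnNge => ->.
have Bhm a : size (hp s) <= a -> hm' a = hm0 a by rewrite /hm' ltnNge => ->.
have newk a : size (hp s) <= a -> a < size h' -> kd s' a = KPriv t.
  by move=> ge lt; apply: alloc_new; rewrite ge.
have Nup a u : size (hp s) <= a -> onth h' a = Some (Inner V u) ->
    exists v, [/\ onth h' (hm' a).1 = Some (Inner V v),
      (hm' a).2 < size (children v), an' a = rcons (an' (hm' a).1) a,
      up_kind (kd s' a) (kd s' (hm' a).1) &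
      kd s' (hm' a).1 = KPriv t \/ hm' a = (q, i)].
  move=> ge Ea'; have lta := onth_ltn Ea'; rewrite newk //.
  have [Ear|Nar] := a =P r0.
    exists v; rewrite Bhm // Ban // Ear Hr Ar /= Aan //; split=> //; last by right.
      exact: extends_onth X Eq.
    have NP : kd s q <> KPriv t by move=> E; rewrite E in Sq.
    have ND : kd s q <> KDead by move=> E; rewrite E in Sq.
    rewrite (alloc_old _ I) // ; case: (kd s q) Sq => [||op|] // _; last by apply: Or32.
    by apply: Or33; exists op.
  have [|v' [e1 /andP [e2 e2'] e3 e4]] := Up a; first by apply/andP; split; lia.
  exists v'; rewrite Bhm // !Ban //; rewrite !newk //; split=> //; [exact: Or31|by left].
have Anew a u j b : size (hp s) <= a -> onth h' a = Some (Inner V u) ->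
    nth null (children u) j = Some b -> size (hp s) <= b.
  move=> ge Ea' Eb; have := Nd a; rewrite /fresh_node Ea' => -[|_ /(_ j b Eb) [/andP [] //]].
  by rewrite ge (onth_ltn Ea').
have Ainv a u : size (hp s) <= a -> onth h' a = Some (Inner V u) ->
   node_inv s' a u /\ bound_inv s' a u.
  move=> ge Ea'; have lta := onth_ltn Ea'.
  have := Nd a; rewrite /fresh_node Ea' => -[|[n1 n1' n1''] n2 n3 n4 n5]; first by rewrite ge.
  have ka := newk a ge lta.
  have sub j b : nth null (children u) j = Some b ->
      [/\ size (hp s) <= b, b < size h', kd s' b = KPriv t & hm' b = (a, j)].
    move=> /n2 [/andP [geb ltb] Hb]; have ltb' := ltn_trans ltb lta.
    by rewrite Bhm //; split=> //; apply: newk.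
  have leaf j b : nth null (children u) j = Some b ->
      match onth h' b with Some (Rebuild _ _ _ _) | None => False | _ => True end.
    move=> /sub [geb ltb _ _]; have := Nd b; rewrite /fresh_node geb ltb => /(_ isT).
    by case: (onth h' b) => [[|? ?|x|? ? ? ?]|].
  split; split=> //.
  - by case: n1 => ->.
  - exact: ltnW.
  - by move=> a0; have [v' [? ? ? ? _]] := Nup a u ge Ea'; exists v'.
  - move=> j b Eb; have [geb ltb kb hb] := sub j b Eb.
    have := leaf j b Eb; rewrite /child_inv /=; case: (onth h' b) => [[|? ?|x|? ? ? ?]|] // _.
    rewrite -[alloc_kind _ _ _ b]/(kd s' b) -[alloc_kind _ _ _ a]/(kd s' a) kb ka; split=> //; lia.
  - by move=> op _; left.
  - by rewrite n1'.
  - by move=> k /weight_det /(_ (n3 0 isT)) ->; apply: leq_addr.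
  - by move=> k /weight_det /(_ (n3 1 isT)) ->; apply: leq_addr.
  - move=> j l ltj W1; have [l' W2 le] := n4 j ltj.
    by rewrite (weight_det W1 W2); apply: leq_trans le (leq_addr _ _).
  - move=> j w u'; rewrite /inner_child /=; case Eb: (nth _ _ j) => [b|] //.
    have := leaf j b Eb; case Ebb: (onth h' b) => [[|? ?|x|? ? ? ?]|] // _ [<-].
    rewrite Ebb => -[<-]; have [_ le _] := n5 j b x Eb Ebb.
    exact: leq_trans le (leq_addr _ _).
  - move=> j b le4 Eb /=; have := leaf j b Eb.
    case Ebb: (onth h' b) => [[|? ?|x|? ? ? ?]|] // _.
    have [le _ ?] := n5 j b x Eb Ebb; split=> //; exact: leq_trans le4.
  - by left.
  - have N : kd s a <> KPub by move=> E; move: ka; rewrite /= (alloc_pub _ _ I).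
    by left; have [] := i_ghost0 I N.
  - have N : kd s a <> KPub by move=> E; move: ka; rewrite /= (alloc_pub _ _ I).
    by rewrite /=; have [-> _ ->] := i_ghost0 I N; rewrite cards0.
have ge0 : size (hp s) <= r0 by [].
have lt0 : r0 < size h' by rewrite -hi.
exists s', r0; split=> //.
  split; [by apply: alloc_inv|by apply: (alloc_ext t I)|by move=> t' N; apply: (alloc_rely I)].
split=> //.
- exact: newk.
- by rewrite /= Bhm //; split=> //; lia.
move=> a Ka; have : alloc_kind s t h' a <> KDead by rewrite -[alloc_kind _ _ _ _]/(kd s' a) Ka.
move=> /(alloc_kind_inv) [[_ _ N E]|[/andP [ge lt] _]].
  by case: N; rewrite -E.
have := Nd a; rewrite /fresh_node /= ge lt => /(_ isT).
case Ea': (onth h' a) => [[|? ?|x|? ? ? ?]|] // [[n1 _ _] _ _ _ _]; split=> //.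
by have [v' [_ _ _ _ ?]] := Nup a x ge Ea'.
Qed.

Lemma alloc_node_step s t (x : node) (q i : nat) : tree_inv s ->
  match x with
  | Inner u => exists v, [/\ onth (hp s) q = Some (Inner V v), i < size (children v), shared (kd s q),
     exists k, u = MkInner k 0 (nseq (Nat.sqrt k).-1 None) (nseq (Nat.sqrt k) null) clean 0 0 &
       0 < initSize u]
  | _ => True
  end ->
  exists s', [/\ hp s' = rcons (hp s) x, stepped t s s', same_own t s s',
    forall a, kd s' a = KPriv t <-> a = size (hp s) & hm s' (size (hp s)) = (q, i)].
Proof.
move=> I Hx; set h' := rcons (hp s) x.
have X : extends (hp s) h' := extends_rcons _ _.
pose n := size (hp s).
pose an' a := if a < n then an s a else rcons (an s q) a.
pose hm' a := if a < n then hm s a else (q, i).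
pose s' : state := State h' (alloc_kind s t h') an' hm' (dn s) (eg s) (ic s).
have [u0 [E0 _ _]] := i_root I.
have pos : 0 < n := onth_ltn E0.
have Aan a : a < n -> an' a = an s a by rewrite /an' => ->.
have Ahm a : a < n -> hm' a = hm s a by rewrite /hm' => ->.
have sz : size h' = n.+1 by rewrite size_rcons.
have En : onth h' n = Some x by apply: onth_rcons_last.
have kn : kd s' n = KPriv t by apply: alloc_new; rewrite leqnn sz /=.
have only a : n <= a -> a < size h' -> a = n by rewrite sz; lia.
have Anew a u j b : n <= a -> onth h' a = Some (Inner V u) ->
    nth null (children u) j = Some b -> n <= b.
  move=> ge Ea; have Ean := only a ge (onth_ltn Ea).
  move: Ea; rewrite Ean En => -[Ex]; move: Hx; rewrite Ex => -[v [_ _ _ [k ->] _]] /=.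
  by rewrite nth_nseq; case: ifP.
have Ainv a u : n <= a -> onth h' a = Some (Inner V u) -> node_inv s' a u /\ bound_inv s' a u.
  move=> ge Ea; have Ean := only a ge (onth_ltn Ea).
  rewrite Ean in Ea *; move: (Ea); rewrite En => -[Ex]; move: Hx; rewrite Ex.
  move=> [v [Eq lti Sq [k Eu] k0]].
  have kq : 0 < Nat.sqrt k by apply: sqrt_gt0; rewrite Eu in k0.
  have ltq := onth_ltn Eq.
  have nullc j : nth null (children u) j = null by rewrite Eu /= nth_nseq; case: ifP.
  have szc : size (children u) = Nat.sqrt k by rewrite Eu /= size_nseq.
  (* A null slot has no weight, so a blank node has none, and its bounds are vacuous. *)
  have noW e m : ~ weight (hp s') e (Some n) m.
    move=> /weight_inv; rewrite {1}/skel /= Ea /= => -[ks [_ _ /(_ 0)]].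
    by rewrite nullc szc => /(_ kq) /weight_inv.
  have N : kd s n <> KPub by move=> E; move: kn; rewrite /= (alloc_pub _ _ I).
  have [z1 z2 z3] := i_ghost0 I N.
  split; split=> //.
  - by rewrite Eu.
  - by rewrite szc.
  - move=> _; exists v; rewrite /= /hm' ltnn /= (Aan q) // /an' ltnn; split=> //.
      exact: extends_onth X Eq.
    have NP : kd s q <> KPriv t by move=> E; rewrite E in Sq.
    have ND : kd s q <> KDead by move=> E; rewrite E in Sq.
    rewrite -[alloc_kind _ _ _ n]/(kd s' n) kn.
    rewrite (alloc_old _ I) // ; case: (kd s q) Sq => [||op|] // _; last by apply: Or32.
    by apply: Or33; exists op.
  - by move=> j b; rewrite nullc.
  - by rewrite kn.
  - by rewrite kn.
  - by rewrite Eu.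
  - by rewrite Eu.
  - by move=> m /noW.
  - by move=> m /noW.
  - by move=> j l _; rewrite nullc => /weight_inv.
  - by move=> j w u'; rewrite nullc.
  - by move=> j b _; rewrite nullc.
  (* [Nat.sqrt k = 1] forces [k < 4]. Apart from the sentinel, this is how nodes with one child
     arise. *)
  - rewrite szc Eu /=; have [_] := Nat.sqrt_spec k (Nat.le_0_l k).
    by case: (Nat.sqrt k) kq => [|[|m]] // _; [right; lia|left].
  - by left.
  - by rewrite /= z1 z3 cards0.
exists s'; split=> //.
- split; [by apply: alloc_inv|by apply: (alloc_ext t I)|by move=> t' N; apply: (alloc_rely I)].
- move=> a; split=> [Ka|->//].
  have : alloc_kind s t h' a <> KDead by rewrite -[alloc_kind _ _ _ _]/(kd s' a) Ka.
  move=> /(alloc_kind_inv) [[_ _ N E]|[/andP [ge lt] _]]; last exact: only.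
  by case: N; rewrite -E.
- by rewrite /= /hm' ltnn.
Qed.

(** Other threads cannot modify private Inner nodes, and leaves are immutable; the subtree contains
    nothing else. *)
Lemma private_weight s s' t e c k : tree_inv s -> rely t s s' ->
  weight (hp s) e c k ->
  (forall b, c = Some b -> exists2 x, onth (hp s) b = Some x &
     match x with Inner _ => kd s b = KPriv t | Rebuild _ _ _ _ => False | _ => True end) ->
  weight (hp s') e c k.
Proof.
move=> I Rl W Pc.
have st b x : onth (hp s) b = Some x ->
    match x with Inner _ => kd s b = KPriv t | Rebuild _ _ _ _ => False | _ => True end ->
    onth (hp s') b = Some x.
  case: x => [|k0 v0|u|? ? ? ?] Eb //.
  - by have [x' -> /= ->] := x_heap Rl Eb.
  - by have [x' -> /= ->] := x_heap Rl Eb.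
  - by move=> /(r_priv Rl) [->].
apply: (@weight_restrict (hp s) (hp s') e (fun c => forall b, c = Some b ->
  exists2 x, onth (hp s) b = Some x & match x with
    Inner _ => kd s b = KPriv t | Rebuild _ _ _ _ => False | _ => True end)
  _ _ _ c k W Pc) => {c k W Pc}.
- move=> [b|] // /(_ b erefl) [x Eb Hx]; by rewrite /skel /= Eb (st b x Eb Hx).
- move=> [b|] // cs j /(_ b erefl) [x Eb Hx]; rewrite /skel /= Eb /=.
  case: x Eb Hx => [|k0 v0|u|? ? ? ?] //= Eb Kb [<-] ltj d Ed0.
  have Pb : kd s b <> KDead by rewrite Kb.
  have := nd_child (i_node I Pb Eb) Ed0; rewrite /child_inv; case Ed: (onth _ d) => [y|] //.
  move=> Hy; exists y => //.
  case: y Ed Hy => [|? ?|u1|? ? ? ?] Ed //; first by move=> [-> _ _].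
  by rewrite Kb => -[].
- move=> [b|] // d /(_ b erefl) [x Eb Hx]; rewrite /skel /= Eb /=.
  by case: x Eb Hx.
Qed.

Lemma private_tree_rely s s' t r q i t0 : tree_inv s -> rely t s s' ->
  private_tree s t r q i t0 -> private_tree s' t r q i t0.
Proof.
move=> I Rl [K1 [H1 H2] W Rt N].
have [er ar hr] := r_priv Rl K1.
split.
- exact/(r_kd Rl).
- by rewrite hr.
- move=> e; apply: (private_weight I Rl (W e)) => b [<-].
  by move: Rt; rewrite /root_node; case: (onth _ r) => [x|] // Rt; exists x => //; case: x Rt.
- by rewrite /root_node er.
- move=> a /(r_kd Rl) Ka; have [-> _ ->] := r_priv Rl Ka.
  have := N a Ka; case: (onth _ a) => [[|? ?|u|? ? ? ?]|] // [C D]; split=> //.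
  by case: D => D; [left; apply/(r_kd Rl)|right].
Qed.

(** * Rely-guarantee logic *)

(* The updates charged to [t] are over, and a descent of [t] that has passed [L]
   cannot reach the nodes at which they are charged. *)
Definition engaged (s : state) (t : 'I_p) (L : seq nat) : Prop :=
  forall y, (t \in ic s y) = false /\ (t \in eg s y -> closedx s L y).

Local Notation idle s t := (engaged s t [::]).

Definition pub_inner (s : state) (a : nat) : Prop :=
  kd s a = KPub /\ exists u, onth (hp s) a = Some (Inner V u).

Definition pub_rebuild (s : state) (b v : nat) : Prop :=
  kd s b = KPub /\ exists w q i, onth (hp s) b = Some (Rebuild K V (Some v) w q i).

Definition path_of (s : state) (L : seq nat) : path_t :=
  [seq (Some x, (hm s x).2) | x <- L].

Definition markable (s : state) (c : ptr) : Prop :=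
  exists b x, [/\ c = Some b, onth (hp s) b = Some x &
    match x with
    | Inner _ => kd s b = KPub /\ closed s b
    | Rebuild _ _ _ _ => kd s b = KPub
    | _ => True
    end].

Definition marked_at (s : state) (b : nat) (cs : seq ptr) : Prop :=
  kd s b = KPub /\ exists u, [/\ onth (hp s) b = Some (Inner V u), marked u & children u = cs].

Definition building (s : state) (b v w k len : nat) : Prop :=
  [/\ pub_rebuild s b v, frozen (hp s) (Some v) k, T <= k, new_target (hp s) b = Some w &
   exists u, onth (hp s) w = Some (Inner V u) /\ size (children u) = len].

Definition ready (s : state) (w : nat) : Prop :=
  kd s w = KPub \/ exists x, onth (hp s) w = Some x /\
    match x with Inner u => complete u | Rebuild _ _ _ _ => False | _ => True end.

Definition filled (s : state) (w : nat) : Prop :=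
  exists u, onth (hp s) w = Some (Inner V u) /\ degree u = size (children u).

Section Thread.
Variable t : 'I_p.

(** In [ModifyFrom], the nodes passed are the ancestors of the current one. In [StartRebuild], a
    parent other than the sentinel has initial size above 4 because its comparison failed after at
    least one increment; every charge not yet closed is at or below [m] and will be closed together
    with [m]. *)
Definition pre (f : proc) (s : state) : Prop :=
  match f with
  | Modify _ | Lookup _ | LookupFrom _ _ => idle s t
  | ModifyFrom m n path => exists a, [/\ n = Some a, pub_inner s a,
      path = path_of s (an s a) & engaged s t (an s a)]
  | StartRebuild u q i => exists m, [/\ u = Some m, pub_inner s m,
      m <> 0 /\ q = Some (hm s m).1 /\ i = (hm s m).2,
      (hm s m).1 = 0 \/ (exists2 v, onth (hp s) (hm s m).1 = Some (Inner V v) & 4 < initSize v)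
      & forall y, t \in eg s y -> (m \in an s y /\ pub_inner s y) \/ closed s y]
  | HelpRebuild op => idle s t /\ exists b v, op = Some b /\ pub_rebuild s b v
  | MarkAndCount c => idle s t /\ markable s c
  | MarkLoop c deg => idle s t /\ exists b cs, [/\ c = Some b, marked_at s b cs & deg <= size cs]
  | CreateIdealCollaborative op k => idle s t /\ exists b v,
      [/\ op = Some b, pub_rebuild s b v & frozen (hp s) (Some v) k]
  | FillLoop op nt k len => idle s t /\ exists b v w,
      [/\ op = Some b, nt = Some w & building s b v w k len]
  end.

Definition post (f : proc) : proc_res f -> state -> Prop :=
  match f return proc_res f -> state -> Prop with
  | Modify _ | ModifyFrom _ _ _ | StartRebuild _ _ _ | HelpRebuild _
  | MarkLoop _ _ => fun _ s => idle s t
  | Lookup _ | LookupFrom _ _ => fun _ s => idle s t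
  | MarkAndCount c => fun r s => idle s t /\ frozen (hp s) c r
  | CreateIdealCollaborative op k => fun r s => idle s t /\
      exists b w, [/\ op = Some b, r = Some w, new_target (hp s) b = Some w & ready s w]
  | FillLoop op nt k len => fun r s => idle s t /\
      exists w, nt = Some w /\ if r then filled s w else kd s w = KPub
  end.

(* A call is replaced by the specification of the procedure, whatever its
   termination; after it, only facts stable under [ext] are kept. *)
Fixpoint wp A (m : prog A) (Q : A -> state -> Prop) (s : state) : Prop :=
  match m with
  | Ret x => Q x s
  | Do c k => forall s1, rely t s s1 -> tree_inv s1 ->
      forall r h2, exec (hp s1) r h2 ->
      exists s2, [/\ hp s2 = h2, stepped t s1 s2 & wp (k r) Q s2]
  | Call f k => pre f s /\ forall r s1, ext s s1 -> tree_inv s1 -> post r s1 ->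
      wp (k r) Q s1
  end.

Lemma stepped_refl s : tree_inv s -> stepped t s s.
Proof. by move=> I; split=> //; [exact: ext_refl|move=> t' _; exact: rely_refl]. Qed.

Lemma wp_act A c (f : prim_res c -> prog A) Q s :
  (forall s1, rely t s s1 -> tree_inv s1 ->
      forall r h2, exec (hp s1) r h2 ->
      exists s2, [/\ hp s2 = h2, stepped t s1 s2 & wp (f r) Q s2]) ->
  wp (Do f) Q s.
Proof. by []. Qed.

Definition reads (c : prim) : bool :=
  match c with Peek _ | Read _ | KeyOfRank _ _ => true | _ => false end.

Lemma wp_read A c (f : prim_res c -> prog A) Q s : reads c ->
  (forall s1 r, rely t s s1 -> tree_inv s1 -> exec (hp s1) r (hp s1) -> wp (f r) Q s1) ->
  wp (Do f) Q s.
Proof.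
move=> Rc H; apply: wp_act => s1 R1 I1 r h2 E; exists s1.
have E2 : h2 = hp s1.
  by case: c Rc r f H E => //= => [a _ r f _ []|a _ r f _ []|a n _ r f _ [? [? []]]].
by rewrite E2 in E *; split=> //; [exact: stepped_refl|exact: H].
Qed.

Lemma wp_call A f (k : proc_res f -> prog A) Q s : pre f s ->
  (forall r s1, ext s s1 -> tree_inv s1 -> post r s1 -> wp (k r) Q s1) ->
  wp (Call k) Q s.
Proof. by []. Qed.

Lemma wp_tail f Q s : pre f s -> (forall r s1, ext s s1 -> tree_inv s1 -> post r s1 -> Q r s1) ->
  wp (call f) Q s.
Proof. by []. Qed.

Lemma rely_ext (s s' : state) : rely t s s' -> ext s s'. Proof. by case. Qed.

Lemma wp_bind A B (m : prog A) (k : A -> prog B) Q' Q s : tree_inv s -> wp m Q' s ->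
  (forall r s1, ext s s1 -> tree_inv s1 -> Q' r s1 -> wp (k r) Q s1) ->
  wp (bind m k) Q s.
Proof.
elim: m s => [x|c f IH|g f IH] s I /=.
- by move=> q H; apply: H => //; apply: ext_refl.
- move=> Hm H s1 R1 I1 r h2 E; have [s2 [E2 S2 W2]] := Hm s1 R1 I1 r h2 E.
  exists s2; split=> //; apply: IH => //; first exact: S2.
  move=> x s3 X3; apply: H; apply: ext_trans X3.
  exact: ext_trans (rely_ext R1) (st_ext S2).
- move=> [Hp Hm] H; split=> // r s1 X1 I1 P1; apply: IH => //; first exact: Hm.
  by move=> x s3 X3; apply: H; apply: ext_trans X3.
Qed.

Lemma engaged_own (s s' : state) L : ext s s' -> same_own t s s' -> engaged s t L -> engaged s' t L.
Proof.
move=> X O E y; have [e1 e2] := O y; rewrite e1 e2; have [? H] := E y; split=> //.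
by move=> /H; apply: closedx_ext X.
Qed.

Lemma engaged_rely (s s' : state) L : rely t s s' -> engaged s t L -> engaged s' t L.
Proof. by move=> R; apply: engaged_own (r_own R); apply: rely_ext. Qed.

Lemma engaged_idle (s : state) L : engaged s t L -> idle s t.
Proof.
move=> E y; have [? H] := E y; split=> // /H [P [x [x1 _ x3 x4]]]; split=> //.
by exists x.
Qed.

Lemma pub_inner_ext (s s' : state) a : ext s s' -> pub_inner s a -> pub_inner s' a.
Proof.
move=> X [P [u E]]; split; first exact: (x_pub X).
by have [u' E' _] := ext_inner X E; exists u'.
Qed.

Lemma pub_rebuild_ext (s s' : state) b v : ext s s' -> pub_rebuild s b v -> pub_rebuild s' b v.
Proof.
move=> X [P [w [q [i E]]]]; split; first exact: (x_pub X).
by have [w' E' _] := ext_rebuild X E; exists w', q, i.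
Qed.

Lemma pub_an (s s' : state) a : ext s s' -> kd s a = KPub -> an s' a = an s a /\ hm s' a = hm s a.
Proof. by move=> X P; rewrite (x_an X) ?(x_hm X) ?P. Qed.

Lemma path_of_ext (s s' : state) a : struct_inv s -> ext s s' -> pub_inner s a ->
  path_of s' (an s' a) = path_of s (an s a).
Proof.
move=> I X [P [u E]]; have [-> _] := pub_an X P; apply/eq_in_map => x xa.
by have [Px _ _ _ _] := anc_pub I P E xa; have [_ ->] := pub_an X Px.
Qed.

Lemma markable_ext (s s' : state) c : ext s s' -> markable s c -> markable s' c.
Proof.
move=> X [b [x [-> E H]]]; have [x' E' le] := x_heap X E; exists b, x'; split=> //.
case: x E H le => [|? ?|u|tt w q i] E H /=; try by move=> ->.
  move=> [u' -> _]; case: H => H1 H2; split; [exact: (x_pub X)|exact: closedx_ext X H2].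
by move=> [w' -> _]; apply: (x_pub X).
Qed.

Lemma marked_at_ext (s s' : state) b cs : ext s s' -> marked_at s b cs -> marked_at s' b cs.
Proof.
move=> X [P [u [E M C]]]; split; first exact: (x_pub X).
have [u' E' le] := ext_inner X E; have [M' C'] := le_marked le M.
by exists u'; rewrite C'.
Qed.

Lemma new_target_ext (s s' : state) b w : ext s s' -> new_target (hp s) b = Some w ->
  new_target (hp s') b = Some w.
Proof.
move=> X; rewrite /new_target; case E: (onth (hp s) b) => [[|? ?|?|tt w' q i]|] // Ew.
have [w2 -> [H|->]] := ext_rebuild X E => //.
by rewrite H in Ew.
Qed.

Lemma building_ext (s s' : state) b v w k len : ext s s' -> building s b v w k len ->
  building s' b v w k len.
Proof.
move=> X [h1 h2 h3 h4 [u [E S]]]; split=> //.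
- exact: pub_rebuild_ext X h1.
- exact: frozen_le (x_heap X) h2.
- exact: new_target_ext X h4.
- have [u' E' le] := ext_inner X E; exists u'; split=> //.
  by rewrite (le_size le).
Qed.

Lemma pre_rely f (s s' : state) : tree_inv s -> rely t s s' -> pre f s -> pre f s'.
Proof.
move=> I R; have X := rely_ext R; case: f => /=.
- by move=> _; apply: engaged_rely.
- move=> m n path [a [-> P -> E]]; exists a; split=> //.
  + exact: pub_inner_ext X P.
  + by rewrite (path_of_ext I X P).
  + by have [-> _] := pub_an X P.1; apply: engaged_rely E.
- by move=> _; apply: engaged_rely.
- by move=> _ _; apply: engaged_rely.
- move=> u q i [m [-> P [m0 Hq] Hs He]].
  have [Am Hm] := pub_an X P.1.
  exists m; rewrite Hm; split=> //.
  + exact: pub_inner_ext X P.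
  + case: Hs => [|[v E le]]; [by left|right].
    by have [v' E' le'] := ext_inner X E; exists v'; rewrite // (le_init le').
  + move=> y; have [-> _] := r_own R y => /He [[my Py]|C]; [left|right].
      have [-> _] := pub_an X Py.1; split=> //; exact: pub_inner_ext X Py.
    exact: closedx_ext X C.
- move=> op [E [b [v [-> P]]]]; split; first exact: engaged_rely E.
  by exists b, v; split=> //; apply: pub_rebuild_ext X P.
- move=> c [E M]; split; [exact: engaged_rely E|exact: markable_ext X M].
- move=> c d [E [b [cs [-> M le]]]]; split; first exact: engaged_rely E.
  by exists b, cs; split=> //; apply: marked_at_ext X M.
- move=> op k [E [b [v [-> P F]]]]; split; first exact: engaged_rely E.
  exists b, v; split=> //; [exact: pub_rebuild_ext X P|exact: frozen_le (x_heap X) F].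
- move=> op nt k len [E [b [v [w [-> -> B]]]]]; split; first exact: engaged_rely E.
  by exists b, v, w; split=> //; apply: building_ext X B.
Qed.

(** For a primitive, [wp] already allows for interference, so only the preconditions of calls and
    the final assertion have to be stable. *)
Lemma wp_rely A (m : prog A) (Q : A -> state -> Prop) (s s' : state) : tree_inv s -> rely t s s' ->
  (forall x, Q x s -> Q x s') -> wp m Q s -> wp m Q s'.
Proof.
move=> I R HQ; case: m => [x|c k|f k] /=; first exact: HQ.
- by move=> H s1 R1; apply: H; apply: rely_trans R1.
- move=> [P H]; split; first exact: pre_rely R P.
  by move=> r s1 X1; apply: H; apply: ext_trans X1; apply: rely_ext.
Qed.

End Thread.

Arguments wp : simpl never.

(** * Insert, delete and the start of a rebuild *)

Section Updates.

Variable t : 'I_p.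

Lemma node_at_peek (h : heap) b x r h' : onth h b = Some x ->
  exec h (c := Peek K V (Some b)) r h' -> r = view_of x.
Proof. by move=> E [] /=; rewrite E => -[<-]. Qed.

Lemma get_child (h : heap) a i c : get h (Child (Some a) i) = Some c ->
  exists u, [/\ onth h a = Some (Inner V u), i < size (children u) & nth null (children u) i = c].
Proof.
rewrite /= /inner_at /=; case E: (onth h a) => [[|? ?|u|? ? ? ?]|] //= Ec.
by exists u; split=> //; [exact: onth_ltn Ec|exact: onth_nth Ec].
Qed.

Lemma get_status (h : heap) a st : get h (Status (Some a)) = Some st ->
  exists2 u, onth h a = Some (Inner V u) & status u = st.
Proof.
by rewrite /= /inner_at /=; case E: (onth h a) => [[|? ?|u|? ? ? ?]|] //= [<-]; exists u.
Qed.

(** * Ancestor lists as search paths *)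

Section Path.
Variable s : state.
Hypothesis I : struct_inv s.

Lemma an_rcons a u : kd s a = KPub -> onth (hp s) a = Some (Inner V u) -> a <> 0 ->
  [/\ an s a = rcons (an s (hm s a).1) a, pub_inner s (hm s a).1 &
     last 0 (an s (hm s a).1) = (hm s a).1].
Proof.
move=> Pa Ea a0; have [v [Ev _ Ean Uk]] := nd_up (i_node I (tracked_pub Pa) Ea) a0.
rewrite Pa /= in Uk; split=> //; first by split=> //; exists v.
have [->|/eqP q0] := eqVneq (hm s a).1 0; first by rewrite (root_an I).
have [w [_ _ -> _]] := nd_up (i_node I (tracked_pub Uk) Ev) q0.
by rewrite last_rcons.
Qed.

Lemma an_split a L m R : pub_inner s a -> an s a = L ++ m :: R ->
  [/\ an s m = rcons L m, (hm s m).1 = last 0 L & m <> 0 /\ pub_inner s m].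
Proof.
move=> [Pa [u Ea]]; elim/last_ind: R a u Pa Ea => [|R y IH] a u Pa Ea.
all: have [->|/eqP a0] := eqVneq a 0; first by rewrite (root_an I); case: (L).
all: have [Ean [Pq [uq Eq]] El] := an_rcons Pa Ea a0.
  rewrite cats1 => Ea'; have := Ea'; rewrite Ean => /rcons_inj [EL Em].
  rewrite -EL -Em; split=> //; split=> //; split=> //; by exists u.
rewrite Ean -rcons_cons -rcons_cat => /rcons_inj [EL _].
exact: IH Pq Eq EL.
Qed.

Lemma an_uniq a : pub_inner s a -> uniq (an s a).
Proof.
move=> [Pa [u Ea]]; elim: {a}(size (an s a)) {-2}a (leqnn (size (an s a))) u Pa Ea => [|n IH] a le u Pa Ea.
  by move: le; rewrite leqn0 size_eq0 => /eqP ->.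
have [->|/eqP a0] := eqVneq a 0; first by rewrite (root_an I).
have [Ean [Pq [uq Eq]] _] := an_rcons Pa Ea a0.
rewrite Ean rcons_uniq; apply/andP; split; last first.
  by apply: (IH _ _ uq) => //; move: le; rewrite Ean size_rcons.
apply/negP => aq; have [_ _ _ [r Er] _] := anc_pub I Pq Eq aq.
by move: (congr1 size Er); rewrite Ean size_cat size_rcons; lia.
Qed.

Lemma an_mem_sub a y : pub_inner s a -> y \in an s a ->
  [/\ pub_inner s y, y <> 0, {subset an s y <= an s a} & y \in an s y].
Proof.
move=> [Pa [u Ea]] ya; have [Py y0 Ey [r Er] yy] := anc_pub I Pa Ea ya.
by split=> // z; rewrite Er mem_cat => ->.
Qed.

End Path.

(** Describes [t] between its successful DCSS and the end of its comparisons: its open charges are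
    at [L], and [M] lists the counts incremented but not compared. [M] first grows to the whole
    path; then both lists shrink from the top. *)
Definition pend (s : state) (L M : seq nat) : Prop :=
  forall y, [/\ t \in eg s y -> y \in L \/ closed s y, y \in L -> t \in eg s y &
    (t \in ic s y) = (y \in M)].

Lemma pend_own (s s' : state) L M : ext s s' -> same_own t s s' -> pend s L M -> pend s' L M.
Proof.
move=> X O H y; have [h1 h2 h3] := H y; have [e1 e2] := O y; rewrite e1 e2; split=> //.
by move=> /h1 [yL|C]; [left|right; apply: (closedx_ext X C)].
Qed.

Lemma pend_rely (s s' : state) L M : rely t s s' -> pend s L M -> pend s' L M.
Proof. by move=> R; apply: (pend_own (r_ext R) (r_own R)). Qed.

(** A charge of [t] sits below a replaced node that is off the path, whereas the ancestors of a node
    on the path are on the path. So a new charge really enlarges [eg], and a set of threads suffices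
    to count the charges. *)
Lemma not_engaged (s : state) a y : tree_inv s -> pub_inner s a -> engaged s t (an s a) ->
  y \in an s a -> t \notin eg s y.
Proof.
move=> I P E ya; apply/negP => /(E y).2 [_ [x [xy xa _ _]]].
by have [_ _ sub _] := an_mem_sub I P ya; move: xa; rewrite sub.
Qed.

Definition leaf_weight (e : nat) (x : node) : nat :=
  match x with Empty => e | _ => 1 end.

Definition is_leaf (x : node) : bool :=
  match x with Empty | Single _ _ => true | _ => false end.

(** Changing one leaf changes each count by at most one, and adding [t] to [eg] at every node of the
    path pays for it. *)
Lemma event_step (s : state) a un i b0 x0 r t0 h' : tree_inv s ->
  kd s a = KPub -> onth (hp s) a = Some (Inner V un) -> i < size (children un) ->
  nth null (children un) i = Some b0 -> onth (hp s) b0 = Some x0 -> is_leaf x0 ->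
  status un = clean -> private_tree s t r a i t0 -> engaged s t (an s a) ->
  (forall e, e < 2 -> leaf_weight e x0 <= tree_weight e t0 + 1 /\
     tree_weight e t0 <= leaf_weight e x0 + 1) -> tree_size t0 <= 2 ->
  replaced (hp s) a (Inner V (set_child un i (Some r))) h' ->
  exists s', [/\ hp s' = h', stepped t s s', pub_inner s' a, an s' a = an s a &
    pend s' (an s a) [::]].
Proof.
move=> I Pa Ea lti Eb Eb0 lf st PT En Hw t2 R.
have Pia : pub_inner s a by split=> //; exists un.
have [pk [ph r0] pw prt pn] := PT.
pose eg' y := if y \in an s a then t |: eg s y else eg s y.
have Wc e x : weight (hp s) e (nth null (children un) i) x -> x = leaf_weight e x0.
  rewrite Eb => /weight_inv; rewrite /skel /= Eb0 /=.
  by case: (x0) lf.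
have Wc' e : weight (hp s) e (nth null (children un) i) (leaf_weight e x0).
  rewrite Eb; case: x0 Eb0 lf {Hw Wc} => [|k v|?|? ? ? ?] // Eb0 _.
    by apply: weight_empty; rewrite /skel /= Eb0.
  by apply: weight_single; rewrite /skel /= Eb0.
have NPr y : kd s y = KPub -> y <> r by move=> Py Ey; rewrite Ey pk in Py.
have Wr e x : weight h' e (Some r) x -> x = tree_weight e t0.
  move=> /weight_det; apply; apply: (weight_off_path I Pa Ea _ _ _ (pw e)).
  - by move=> b nb; rewrite /skel /= R.2; case: eqP nb.
  - move=> v; move: prt; rewrite /root_node /=; case Er: (onth _ r) => [[|? ?|ur|? ? ? ?]|] // _ [<-].
    by rewrite pk; split=> //; exists ur.
  - move=> v; move: prt; rewrite /root_node /=; case Er: (onth _ r) => [[|? ?|ur|? ? ? ?]|] // _ [<-].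
    by move=> /(on_path_inner I Pa Ea) [/NPr].
pose s' : state := State h' (move_kind (KPriv t) KPub (kd s)) (an s) (hm s) (dn s) eg' (ic s).
have k0u : KPriv t <> KPub /\ KPriv t <> KDead by [].
have C1 y u : kd s y = KPriv t -> onth (hp s) y = Some (Inner V u) -> complete u.
  by move=> /pn + E; rewrite E => -[].
have C2 y u : kd s y = KPriv t -> onth (hp s) y = Some (Inner V u) ->
    kd s (hm s y).1 = KPriv t \/ kd s (hm s y).1 = KPub.
  by move=> /pn + E; rewrite E => -[_ [->|->]]; [left|right].
have C3 b d w q j : kd s b = KPriv t -> onth (hp s) b = Some (Rebuild K V d w q j) ->
  exists v, [/\ d = Some v /\ w = null, q = Some (hm s b).1 /\ j = (hm s b).2,
    hm s v = hm s b /\ v <> 0, (exists u, onth (hp s) v = Some (Inner V u)) /\ kd s v = KPub &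
    hm s v = (a, i)].
  by move=> /pn + E; rewrite E.
have C4 : match onth (hp s) r return Prop with
  | Some (Inner _) => hm s r = (a, i) /\ r <> 0
  | Some (Rebuild _ _ _ _) => hm s r = (a, i)
  | Some _ => True
  | None => False end.
  by move: prt; rewrite /root_node; case: (onth _ r) => [[]|].
have C6 op : KPriv t = KSub op -> hm s op = (a, i) by [].
have R0 x' : weight h' 0 (Some r) x' ->
   exists2 x, weight (hp s) 0 (nth null (children un) i) x & x <= x' + 1.
  by move=> /Wr ->; exists (leaf_weight 0 x0) => //; have [] := Hw 0 isT.
have R1 x' : weight h' 1 (Some r) x' ->
   exists2 x, weight (hp s) 1 (nth null (children un) i) x & x' <= x + 1.
  by move=> /Wr ->; exists (leaf_weight 1 x0) => //; have [] := Hw 1 isT.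
have E1 y : y <> 0 -> on_path s a y -> #|eg' y| = #|eg s y| + 1.
  rewrite /on_path inE => y0 /predU1P [//|ya]; rewrite /eg' ya cardsU1.
  by rewrite (not_engaged I Pia En ya) addnC.
have E2 y : ~ on_path s a y -> eg' y = eg s y.
  rewrite /on_path /eg' => N; case: ifP => // ya; case: N; by rewrite inE ya orbT.
have C7 : a <> 0 -> forall v u', inner_child (hp s) (Some r) = Some v ->
  onth (hp s) v = Some (Inner V u') ->
  initSize u' <= slot_bound (initSize un) + slack s a + 1.
  move=> _ v u'; move: prt; rewrite /root_node /=.
  case Er: (onth _ r) => [[|? ?|ur|? ? ? ?]|] // [E _] [<-]; rewrite Er => -[<-].
  by rewrite E /slot_bound; lia.
have C8 : a <> 0 -> initSize un <= 4 -> match onth (hp s) r return Prop with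
    | Some (Inner u') => initSize u' <= 4 /\ 1 < size (children u')
    | Some (Rebuild _ _ _ _) => False
    | _ => True
    end.
  move: prt; rewrite /root_node; case: (onth _ r) => [[|? ?|ur|? ? ? ?]|] // [-> ?] _ _.
  by split=> //; lia.
have X : ext s s' by apply: (slot_ext (n := a) (un := un) (i := i) (r := r)).
exists s'; split=> //.
- split=> //; first exact: (slot_inv I Pa Ea lti st R k0u C1 C2 C3 pk C4 C6 R0 R1 E1 E2 C7 C8).
  move=> t' Nt; apply: (slot_rely (n := a) (un := un) (i := i) (r := r)) => //.
    by move=> [Et]; case: Nt.
  move=> y; rewrite /eg'; case: ifP => // _; rewrite !inE.
  by case: eqP => // Et; case: Nt.
- exact: pub_inner_ext X Pia.
- move=> y; have [h1 h2] := En y; split=> //.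
  + rewrite /= /eg'; case: ifP => [ya _|_ /h2 C]; first by left.
    right; apply: (closedx_ext X); case: C => P [x [? _ ? ?]]; split=> //; by exists x.
  + by rewrite /= /eg' => ->; rewrite !inE eqxx.
Qed.

Lemma incr_step (s : state) m u h' L M : tree_inv s -> kd s m = KPub -> m <> 0 ->
  onth (hp s) m = Some (Inner V u) -> m \notin M -> pend s L M ->
  h' = @set _ K V (hp s) (NatLoc (Count (Some m))) (Defs.count u + 1) ->
  exists s', [/\ hp s' = h', stepped t s s' & pend s' L (rcons M m)].
Proof.
move=> I Pm m0 Em mM Pd Eh.
pose u' := MkInner (initSize u) (degree u) (keys u) (children u) (status u) (Defs.count u + 1) (nextMark u).
have R : replaced (hp s) m (Inner V u') h'.
  by rewrite Eh; apply: (replaced_inner _ Em).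
have le : inner_le u u' by split=> //=; rewrite leq_addr.
have N := i_node I (tracked_pub Pm) Em.
have sh : shared (kd s m) by rewrite Pm.
have heaple := replaced_le Em le R.
have I1 : tree_inv (with_heap s h').
  apply: (attr_inv (u' := u') I Em R le) => //.
  - exact: nd_deg N.
  - by move=> /(nd_marked N).
  - by move=> k b /(nd_fin N); apply: frozen_le heaple.
pose ic' y := if y == m then t |: ic s y else ic s y.
pose s1 := with_heap s h'.
pose s2 : state := State h' (kd s) (an s) (hm s) (dn s) (eg s) ic'.
have Em' : onth h' m = Some (Inner V u') by rewrite R.2 eqxx.
have I2 : tree_inv s2.
  apply: (ghost_inv I1) => /= [a Na|a v a0 Pa Ea].
    have [-> -> e] := i_ghost0 I Na; rewrite /ic'; case: eqP => // Eam.
    by rewrite Eam in Na.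
  have [b1 b2 b3 b4 b5 b6 b7 b8] := inv_bound I1 a0 (tracked_pub Pa) Ea.
  split=> //; rewrite /ic'; case: eqP => // Eam; rewrite Eam in Ea *.
  move: Ea; rewrite Em' => -[<-] /=.
  have B := bd_count (inv_bound I m0 (tracked_pub Pm) Em).
  rewrite cardsU1; have : (t \notin ic s m) <= 1 by case: (_ \notin _).
  by move: B => /=; lia.
have X1 : ext s s1 by apply: (attr_ext Em R le).
have X2 : ext s1 s2 := ghost_ext _ _ _ _.
exists s2; split=> //.
- split=> //; first exact: ext_trans X1 X2.
  move=> t' Nt; apply: rely_trans (_ : rely t' s s1) _; first by apply: (attr_rely Em R le).
  apply: ghost_rely => y; split=> //; rewrite /ic'; case: eqP => // _.
  by rewrite !inE; case: eqP => // E; case: Nt.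
- move=> y; have [h1 h2 h3] := Pd y; split=> //=.
    move=> /h1 [|C]; [by left|right]; exact: closedx_ext (ext_trans X1 X2) C.
  rewrite mem_rcons inE /ic'; case: eqP => [->|_]; first by rewrite !inE eqxx.
  exact: h3.
Qed.

(** The charge moves from [eg] to [dn], so the slack is unchanged. As [t] is in [ic], the count is
    at least [dn + 1]; the failed comparison thus gives [4 * (dn + 1) < initSize], and also
    [4 < initSize] because the count is positive. *)
Lemma check_step (s : state) m u L : tree_inv s -> kd s m = KPub -> m <> 0 ->
  onth (hp s) m = Some (Inner V u) -> m \notin L -> pend s (m :: L) (m :: L) ->
  4 * Defs.count u < initSize u ->
  exists s', [/\ hp s' = hp s, stepped t s s', 4 < initSize u & pend s' L L].
Proof.
move=> I Pm m0 Em mL Pd lt.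
pose dn' y := if y == m then (dn s y).+1 else dn s y.
pose eg' y := if y == m then eg s y :\ t else eg s y.
pose ic' y := if y == m then ic s y :\ t else ic s y.
pose s' : state := State (hp s) (kd s) (an s) (hm s) dn' eg' ic'.
have [_ /(_ (mem_head _ _)) te] := Pd m; rewrite mem_head => ti.
have B := inv_bound I m0 (tracked_pub Pm) Em.
have Bc := bd_count B.
have ci : #|ic s m| = #|ic s m :\ t| + 1 by rewrite (cardsD1 t) ti addnC.
have ce : #|eg s m| = #|eg s m :\ t| + 1 by rewrite (cardsD1 t) te addnC.
have I' : tree_inv s'.
  apply: (ghost_inv I) => /= [a Na|a v a0 Pa Ea].
    have [e1 e2 e3] := i_ghost0 I Na; rewrite /dn' /eg' /ic'.
    by case: eqP => // Eam; rewrite Eam in Na.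
  have [b1 b2 b3 b4 b5 b6 b7 b8] := inv_bound I a0 (tracked_pub Pa) Ea.
  rewrite /slack /dn' /eg' /ic'; case: (a =P m) => [Eam|_]; last by split.
  rewrite Eam in Ea *; move: Ea; rewrite Em => -[<-].
  rewrite ce; move: Bc; rewrite ci => Bc; split; [|right|].
  - by rewrite addSn addn1 addnS.
  - by apply: leq_trans lt; rewrite ltnS leq_mul2l /=; lia.
  - by move: Bc; rewrite addn1 addnS addSn.
have X : ext s s' := ghost_ext _ _ _ _.
exists s'; split=> //.
- split=> // t' Nt; apply: ghost_rely => y; rewrite /eg' /ic'.
  case: eqP => // _; rewrite !inE; by case: eqP => // E; case: Nt.
- by move: Bc; rewrite ci; lia.
- move=> y; have [h1 h2 h3] := Pd y.
  rewrite /= /eg' /ic'; case: (y =P m) => [->|Nm]; split.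
  + by rewrite !inE eqxx.
  + by rewrite (negPf mL).
  + by rewrite !inE eqxx (negPf mL).
  + move=> /h1 []; last by right.
    by rewrite inE => /predU1P [|]; [|left].
  + by move=> yL; apply: h2; rewrite inE yL orbT.
  + by rewrite h3 inE; case: eqP.
Qed.

(** Forgets increments that will never be compared. The charges themselves stay in [eg], but they
    are closed and so do not prevent later updates by [t]. *)
Lemma drop_step (s : state) : tree_inv s ->
  (forall y, t \in eg s y -> closed s y) ->
  exists s', [/\ hp s' = hp s, stepped t s s' & idle s' t].
Proof.
move=> I H.
pose ic' y := ic s y :\ t.
pose s' : state := State (hp s) (kd s) (an s) (hm s) (dn s) (eg s) ic'.
have X : ext s s' := ghost_ext _ _ _ _.
exists s'; split=> //.
- split=> //.
    apply: (ghost_inv I) => /= [a Na|a v a0 Pa Ea].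
      by have [-> -> e] := i_ghost0 I Na; rewrite /ic' e set0D.
    have [b1 b2 b3 b4 b5 b6 b7 b8] := inv_bound I a0 (tracked_pub Pa) Ea.
    split=> //; apply: leq_trans b8; rewrite leq_add2l subset_leq_card //.
    exact: subsetDl.
  move=> t' Nt; apply: ghost_rely => y; split=> //; rewrite !inE.
  by case: eqP => // E; case: Nt.
- move=> y; split; first by rewrite !inE eqxx.
  by move=> /H; apply: closedx_ext X.
Qed.

End Updates.

Section Modify.

Variable t : 'I_p.

Lemma wp_increment a rest : forall (L : seq nat) path s (Q : unit -> state -> Prop),
  tree_inv s -> pub_inner s a -> an s a = L ++ rest -> map fst path = map Some rest ->
  pend t s (an s a) L ->
  (forall s1, ext s s1 -> tree_inv s1 -> pend t s1 (an s1 a) (an s1 a) -> Q tt s1) ->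
  wp t (incrementCounts K V path) Q s.
Proof.
elim: rest => [|m rest IH] L [|[m' j] path] s Q I P Ea // Ep Pd HQ.
  apply: HQ => //; first exact: ext_refl.
  by rewrite cats0 in Ea; move: Pd; rewrite Ea.
case: Ep => -> Ep; rewrite /= -/(incrementCounts K V).
apply: wp_act => s1 R1 I1 r h2 [/= Er Eh].
have X1 := r_ext R1; have P1 := pub_inner_ext X1 P; have [A1 _] := pub_an X1 P.1.
have Pd1 := pend_rely R1 Pd; rewrite -A1 in Pd1 Ea.
have [Am _ [m0 [Pm [u Em]]]] := an_split I1 P1 Ea.
have mL : m \notin L.
  by have := an_uniq I1 P1; rewrite Ea cat_uniq /= => /and3P [_ /norP []].
have Eu : r = Defs.count u by move: Er; rewrite /inner_at /= Em /= => -[].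
rewrite Eu in Eh; have [s2 [E2 S2 Pd2]] := incr_step I1 Pm m0 Em mL Pd1 Eh.
exists s2; split=> //; have X2 := st_ext S2.
have [A2 _] := pub_an X2 P1.1.
apply: (IH (rcons L m)); rewrite ?A2 //.
- exact: S2.
- exact: pub_inner_ext X2 P1.
- by rewrite Ea cat_rcons.
- by move=> s3 X3; apply: HQ; apply: (ext_trans X1 (ext_trans X2 X3)).
Qed.

Lemma pend_idle (s : state) : pend t s [::] [::] -> idle s t.
Proof.
move=> Pd y; have [h1 h2 ->] := Pd y; split=> // /h1 [] //.
Qed.

(** The charges at [L] have moved to [dn], so every open charge is at or below the node to be
    compared next. Closing that node would close them all. *)
Lemma wp_rebuildFirst a rest : forall (L : seq nat) s,
  tree_inv s -> pub_inner s a -> an s a = L ++ rest ->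
  (last 0 L = 0 \/ exists2 v, onth (hp s) (last 0 L) = Some (Inner V v) & 4 < initSize v) ->
  pend t s rest rest ->
  wp t (rebuildFirst K V (Some (last 0 L)) (path_of s rest)) (fun _ s => idle s t) s.
Proof.
elim: rest => [|m rest IH] L s I P Ea HL Pd; first exact: pend_idle.
have [_ _ [_ Pm0]] := an_split I P Ea.
have Prest x : x \in rest -> kd s x = KPub.
  move=> xr; have xa : x \in an s a by rewrite Ea mem_cat inE xr !orbT.
  by have [[]] := an_mem_sub I P xa.
rewrite /=.
apply: wp_read => // s1 x R1 I1 Ex.
have X1 := r_ext R1; have P1 := pub_inner_ext X1 P; have [A1 _] := pub_an X1 P.1.
have Pd1 := pend_rely R1 Pd; rewrite -A1 in Ea.
have [Am Hm [m0 [Pm [u Em]]]] := an_split I1 P1 Ea.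
rewrite (node_at_peek Em Ex) /= {x Ex}.
apply: wp_act => s2 R2 I2 r h2 [/= Er Eh].
have X2 := r_ext R2; have P2 := pub_inner_ext X2 P1; have [A2 _] := pub_an X2 P1.1.
have Pd2 := pend_rely R2 Pd1; rewrite -A2 in Ea.
have X12 := ext_trans X1 X2.
have [Am2 Hm2 [_ [Pm2 [u2 Em2]]]] := an_split I2 P2 Ea.
have Eu2 : initSize u2 = initSize u.
  by have [u2' ] := ext_inner X2 Em; rewrite Em2 => -[<-] /le_init.
have Er2 : r = Defs.count u2 by move: Er; rewrite /inner_at /= Em2 /= => -[].
have mrest : m \notin rest.
  by have := an_uniq I2 P2; rewrite Ea cat_uniq /= => /and3P [_ _ /andP []].
have subs y : y \in m :: rest -> m \in an s2 y /\ pub_inner s2 y.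
  rewrite inE => /predU1P [->|yr].
    by split; [rewrite Am2 mem_rcons mem_head|split=> //; exists u2].
  have [r1 [r2 Er12]] : exists r1 r2, rest = r1 ++ y :: r2.
    by case/splitPr: yr => r1 r2; exists r1, r2.
  have Ea' : an s2 a = (L ++ m :: r1) ++ y :: r2 by rewrite Ea Er12 -catA.
  have [-> _ [_ Py]] := an_split I2 P2 Ea'; split=> //.
  by rewrite mem_rcons inE mem_cat mem_head !orbT.
have Ehm : hm s2 m = hm s m by have [_ ->] := pub_an X12 Pm0.1.
have [le|gt] := leqP (initSize u) (4 * r).
  exists s2; split=> //; first exact: stepped_refl.
  split=> //; exists m; split=> //.
  - by split=> //; exists u2.
  - by rewrite Hm2 Ehm.
  - rewrite Hm2; case: HL => [|[v Ev lt]]; [by left|right].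
    by have [v' Ev' le'] := ext_inner X12 Ev; exists v'; rewrite // (le_init le').
  - by move=> y; have [h1 _ _] := Pd2 y; move=> /h1 [/subs|]; [left|right].
rewrite Er2 -Eu2 in gt.
(* The comparison takes effect at the moment when the count is read. *)
have [s3 [E3 S3 lt3 Pd3]] := check_step I2 Pm2 m0 Em2 mrest Pd2 gt.
exists s3; split=> //; first by rewrite E3.
have X3 := st_ext S3; have P3 := pub_inner_ext X3 P2; have [A3 _] := pub_an X3 P2.1.
have Ep : path_of s rest = path_of s3 rest.
  apply/eq_in_map => x /Prest Px.
  by have [_ ->] := pub_an (ext_trans X12 X3) Px.
rewrite Ep -[m](last_rcons 0 L).
apply: (IH (rcons L m)) => //.
- exact: S3.
- by rewrite A3 Ea cat_rcons.
- rewrite last_rcons; right; exists u2 => //; by rewrite E3.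
Qed.

(** Each outcome of the DCSS closes [m]. Success puts a Rebuild node into its slot;
    FAILED_MAIN_ADDRESS shows that [m] is no longer there; after FAILED_AUX_ADDRESS the parent is
    marked, hence closed, and its replaced ancestor is also one of [m]. All open charges of [t] are
    below [m] and become closed with it. *)
Lemma wp_startRebuild u q i s : tree_inv s -> pre t (@StartRebuild _ K V u q i) s ->
  wp t (startRebuild K V u q i) (fun _ s => idle s t) s.
Proof.
move=> I [m [-> P0 [m0 [-> ->]] Hs He]].
set q0 := (hm s m).1; set i0 := (hm s m).2.
apply: wp_act => s1 R1 I1 r h2 [-> ->].
have [s2 [E2 S2 O2 K2 H2]] := @alloc_node_step s1 t
  (Rebuild K V (Some m) null (Some q0) i0) q0 i0 I1 Logic.I.
set n0 := size (hp s1) in K2 H2 *.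
exists s2; split=> //.
apply: wp_act => s3 R3 I3 res h4 [v [v' [Gc Gs Hres]]].
have X3 : ext s s3 := ext_trans (r_ext R1) (ext_trans (st_ext S2) (r_ext R3)).
have P3 := pub_inner_ext X3 P0; have [Am Hm] := pub_an X3 P0.1.
have Kn n : kd s3 n = KPriv t <-> n = n0 by rewrite (r_kd R3).
have [En0 _ Hn0] := r_priv R3 ((K2 n0).2 erefl).
rewrite E2 onth_rcons_last in En0; rewrite H2 in Hn0.
have He3 y : t \in eg s3 y -> (m \in an s3 y /\ pub_inner s3 y) \/ closed s3 y.
  have [-> _] := r_own R3 y; have [-> _] := O2 y; have [-> _] := r_own R1 y.
  move=> /He [[my Py]|C]; last by right; apply: (closedx_ext X3).
  left; have [-> _] := pub_an X3 Py.1; split=> //; exact: pub_inner_ext X3 Py.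
have [um Em] := P3.2; have Pm := P3.1.
have [Anm [Pq [uq Eq]] _] := an_rcons I3 Pm Em m0.
have [Hm1 Hm2] : (hm s3 m).1 = q0 /\ (hm s3 m).2 = i0 by rewrite Hm.
rewrite Hm1 in Anm Pq Eq.
have closing s' : ext s3 s' -> same_own t s3 s' -> closed s' m ->
    forall y, t \in eg s' y -> closed s' y.
  move=> X' O' [_ [x [xm _ Px Sx]]] y; have [-> _] := O' y.
  move=> /He3 [[my Py]|]; last exact: closedx_ext X'.
  split; first exact: (x_pub X' Py.1).
  exists x; split=> //; have [-> _] := pub_an X' Py.1.
  have [_ _ sub _] := an_mem_sub I3 Py my; apply: sub.
  by move: xm; have [-> _] := pub_an X' Pm.
have fin s' : ext s3 s' -> same_own t s3 s' -> tree_inv s' -> closed s' m ->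
    exists s4, [/\ hp s4 = hp s', stepped t s' s4 & idle s4 t].
  by move=> X' O' I' C; apply: drop_step => //; apply: (closing s').
have [uc [Euc ltc Ec]] := get_child Gc.
have [us Eus Est] := get_status Gs.
rewrite Eq in Euc; case: Euc => Euc; rewrite -{uc}Euc in ltc Ec.
rewrite Eq in Eus; case: Eus => Eus; rewrite -{us}Eus in Est.
have mm : m \in an s3 m by rewrite Anm mem_rcons mem_head.
case: res Hres => Hres.
- case: Hres => Ev Ev' Eh; rewrite {}Ev in Ec; rewrite {}Ev' in Est.
  pose s4 : state := State h4 (move_kind (KPriv t) KPub (kd s3)) (an s3) (hm s3) (dn s3) (eg s3) (ic s3).
  have R4 : replaced (hp s3) q0 (Inner V (set_child uq i0 (Some n0))) h4.
    by rewrite Eh /=; apply: (replaced_inner _ Eq).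
  have Kn0 : kd s3 n0 = KPriv t by apply/Kn.
  have k0u : KPriv t <> KPub /\ KPriv t <> KDead by [].
  have C1 a u1 : kd s3 a = KPriv t -> onth (hp s3) a = Some (Inner V u1) -> complete u1.
    by move=> /Kn ->; rewrite En0.
  have C2 a u1 : kd s3 a = KPriv t -> onth (hp s3) a = Some (Inner V u1) ->
      kd s3 (hm s3 a).1 = KPriv t \/ kd s3 (hm s3 a).1 = KPub.
    by move=> /Kn ->; rewrite En0.
  have Hq0 : hm s3 m = (q0, i0) by rewrite Hm [LHS]surjective_pairing.
  have C3 b d w q1 j : kd s3 b = KPriv t -> onth (hp s3) b = Some (Rebuild K V d w q1 j) ->
    exists v0, [/\ d = Some v0 /\ w = null, q1 = Some (hm s3 b).1 /\ j = (hm s3 b).2,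
      hm s3 v0 = hm s3 b /\ v0 <> 0, (exists u, onth (hp s3) v0 = Some (Inner V u)) /\ kd s3 v0 = KPub &
      hm s3 v0 = (q0, i0)].
    move=> /Kn ->; rewrite En0 => -[<- <- <- <-]; exists m.
    by rewrite Hn0 Hq0; split=> //; split=> //; exists um.
  have C4 : match onth (hp s3) n0 return Prop with
    | Some (Inner _) => hm s3 n0 = (q0, i0) /\ n0 <> 0
    | Some (Rebuild _ _ _ _) => hm s3 n0 = (q0, i0)
    | Some _ => True
    | None => False end by rewrite En0.
  have C6 op : KPriv t = KSub op -> hm s3 op = (q0, i0) by [].
  have E1 a : a <> 0 -> on_path s3 q0 a -> #|eg s3 a| = #|eg s3 a| + 0 by rewrite addn0.
  have E2' a : ~ on_path s3 q0 a -> eg s3 a = eg s3 a by [].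
  have St := slot_struct I3 Pq Eq ltc Est R4 k0u C1 C2 C3 Kn0 C4 C6 E2'.
  have nm : ~ on_path s3 q0 m.
    rewrite /on_path inE => /predU1P [//|mq].
    have [_ _ _ [r' Er'] _] := anc_pub I3 Pq Eq mq.
    by move: (congr1 size Er'); rewrite Anm size_cat size_rcons; lia.
  have nmq : m <> q0 by move=> E; apply: nm; rewrite E; apply: (on_path_self I3 Pq Eq).
  have nn0q : n0 <> q0 by move=> E; rewrite E Eq in En0.
  have nn0m : n0 <> m by move=> E; rewrite E Em in En0.
  have Em4 : onth h4 m = Some (Inner V um) by rewrite R4.2; case: eqP nmq.
  have En4 : onth h4 n0 = Some (Rebuild K V (Some m) null (Some q0) i0).
    by rewrite R4.2; case: eqP nn0q.
  have Eq4 : onth h4 q0 = Some (Inner V (set_child uq i0 (Some n0))) by rewrite R4.2 eqxx.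
  have Pub4 a : kd s3 a = KPub -> kd s4 a = KPub by move=> Pa; apply: slot_pub.
  (* The Rebuild node has the weight of its target, so nothing has to be paid and [e = 0]. *)
  have Wb e x' : weight h4 e (Some n0) x' -> weight (hp s3) e (nth null (children uq) i0) x'.
    move=> /weight_inv; rewrite /skel /= En4 /= Ec.
    apply: (weight_off_path St (Pub4 _ Pq) Eq4) => //=.
    - by move=> b nb; rewrite /skel /= R4.2; case: eqP nb.
    - by apply: (@ok_self s4 m um _ Em4); rewrite Pub4.
    - by move=> v0; rewrite Em4 => -[<-].
  have R0 x' : weight h4 0 (Some n0) x' ->
     exists2 x, weight (hp s3) 0 (nth null (children uq) i0) x & x <= x' + 0.
    by move=> /Wb W; exists x' => //; rewrite addn0.
  have R1' x' : weight h4 1 (Some n0) x' ->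
     exists2 x, weight (hp s3) 1 (nth null (children uq) i0) x & x' <= x + 0.
    by move=> /Wb W; exists x' => //; rewrite addn0.
  have C7 : q0 <> 0 -> forall v u', inner_child (hp s3) (Some n0) = Some v ->
    onth (hp s3) v = Some (Inner V u') ->
    initSize u' <= slot_bound (initSize uq) + slack s3 q0 + 0.
    move=> qn0 v0 u'; rewrite /= En0 => -[<-] Eu'; rewrite addn0.
    have B := inv_bound I3 qn0 (tracked_pub Pq) Eq.
    by apply: (bd_child B (j := i0)) Eu'; rewrite Ec /= Em.
  have C8 : q0 <> 0 -> initSize uq <= 4 -> match onth (hp s3) n0 return Prop with
      | Some (Inner u') => initSize u' <= 4 /\ 1 < size (children u')
      | Some (Rebuild _ _ _ _) => False
      | _ => True
      end.
    move=> qn0 le4; case: Hs => [//|[v0 Ev0 lt4]].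
    have [v1] := ext_inner X3 Ev0; rewrite Eq => -[<-] /le_init E.
    by move: le4; rewrite E leqNgt lt4.
  have I4 : tree_inv s4 := slot_inv I3 Pq Eq ltc Est R4 k0u C1 C2 C3 Kn0 C4 C6 R0 R1' E1 E2' C7 C8.
  have X4 : ext s3 s4 := slot_ext _ Eq ltc Est R4 k0u Kn0.
  have S4 : stepped t s3 s4.
    split=> // t' Nt; apply: (slot_rely Pq Eq ltc Est R4 k0u Kn0) => //.
    by move=> [E]; case: Nt.
  have C : closed s4 m.
    split; first exact: Pub4.
    exists m; split=> //; first exact: Pub4.
    rewrite /slot /= Hq0 Eq4 /= nth_set_nth /= eqxx => -[]; exact: nn0m.
  have [s5 [E5 S5 Id5]] := fin s4 X4 (fun y => conj erefl erefl) I4 C.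
  exists s5; split; [by rewrite E5|exact: stepped_trans S4 S5|].
  apply: wp_tail; last by [].
  split=> //; exists n0, m; split=> //; apply: (pub_rebuild_ext (st_ext S5)).
  split; first exact: move_kind_in.
  by exists null, (Some q0), i0.
- case: Hres => Nv ->.
  have C : closed s3 m.
    split=> //; exists m; split=> //.
    by rewrite /slot Hm1 Hm2 Eq Ec.
  have [s5 [E5 S5 Id5]] := fin s3 (ext_refl s3) (fun y => conj erefl erefl) I3 C.
  by exists s5.
- case: Hres => Nv ->.
  have C : closed s3 m.
    have /(nd_marked (i_node I3 (tracked_pub Pq) Eq)) : marked uq by rewrite /marked Est.
    move=> [_ [x [xq _ Px Sx]]]; split=> //; exists x; split=> //.
    by rewrite Anm mem_rcons inE xq orbT.
  have [s5 [E5 S5 Id5]] := fin s3 (ext_refl s3) (fun y => conj erefl erefl) I3 C.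
  by exists s5.
Qed.

Lemma wp_lookupFrom k n (s : state) : idle s t -> wp t (lookupFrom V k n) (fun _ s => idle s t) s.
Proof.
move=> E; apply: wp_read => // s1 x R1 I1 _.
have E1 := engaged_rely R1 E; case: x => //=.
- move=> _ _ ks _; apply: wp_read => // s2 c R2 I2 _.
  by apply: wp_tail; [exact: engaged_rely R2 E1|].
Qed.

Lemma wp_modifyFrom m n path s : tree_inv s -> pre t (@ModifyFrom _ K V m n path) s ->
  wp t (modifyFrom m n path) (fun _ s => idle s t) s.
Proof.
move=> I [a [-> P -> En]].
apply: wp_read => // s1 x R1 I1 Ex.
have X1 := r_ext R1; have P1 := pub_inner_ext X1 P; have En1 := engaged_rely R1 En.
rewrite -(path_of_ext I X1 P); have [A1 _] := pub_an X1 P.1; rewrite -A1 in En1.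
have [u1 Ea1] := P1.2; rewrite (node_at_peek Ea1 Ex) /= {x Ex}.
set i := interpolationSearch _ _.
apply: wp_read => // s2 c R2 I2 [Gc _].
have X2 := r_ext R2; have P2 := pub_inner_ext X2 P1; have En2 := engaged_rely R2 En1.
rewrite -(path_of_ext I1 X2 P1); have [A2 _] := pub_an X2 P1.1; rewrite -A2 in En2.
have [u2 [Ea2 lti Ec]] := get_child Gc.
have N2 := i_node I2 (tracked_pub P2.1) Ea2.
case: c Gc Ec => [b|] Gc Ec; last by case: (nd_pub N2 P2.1) => _ /(_ _ lti).
have := nd_child N2 Ec; rewrite /child_inv; case Eb: (onth _ b) => [x|] // Hb.
apply: wp_read => // s3 y R3 I3 Ey.
have X3 := r_ext R3; have P3 := pub_inner_ext X3 P2.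
have [x3 Eb3 le3] := x_heap X3 Eb.
rewrite (node_at_peek Eb3 Ey) {y Ey}.
have [A3 _] := pub_an X3 P2.1.
have En3 := engaged_rely R3 En2; rewrite -A3 in En3.
have [leaf|inn] : is_leaf x \/ ~~ is_leaf x by case: (is_leaf x); [left|right].
  have Ex3 : x3 = x by case: (x) leaf le3.
  rewrite Ex3 in Eb3 le3 *.
  rewrite /=; have -> : forall (A : prog unit) B C, match view_of x with
     | VInner _ _ _ _ => A | VRebuild _ _ _ => B | _ => C end = C.
    by move=> A B C; case: (x) leaf.
  case Er: (replacement m (view_of x)) => [t0|]; last exact: engaged_idle En3.
  apply: wp_act => s4 R4 I4 r h5 /= Ealloc.
  have X4 := r_ext R4; have P4 := pub_inner_ext X4 P3; have [A4 _] := pub_an X4 P3.1.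
  have En4 := engaged_rely R4 En3; rewrite -A4 in En4.
  have [u4 Ea4] := P4.2.
  have [u4' Ea4' le4] := ext_inner (ext_trans X3 X4) Ea2.
  have lt4 : i < size (children u4).
    by move: Ea4'; rewrite Ea4 => -[->]; rewrite (le_size le4).
  have sh : shared (kd s4 a) by rewrite P4.1.
  have [s5 [r0 [E5 -> S5 O5 PT5]]] := alloc_tree_step t I4 (replacement_good Er) (esym Ealloc) Ea4 lt4 sh.
  exists s5; split=> //.
  have X5 := st_ext S5; have I5 : tree_inv s5 := S5.
  have P5 := pub_inner_ext X5 P4; have [A5 _] := pub_an X5 P4.1.
  have En5 := engaged_own X5 O5 En4; rewrite -A5 in En5.
  apply: wp_act => s6 R6 I6 res h7 [v [v' [Gc6 Gs6 Hres]]].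
  have X6 := r_ext R6; have P6 := pub_inner_ext X6 P5; have [A6 _] := pub_an X6 P5.1.
  have En6 := engaged_rely R6 En5; rewrite -A6 in En6.
  have PT6 := private_tree_rely I5 R6 PT5.
  have X36 : ext s3 s6 := ext_trans X4 (ext_trans X5 X6).
  rewrite -(path_of_ext I2 (ext_trans X3 X36) P2).
  have [uc [Euc ltc Ec6]] := get_child Gc6.
  have [us Eus Est] := get_status Gs6.
  rewrite Euc in Eus; case: Eus => Eus; rewrite -{us}Eus in Est.
  case: res Hres => Hres.
  - case: Hres => Ev Ev' Eh; rewrite {}Ev in Ec6; rewrite {}Ev' in Est.
    have Eb6 : onth (hp s6) b = Some x.
      have [x6 -> le6] := x_heap X36 Eb3; congr Some.
      by case: (x) leaf le6.
    have [Hw Ht] : (forall e, e < 2 -> leaf_weight e x <= tree_weight e t0 + 1 /\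
       tree_weight e t0 <= leaf_weight e x + 1) /\ tree_size t0 <= 2.
      move: Er leaf; clear; case: m => [k v|k]; case: x => [|k' v'|?|? ? ? ?] //=.
      + by move=> [<-] _; split=> // -[|[|]].
      + case: ifP => _ [E] _; rewrite -{t0}E; first by split=> // -[|[|]].
        by case: ifP => _; split=> // -[|[|]].
      + by case: ifP => // _ [<-] _; split=> // -[|[|]].
    have R7 : replaced (hp s6) a (Inner V (set_child uc i (Some r0))) h7.
      by rewrite Eh /=; apply: (replaced_inner _ Euc).
    have [s7 [E7 S7 P7 A7 Pd7]] := event_step I6 P6.1 Euc ltc Ec6 Eb6 leaf Est PT6 En6 Hw Ht R7.
    exists s7; split=> //.
    rewrite -(path_of_ext I6 (st_ext S7) P6).
    apply: (wp_bind (Q' := fun _ s => pub_inner s a /\ pend t s (an s a) (an s a)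
      /\ path_of s (an s a) = path_of s7 (an s7 a))); first exact: S7.
      apply: (@wp_increment a (an s7 a) [::]) => //.
      + exact: S7.
      + by rewrite /path_of -map_comp.
      + by rewrite A7.
      move=> s8 X8 I8 Pd8; split; first exact: pub_inner_ext X8 P7.
      split=> //; apply: path_of_ext X8 P7; exact: S7.
    move=> _ s8 X8 I8 [P8 [Pd8 <-]].
    apply: (@wp_rebuildFirst a (an s8 a) [::]) => //; by left.
  - case: Hres => _ ->; exists s6; split=> //; first exact: stepped_refl.
    apply: wp_tail => //; exists a; split=> //.
  - case: Hres => _ ->; exists s6; split=> //; first exact: stepped_refl.
    apply: wp_tail => //; exact: engaged_idle En6.
case: x Eb Hb le3 inn => [|? ?|ub|d w q j] Eb Hb le3 // _.
- case: le3 => ub' Ex3 le3; rewrite Ex3 /=.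
  case: Hb => Kb Hb b0; rewrite P2.1 in Kb.
  have Pb : pub_inner s2 b by split=> //; exists ub.
  have [Ab _ _] := an_rcons I2 Kb Eb b0; rewrite Hb /= in Ab.
  have [Ab3 Hb3] := pub_an X3 Kb.
  apply: wp_tail => //; exists b; split=> //.
  + exact: pub_inner_ext X3 Pb.
  + rewrite (path_of_ext I2 X3 Pb) /path_of Ab map_rcons Hb /=.
    by rewrite -/(path_of s2 _).
  (* When slot [i] was read it held [b]. So the replaced ancestor that closes a charge is not [b],
     and it stays off the path extended by [b]. *)
  + apply: (engaged_rely R3); rewrite Ab3 Ab => z; have [h1 h2] := En2 z; split=> //.
    move=> /h2 [Pz [y [yz ya Py Sy]]]; split=> //; exists y; split=> //.
    rewrite mem_rcons inE negb_or ya andbT; apply/eqP => Eyb; apply: Sy.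
    by rewrite Eyb Hb /slot /= Ea2.
- case: le3 => w' Ex3 _; rewrite Ex3 /=.
  case: Hb => _ Kb Hb.
  have [v [Ed _ _ _ _]] := i_reb I2 Kb Eb.
  rewrite Ed in Eb Ex3.
  have Prb : pub_rebuild s2 b v by split=> //; exists w, q, j.
  apply: wp_call.
    split; first exact: engaged_idle En3.
    by exists b, v; split=> //; apply: (pub_rebuild_ext X3).
  by move=> r4 s4 X4 I4 Id4; apply: wp_tail.
Qed.

End Modify.

(** * Marking and counting *)

Section Rebuilding.

Variable t : 'I_p.

Lemma attr_step (s : state) a u u' h' : tree_inv s ->
  onth (hp s) a = Some (Inner V u) -> shared (kd s a) ->
  replaced (hp s) a (Inner V u') h' -> inner_le u u' -> children u' = children u ->
  degree u' <= size (children u) -> (kd s a = KPub -> degree u' = degree u) ->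
  (marked u' -> closed s a) ->
  (forall k b, status u' = (k, true, b) -> frozen (hp s) (Some a) k) ->
  exists s', [/\ hp s' = h', stepped t s s' & rely t s s'].
Proof.
move=> I Ea sh R le Ec dle Hpub Hm Hf; exists (with_heap s h').
have fr k b : status u' = (k, true, b) -> frozen h' (Some a) k.
  by move=> /Hf; apply: frozen_le; apply: replaced_le Ea le R.
split=> //; last by apply: attr_rely Ea R le Ec sh t.
split=> //; [|exact: (attr_ext Ea R le)|by move=> t' _; apply: attr_rely Ea R le Ec sh t'].
exact: (attr_inv I Ea R le Ec).
Qed.

Lemma closed_self (s : state) v : tree_inv s -> pub_inner s v -> v <> 0 ->
  slot (hp s) (hm s v) <> Some v -> closed s v.
Proof.
move=> I [P [u E]] v0 N; split=> //; exists v; split=> //.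
exact: (an_self I (tracked_pub P) E v0).
Qed.

Lemma target_markable (s : state) b v : tree_inv s -> pub_rebuild s b v ->
  markable s (Some v).
Proof.
move=> I [P [w [q [i E]]]].
have [v' [[<-] _ [Hv v0] [[u Ev] Pv Sv] _]] := i_reb I P E.
exists v, (Inner V u); split=> //; split=> //.
apply: closed_self => //; split=> //; by exists u.
Qed.

Lemma marked_closed (s : state) b cs : tree_inv s -> marked_at s b cs -> closed s b.
Proof.
move=> I [P [u [E M _]]]; exact: (nd_marked (i_node I (tracked_pub P) E) M).
Qed.

(** The replaced ancestor that closes a node also closes its children, so marking may proceed
    downwards. *)
Lemma child_markable (s : state) b cs j c : tree_inv s -> marked_at s b cs ->
  j < size cs -> nth null cs j = c -> markable s c.
Proof.
move=> I M ltj Ec; have [_ [x [xb _ Px Sx]]] := marked_closed I M.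
move: M => [P [u [E _ Ecs]]]; rewrite -Ecs in ltj Ec.
have N := i_node I (tracked_pub P) E.
case: c Ec => [d|] Ec; last by have [_ /(_ j ltj)] := nd_pub N P.
have := nd_child N Ec; rewrite /child_inv; case Ed: (onth _ d) => [y|] // Hy.
exists d, y; split=> //; case: y Ed Hy => [|? ?|v|? ? ? ?] Ed //; last by case.
rewrite P => -[Kd Hd d0]; split=> //; split=> //; exists x; split=> //.
have [-> _ _] := an_rcons I Kd Ed d0.
by rewrite Hd mem_rcons inE xb orbT.
Qed.

Lemma status_step (s : state) b u h' st : tree_inv s -> kd s b = KPub ->
  onth (hp s) b = Some (Inner V u) -> closed s b -> st <> clean ->
  (forall k y, st = (k, true, y) -> frozen (hp s) (Some b) k) ->
  h' = @set _ K V (hp s) (Status (Some b)) st ->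
  exists s', [/\ hp s' = h', stepped t s s', rely t s s' & marked_at s' b (children u)].
Proof.
move=> I P E C Nst Hf Eh.
pose u' := MkInner (initSize u) (degree u) (keys u) (children u) st (Defs.count u) (nextMark u).
have R : replaced (hp s) b (Inner V u') h' by rewrite Eh; apply: (replaced_inner _ E).
have N := i_node I (tracked_pub P) E.
have le : inner_le u u' by split.
have sh : shared (kd s b) by rewrite P.
have [s' [E' S' R']] := attr_step I E sh R le erefl (nd_deg N) (fun _ => erefl) (fun _ => C) Hf.
exists s'; split=> //; split; first exact: (x_pub (st_ext S')).
by exists u'; rewrite E' R.2 eqxx.
Qed.

Definition mac_post (b : nat) (cs : seq ptr) (r : nat) (s : state) : Prop :=
  idle s t /\ exists ks, [/\ size ks = size cs, r = sumn ks &
    forall i, i < size cs -> frozen (hp s) (nth null cs i) (nth 0 ks i)].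

(** The children of a marked node are fixed, and a count stays valid because the counted subtree is
    frozen. The reads therefore need not be simultaneous. *)
Lemma wp_countChildren b cs n : forall j ks s, tree_inv s -> idle s t -> marked_at s b cs ->
  j + n = size cs -> size ks = j ->
  (forall i, i < j -> frozen (hp s) (nth null cs i) (nth 0 ks i)) ->
  wp t (countChildren K V (Some b) (iota j n) (sumn ks)) (mac_post b cs) s.
Proof.
elim: n => [|n IH] j ks s I Id M Ej Ek Hk.
  by split=> //; exists ks; rewrite -Ej addn0 Ek.
rewrite /=.
apply: wp_read => // s1 c R1 I1 [Gc _].
have X1 := r_ext R1; have M1 := marked_at_ext X1 M.
have [u1 [Eu1 ltj Ec]] := get_child Gc.
have Ecs : children u1 = cs by have [_ [u2 [+ _ <-]]] := M1; rewrite Eu1 => -[->].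
rewrite Ecs in ltj Ec.
have Hk1 i : i < j -> frozen (hp s1) (nth null cs i) (nth 0 ks i).
  by move=> /Hk; apply: frozen_le (x_heap X1).
have Mc := child_markable I1 M1 ltj Ec.
move: (Mc) => [d [x [Ecd Ed Hd]]].
apply: wp_read => // s2 y R2 I2 Ey.
have X2 := r_ext R2; have [x2 Ed2 le2] := x_heap X2 Ed.
rewrite Ecd in Ey; rewrite (node_at_peek Ed2 Ey) {y Ey}.
have Id2 := engaged_rely R2 (engaged_rely R1 Id).
have Mc2 := markable_ext X2 Mc.
apply: (wp_bind (Q' := fun m s => idle s t /\ frozen (hp s) c m)) => //.
  case: x Ed Hd le2 => [|k v|u|tt w q i] Ed Hd /=.
  - by move=> Ex; rewrite Ex; split=> //; rewrite Ecd; apply: frozen_empty; rewrite /= Ed2 Ex.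
  - by move=> Ex; rewrite Ex; split=> //; rewrite Ecd; apply: (@frozen_single _ _ k v); rewrite /= Ed2 Ex.
  - move=> [u' Ex le]; rewrite Ex /=.
    apply: wp_read => // s3 st R3 I3 [Gs _].
    have X3 := r_ext R3; rewrite Ecd in Gs; have [us Eus Est] := get_status Gs.
    have Id3 := engaged_rely R3 Id2.
    have Pd3 : kd s3 d = KPub by apply: (x_pub X3); apply: (x_pub X2); case: Hd.
    case: st Gs Est => [[cnt fin] z] _ Est; case: fin Est => Est.
      split=> //; rewrite Ecd.
      exact: (nd_fin (i_node I3 (tracked_pub Pd3) Eus) Est).
    apply: wp_tail; last by [].
    by split=> //; apply: markable_ext X3 Mc2.
  - by move=> [w' Ex _]; rewrite Ex /=; apply: wp_tail.
move=> m s3 X3 I3 [Id3 Fr3].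
have Es : sumn ks + m = sumn (rcons ks m) by rewrite sumn_rcons.
rewrite Es; apply: (IH j.+1) => //.
- exact: marked_at_ext X3 (marked_at_ext X2 M1).
- by rewrite addSnnS.
- by rewrite size_rcons Ek.
- move=> i; rewrite ltnS leq_eqVlt nth_rcons Ek => /predU1P [->|lti].
    by rewrite ltnn eqxx Ec.
  rewrite lti; apply: (frozen_le (x_heap X3)); apply: (frozen_le (x_heap X2)).
  exact: Hk1.
Qed.

Lemma wp_markAndCount c s : tree_inv s -> idle s t -> markable s c ->
  wp t (markAndCount K V T c) (fun r s => idle s t /\ frozen (hp s) c r) s.
Proof.
move=> I Id Mk; move: (Mk) => [b [x [Ec Eb Hb]]]; rewrite Ec.
apply: wp_read => // s1 y R1 I1 Ey.
have X1 := r_ext R1; have [x1 Eb1 le1] := x_heap X1 Eb.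
rewrite (node_at_peek Eb1 Ey) {y Ey}.
have Id1 := engaged_rely R1 Id.
case: x Eb Hb le1 => [|k v|u|tt w q i] Eb Hb /=.
- by move=> Ex; rewrite Ex /=; split=> //; apply: frozen_empty; rewrite /= Eb1 Ex.
- by move=> Ex; rewrite Ex /=; split=> //; apply: (@frozen_single _ _ k v); rewrite /= Eb1 Ex.
- move=> [u1 Ex le1]; rewrite Ex /= in Eb1 *.
  have [Pb C] := Hb.
  have Pb1 := x_pub X1 Pb; have C1 := closedx_ext X1 C.
  have N1 := i_node I1 (tracked_pub Pb1) Eb1.
  have [Dg _] := nd_pub N1 Pb1.
  set cs := children u1 in Dg; rewrite Dg.
  apply: wp_act => s2 R2 I2 r h3 [v Gs Hr].
  have X2 := r_ext R2; have Id2 := engaged_rely R2 Id1.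
  have Pb2 := x_pub X2 Pb1; have C2 := closedx_ext X2 C1.
  have [u2 Eb2 Est] := get_status Gs.
  have [u2' Eb2' le2] := ext_inner X2 Eb1.
  rewrite Eb2 in Eb2'; case: Eb2' => Eu2; rewrite -{u2'}Eu2 in le2.
  have Esz : size (children u2) = size cs := le_size le2.
  (* If the CAS fails, the status is not clean, so the node is marked in either case. *)
  have [s3 [E3 S3 R3 M3]] : exists s3, [/\ hp s3 = h3, stepped t s2 s3, rely t s2 s3 &
      marked_at s3 b (children u2)].
    case: r Hr => -[Ev Eh].
      by apply: (status_step I2 Pb2 Eb2 C2 _ _ Eh) => // k y [].
    exists s2; rewrite Eh; split=> //; [exact: stepped_refl|exact: rely_refl|].
    by split=> //; exists u2; rewrite /marked Est.
  exists s3; split=> //.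
  have Id3 := engaged_rely R3 Id2; have I3 : tree_inv s3 := S3.
  rewrite -Esz; set cs2 := children u2 in M3 *.
  apply: (wp_bind (Q' := fun _ s => idle s t)) => //.
    case: ifP => _ //; apply: wp_tail => //; split=> //.
    by exists b, cs2.
  move=> _ s4 X4 I4 Id4.
  have M4 := marked_at_ext X4 M3.
  apply: (wp_bind (Q' := mac_post b cs2)) => //.
    exact: (@wp_countChildren b cs2 (size cs2) 0 [::]).
  move=> kc s5 X5 I5 [Id5 [ks [szk -> Hk]]].
  have M5 := marked_at_ext X5 M4.
  have Fr s' : ext s5 s' -> tree_inv s' -> frozen (hp s') (Some b) (sumn ks).
    move=> X' I'; have [P' [u' [E' M' Ec']]] := marked_at_ext X' M5.
    have N' := i_node I' (tracked_pub P') E'.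
    apply: (@frozen_inner _ _ u') => //; first exact: nd_pos N'.
      by rewrite Ec'.
    by move=> i; rewrite szk Ec' => /Hk; apply: frozen_le (x_heap X').
  apply: wp_act => s6 R6 I6 r6 h7 [v6 Gs6 Hr6].
  have X6 := r_ext R6; have Id6 := engaged_rely R6 Id5.
  have Fr6 := Fr s6 X6 I6.
  have M6 := marked_at_ext X6 M5.
  have [s7 [E7 S7 R7]] : exists s7, [/\ hp s7 = h7, stepped t s6 s7 & rely t s6 s7].
    case: r6 Hr6 => -[Ev Eh].
      have C6 := marked_closed I6 M6.
      have [Pb6 [u6 [Eb6 _ _]]] := M6.
      have Hf k y : (sumn ks, true, true) = (k, true, y) -> frozen (hp s6) (Some b) k.
        by move=> [<-].
      have Nc : (sumn ks, true, true) <> clean by [].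
      have [s7 [? ? ? _]] := status_step I6 Pb6 Eb6 C6 Nc Hf Eh.
      by exists s7.
    by exists s6; rewrite Eh; split=> //; [exact: stepped_refl|exact: rely_refl].
  exists s7; split=> //; split; first exact: engaged_rely R7 Id6.
  by apply: Fr; [exact: ext_trans X6 (st_ext S7)|exact: S7].
- move=> [w' Ex _]; rewrite Ex /= in Eb1 *.
  have [v [Et _ _ _ _]] := i_reb I Hb Eb.
  rewrite Et in Eb Eb1 *.
  have Pr : pub_rebuild s b v by split=> //; exists w, q, i.
  have Pr1 := pub_rebuild_ext X1 Pr.
  apply: wp_tail; first by split=> //; apply: (target_markable I1 Pr1).
  move=> r s2 X2 I2 [Id2 Fr2]; split=> //.
  have [_ [w2 [q2 [i2 E2]]]] := pub_rebuild_ext X2 Pr1.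
  by apply: (@frozen_rebuild _ _ (Some v) w2 q2 i2).
Qed.

Lemma wp_markLoop b cs deg s : tree_inv s -> idle s t -> marked_at s b cs -> deg <= size cs ->
  wp t (markLoop K V (Some b) deg) (fun _ s => idle s t) s.
Proof.
move=> I Id M le.
apply: wp_act => s1 R1 I1 r h2 [/= Er Eh].
have X1 := r_ext R1; have Id1 := engaged_rely R1 Id; have M1 := marked_at_ext X1 M.
have [P1 [u1 [E1 Mk1 Ec1]]] := M1.
pose u' := MkInner (initSize u1) (degree u1) (keys u1) (children u1) (status u1) (Defs.count u1) (r + 1).
have R : replaced (hp s1) b (Inner V u') h2 by rewrite Eh; apply: (replaced_inner _ E1).
have N := i_node I1 (tracked_pub P1) E1.
have leu : inner_le u1 u' by split.
have sh : shared (kd s1 b) by rewrite P1.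
have [s2 [E2 S2 R2]] := attr_step I1 E1 sh R leu erefl (nd_deg N) (fun _ => erefl)
  (fun m => nd_marked N m) (nd_fin N).
exists s2; split=> //; have X2 := st_ext S2; have Id2 := engaged_rely R2 Id1.
have M2 := marked_at_ext X2 M1.
case: ifP => [//|/negbT]; rewrite -ltnNge => ltr.
have ltr' := leq_trans ltr le.
apply: wp_read => // s3 c R3 I3 [Gc _].
have X3 := r_ext R3; have Id3 := engaged_rely R3 Id2; have M3 := marked_at_ext X3 M2.
have [u3 [Eu3 _ Ec]] := get_child Gc.
have Ecs : children u3 = cs by have [_ [u4 [+ _ <-]]] := M3; rewrite Eu3 => -[->].
rewrite Ecs in Ec.
apply: wp_call; first by split=> //; apply: (child_markable I3 M3 ltr' Ec).
move=> r4 s4 X4 I4 [Id4 _]; apply: wp_tail => //; split=> //.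
by exists b, cs; split=> //; apply: marked_at_ext X4 M3.
Qed.

End Rebuilding.

(** * Creating and installing the newTarget *)

Section Replacing.

Variable t : 'I_p.

Lemma rebuild_parts (s : state) b v w q i : tree_inv s -> kd s b = KPub ->
  onth (hp s) b = Some (Rebuild K V (Some v) w q i) ->
  [/\ q = Some (hm s b).1, i = (hm s b).2, pub_inner s v & exists u,
    [/\ onth (hp s) (hm s b).1 = Some (Inner V u), kd s (hm s b).1 = KPub & (hm s b).2 < size (children u)]].
Proof.
move=> I P E; have [v' [[<-] [Eq Ei] [Hv v0] [[u Ev] Pv _] _]] := i_reb I P E.
split=> //; first by split=> //; exists u.
have [x [Ex lt _ Uk]] := nd_up (i_node I (tracked_pub Pv) Ev) v0.
by exists x; rewrite -Hv; rewrite Pv in Uk.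
Qed.

Lemma new_inv_of (s : state) b v w : tree_inv s -> pub_rebuild s b v ->
  new_target (hp s) b = Some w -> new_inv s b v w.
Proof.
move=> I [P [w' [q [i E]]]]; rewrite /new_target E => Ew.
by have [v' [[<-] _ _ _ H]] := i_reb I P E; apply: H.
Qed.

Lemma building_inner (s : state) b v w k len : tree_inv s -> building s b v w k len ->
  exists u, [/\ onth (hp s) w = Some (Inner V u), size (children u) = len,
   initSize u = k /\ len = Nat.sqrt k & kd s w = KSub b \/ kd s w = KPub].
Proof.
move=> I [Pr Fr leT Nt [u [Eu Sz]]].
have [_ Kw _ _ [k' Fr' Nk]] := new_inv_of I Pr Nt.
(* A frozen target has a unique key count, so all helpers work with the same [k] and compute the
   same shares. *)
have Ek : k' = k by apply: weight_det (frozen_keys Fr') (frozen_keys Fr).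
move: Nk; rewrite Ek /new_size ltnNge leT /= => -[u' [+ n1 n2 _]].
rewrite Eu => -[Euu]; rewrite -Euu in n1 n2.
by exists u; split=> //; split=> //; rewrite -Sz.
Qed.

Definition built (s : state) (w idx : nat) : Prop :=
  exists u, onth (hp s) w = Some (Inner V u) /\ nth null (children u) idx <> null.

Lemma built_ext (s s' : state) w idx : ext s s' -> built s w idx -> built s' w idx.
Proof.
move=> X [u [E N]]; have [u' E' le] := ext_inner X E; exists u'; split=> //.
exact: (le_nonnull le).
Qed.

Lemma fill_step (s : state) b v w k len idx uw r t0 h' : 0 < T -> tree_inv s ->
  building s b v w k len -> onth (hp s) w = Some (Inner V uw) ->
  idx < size (children uw) -> nth null (children uw) idx = null ->
  replaced (hp s) w (Inner V (set_child uw idx (Some r))) h' ->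
  private_tree s t r w idx t0 ->
  (forall e, tree_weight e t0 = share k idx) -> tree_size t0 = share k idx -> 
  exists s', [/\ hp s' = h', stepped t s s', same_own t s s' & built s' w idx].
Proof.
move=> T0 I B Ew lti Enull R [pk [ph r0] pw prt pn] Hw Hsz.
have [u' [+ Sz [Ek El] Kw]] := building_inner I B; rewrite Ew => -[Eu]; rewrite -{u'}Eu in Sz Ek.
have [Pr Fr leT Nt _] := B.
have KS : kd s w = KSub b.
  case: Kw => // Pw; have [_ /(_ idx lti)] := nd_pub (i_node I (tracked_pub Pw) Ew) Pw.
  by rewrite Enull.
have Hnr a d x q i : kd s a = KPriv t -> onth (hp s) a <> Some (Rebuild K V d x q i).
  by move=> /pn + E; rewrite E.
have Hr : match onth (hp s) r return Prop with
  | Some (Inner ur) => [/\ hm s r = (w, idx), r <> 0,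
      initSize ur <= share (initSize uw) idx & 1 < size (children ur)]
  | Some (Rebuild _ _ _ _) => False
  | Some _ => True
  | None => False end.
  move: prt; rewrite /root_node Ek; case: (onth _ r) => [[|? ?|ur|? ? ? ?]|] // [-> ?].
  by rewrite Hsz.
have Wr e : e < 2 -> weight (hp s) e (Some r) (share (initSize uw) idx).
  by move=> _; rewrite Ek -(Hw e).
have Hc a u : kd s a = KPriv t -> onth (hp s) a = Some (Inner V u) -> complete u.
  by move=> /pn + E; rewrite E => -[].
have Hup a u : kd s a = KPriv t -> onth (hp s) a = Some (Inner V u) ->
  [\/ kd s (hm s a).1 = KPriv t, kd s (hm s a).1 = KPub | kd s (hm s a).1 = KSub b].
  move=> /pn + E; rewrite E => -[_ [H|->]]; [exact: Or31|exact: Or33].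
have Pb : kd s b = KPub by case: Pr.
pose s' : state := State h' (hand_over s t b) (an s) (hm s) (dn s) (eg s) (ic s).
exists s'; split=> //.
- split.
  + exact: (fill_inv I Hnr Pb Nt KS Ew lti Enull R pk Hr Wr Hc Hup T0).
  + exact: (fill_ext I KS Ew lti R pk).
  + by move=> t' Nt'; apply: (fill_rely I KS Ew lti R pk).
- exists (set_child uw idx (Some r)); split; first by rewrite R.2 eqxx.
  by rewrite /= nth_set_nth /= eqxx.
Qed.

(** Ensures that [take] and [drop] in [CreateIdeal] are not cut short, so that each child receives
    its full share. *)
Lemma share_range k idx : 0 < k -> idx < Nat.sqrt k ->
  k %/ Nat.sqrt k * idx + minn idx (k %% Nat.sqrt k) + share k idx <= k.
Proof.
move=> k0 lt; have := divn_eq k (Nat.sqrt k).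
have := ltn_pmod k (sqrt_gt0 k0); rewrite /share.
move: (k %/ _) (k %% _) => d r ltr Ek.
have : d * idx + d <= d * Nat.sqrt k by rewrite addnC -mulnS leq_mul2l lt orbT.
case: ltnP => H; lia.
Qed.

(** Since [Nat.sqrt k <= k], the quotient is positive. So no child is Empty, and its leaves number
    exactly its share too. *)
Lemma share_gt0 k idx : 0 < k -> 0 < share k idx.
Proof.
move=> k0; have t0 := sqrt_gt0 k0; have [le _] := Nat.sqrt_spec k (Nat.le_0_l k).
have : 0 < k %/ Nat.sqrt k by rewrite divn_gt0 //; nia.
by rewrite /share; case: ifP.
Qed.

Lemma ideal_entries (s : state) v k from cnt es t0 : frozen (hp s) (Some v) k ->
  entries (hp s) (Some v) es -> from + cnt <= k ->
  ideal (take cnt (drop from (sort_entries es))) t0 ->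
  [/\ good t0, tree_size t0 = cnt & forall e, tree_weight e t0 = if cnt == 0 then e else cnt].
Proof.
move=> Fr En le Id.
have Ek : size es = k by apply: weight_det (entries_keys En) (frozen_keys Fr).
have Esz : size (take cnt (drop from (sort_entries es))) = cnt.
  by rewrite size_takel // size_drop size_sort Ek; lia.
split; first exact: ideal_good Id.
  by rewrite (ideal_size Id).
by move=> e; rewrite (ideal_weight e Id) Esz.
Qed.

Lemma wp_rebuildAndSetChild b v w k len idx s : 0 < T -> tree_inv s -> idle s t ->
  building s b v w k len -> idx < len ->
  wp t (rebuildAndSetChild K V (Some b) k idx)
    (fun r s => idle s t /\ if r then built s w idx else kd s w = KPub) s.
Proof.
move=> T0 I Id B lti; rewrite /rebuildAndSetChild.
set from := _ + _; rewrite -/(share k idx).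
have k0 : 0 < k by case: B => _ _ leT _ _; apply: leq_trans leT.
apply: wp_read => // s1 x R1 I1 Ex.
have X1 := r_ext R1; have Id1 := engaged_rely R1 Id; have B1 := building_ext X1 B.
have [[Pb1 [w1 [q1 [i1 Eb1]]]] _ _ _ _] := B1.
rewrite (node_at_peek Eb1 Ex) /= {x Ex}.
apply: wp_act => s2 R2 I2 r h3 [es [t0 [En Idl Eal]]].
have X2 := r_ext R2; have Id2 := engaged_rely R2 Id1; have B2 := building_ext X2 B1.
have [uw [Ew Sz [_ Esq] Kw]] := building_inner I2 B2.
have [_ Fr2 _ _ _] := B2.
have lef : from + share k idx <= k by apply: share_range => //; rewrite -Esq.
have [G Hsz Hw'] := ideal_entries Fr2 En lef Idl.
have Hw e : tree_weight e t0 = share k idx.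
  by rewrite Hw' ifF //; apply/negbTE; rewrite -lt0n share_gt0.
have sh : shared (kd s2 w) by case: Kw => ->.
have ltu : idx < size (children uw) by rewrite Sz.
have [s3 [r0 [E3 Er S3 O3 PT3]]] := alloc_tree_step t I2 G (esym Eal) Ew ltu sh.
exists s3; split=> //.
have I3 : tree_inv s3 := S3; have X3 := st_ext S3.
have Id3 := engaged_own X3 O3 Id2; have B3 := building_ext X3 B2.
apply: (wp_bind (Q' := fun _ s => [/\ idle s t, building s b v w k len & private_tree s t r0 w idx t0])) => //.
  case: ifP => idx0 //.
  apply: wp_read => // s4 y R4 I4 _.
  have Id4 := engaged_rely R4 Id3; have B4 := building_ext (r_ext R4) B3.
  have PT4 := private_tree_rely I3 R4 PT3.
  apply: wp_read => // s5 nt R5 I5 [Gn _].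
  have Id5 := engaged_rely R5 Id4; have B5 := building_ext (r_ext R5) B4.
  have PT5 := private_tree_rely I4 R5 PT4.
  have Ent : nt = Some w.
    have [[_ [w' [q' [i' Eb']]]] _ _ + _] := B5; rewrite /new_target Eb' => Ew'.
    by move: Gn; rewrite /= Eb' Ew' => -[].
  rewrite Ent.
  apply: wp_act => s6 R6 I6 [] h7 [_ Eh].
  have Id6 := engaged_rely R6 Id5; have B6 := building_ext (r_ext R6) B5.
  have PT6 := private_tree_rely I5 R6 PT5.
  have [u6 [Eu6 _ _ Kw6]] := building_inner I6 B6.
  pose u' := MkInner (initSize u6) (degree u6) (set_nth None (keys u6) idx.-1 (Some y))
    (children u6) (status u6) (Defs.count u6) (nextMark u6).
  have R : replaced (hp s6) w (Inner V u') h7 by rewrite Eh; apply: (replaced_inner _ Eu6).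
  have sh6 : shared (kd s6 w) by case: Kw6 => ->.
  have Kd6 : kd s6 w <> KDead by case: Kw6 => ->.
  have N := i_node I6 Kd6 Eu6.
  have leu : inner_le u6 u' by split.
  have [s7 [E7 S7 R7]] := attr_step t I6 Eu6 sh6 R leu erefl (nd_deg N) (fun _ => erefl)
    (fun m => nd_marked N m) (nd_fin N).
  exists s7; split=> //; split.
  - exact: engaged_rely R7 Id6.
  - exact: building_ext (r_ext R7) B6.
  - exact: private_tree_rely I6 R7 PT6.
move=> _ s4 X4 I4 [Id4 B4 PT4].
apply: wp_read => // s5 nt R5 I5 [Gn _].
have Id5 := engaged_rely R5 Id4; have B5 := building_ext (r_ext R5) B4.
have PT5 := private_tree_rely I4 R5 PT4.
have Ent : nt = Some w.
  have [[_ [w' [q' [i' Eb']]]] _ _ + _] := B5; rewrite /new_target Eb' => Ew'.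
  by move: Gn; rewrite /= Eb' Ew' => -[].
rewrite Ent Er.
apply: wp_act => s6 R6 I6 res h7 [c [st [Gc Gs Hres]]].
have Id6 := engaged_rely R6 Id5; have B6 := building_ext (r_ext R6) B5.
have PT6 := private_tree_rely I5 R6 PT5.
have [u6 [Eu6 lt6 Ec]] := get_child Gc.
have [us Eus Est] := get_status Gs.
rewrite Eu6 in Eus; case: Eus => Eus; rewrite -{us}Eus in Est.
have [_ [_ _ _ Kw6]] := building_inner I6 B6.
case: res Hres => Hres.
- case: Hres => Ev Ev' Eh; rewrite {}Ev in Ec; rewrite {}Ev' in Est.
  have R : replaced (hp s6) w (Inner V (set_child u6 idx (Some r0))) h7.
    by rewrite Eh /=; apply: (replaced_inner _ Eu6).
  have [s7 [E7 S7 O7 Bt]] := fill_step T0 I6 B6 Eu6 lt6 Ec R PT6 Hw Hsz.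
  exists s7; split=> //; split=> //; exact: engaged_own (st_ext S7) O7 Id6.
- case: Hres => Nv ->; exists s6; split=> //; first exact: stepped_refl.
  by split=> //; exists u6; rewrite Ec.
- case: Hres => Nv ->; exists s6; split=> //; first exact: stepped_refl.
  split=> //; have Kd6 : kd s6 w <> KDead by case: Kw6 => ->.
  have M6 : marked u6 by rewrite /marked Est.
  by have [] := nd_marked (i_node I6 Kd6 Eu6) M6.
Qed.

Lemma wp_fillLoop b v w k len s : 0 < T -> tree_inv s -> idle s t -> building s b v w k len ->
  wp t (fillLoop K V (Some b) (Some w) k len)
    (fun r s => idle s t /\ if r then filled s w else kd s w = KPub) s.
Proof.
move=> T0 I Id B; rewrite /fillLoop.
apply: wp_read => // s1 idx R1 I1 [Gd _].
have Id1 := engaged_rely R1 Id; have B1 := building_ext (r_ext R1) B.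
have [u1 [Eu1 Sz1 _ _]] := building_inner I1 B1.
have Edg : degree u1 = idx by move: Gd; rewrite /= /inner_at /= Eu1 /= => -[].
case: eqP => [Eil|Nil].
  by split=> //; exists u1; rewrite Sz1 Edg.
have again s2 : ext s1 s2 -> tree_inv s2 -> idle s2 t ->
    wp t (call (@FillLoop _ K V (Some b) (Some w) k len))
      (fun r s => idle s t /\ if r then filled s w else kd s w = KPub) s2.
  move=> X2 I2 Id2; apply: wp_tail.
    by split=> //; exists b, v, w; split=> //; apply: building_ext X2 B1.
  by move=> r s3 X3 I3 [Id3 [w' [[<-] H]]].
apply: wp_act => s2 R2 I2 ok h3 [d Gd2 Hok].
have X2 := r_ext R2; have Id2 := engaged_rely R2 Id1; have B2 := building_ext X2 B1.
have [u2 [Eu2 Sz2 _ Kw2]] := building_inner I2 B2.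
have Kd2 : kd s2 w <> KDead by case: Kw2 => ->.
have Ed2 : degree u2 = d by move: Gd2; rewrite /= /inner_at /= Eu2 /= => -[].
have N := i_node I2 Kd2 Eu2.
case: ok Hok => -[Ed Eh]; last first.
  exists s2; rewrite Eh; split=> //; first exact: stepped_refl.
  exact: again.
have lti : idx < len.
  by rewrite ltn_neqAle -Sz2 -Ed -Ed2 (nd_deg N) andbT Sz2 Ed2 Ed; apply/eqP.
pose u' := MkInner (initSize u2) idx.+1 (keys u2) (children u2) (status u2) (Defs.count u2) (nextMark u2).
have R : replaced (hp s2) w (Inner V u') h3 by rewrite Eh; apply: (replaced_inner _ Eu2).
have leu : inner_le u2 u' by split=> //=; rewrite Ed2 Ed.
have sh2 : shared (kd s2 w) by case: Kw2 => ->.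
have dle : degree u' <= size (children u2) by rewrite Sz2.
(* A public node has full degree, so a CAS that raises the degree cannot succeed on it. *)
have Hp : kd s2 w = KPub -> degree u' = degree u2.
  by move=> /(nd_pub N) [D _]; move: lti; rewrite -Sz2 -D Ed2 Ed ltnn.
have [s3 [E3 S3 R3]] := attr_step t I2 Eu2 sh2 R leu erefl dle Hp (fun m => nd_marked N m) (nd_fin N).
exists s3; split=> //; have X3 := st_ext S3.
have Id3 := engaged_rely R3 Id2; have B3 := building_ext X3 B2.
have I3 : tree_inv s3 := S3.
apply: (wp_bind I3 (wp_rebuildAndSetChild T0 I3 Id3 B3 lti)) => ok s4 X4 I4 [Id4 Hok].
case: ok Hok => Hok; last by split.
by apply: again => //; apply: (ext_trans X2 (ext_trans X3 X4)).
Qed.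

(** A full degree only says that all slots have been claimed, and a claimed slot may still be null.
    This pass ensures that every slot is filled, unless the newTarget is already public. *)
Lemma wp_fillMissing b v w k len n : forall j s, 0 < T -> tree_inv s -> idle s t ->
  building s b v w k len -> j + n = len -> (forall i, i < j -> built s w i) ->
  wp t (fillMissing K V (Some b) (Some w) k (iota j n))
    (fun _ s => idle s t /\ (kd s w = KPub \/ forall i, i < len -> built s w i)) s.
Proof.
elim: n => [|n IH] j s T0 I Id B Ej Hj /=.
  by split=> //; right; rewrite -Ej addn0.
have ltj : j < len by lia.
apply: wp_read => // s1 c R1 I1 [Gc _].
have Id1 := engaged_rely R1 Id; have B1 := building_ext (r_ext R1) B.
have [u1 [Eu1 _ Ec]] := get_child Gc.
have Hj1 i : i < j -> built s1 w i by move=> /Hj; apply: built_ext (r_ext R1).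
apply: (wp_bind (Q' := fun r s => idle s t /\ if r then built s w j else kd s w = KPub)) => //.
  case: c Gc Ec => [d|] Gc Ec; last exact: wp_rebuildAndSetChild B1 ltj.
  by split=> //; exists u1; rewrite Ec.
move=> ok s2 X2 I2 [Id2 Hok]; case: ok Hok => Hok; last by split=> //; left.
apply: (IH j.+1) => //.
- exact: building_ext X2 B1.
- by rewrite addSnnS.
- move=> i; rewrite ltnS leq_eqVlt => /predU1P [->//|/Hj1].
  exact: built_ext.
Qed.

(** From the threshold on, the blank node is the one incomplete node that [nd_sub] tolerates, so it
    has to be the only private node of [t]. *)
Definition mine (s : state) (b r k : nat) : Prop :=
  if k < T then exists t0, [/\ private_tree s t r (hm s b).1 (hm s b).2 t0 &
    forall e, tree_weight e t0 = if k == 0 then e else k]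
  else [/\ onth (hp s) r = Some (Inner V (MkInner k 0 (nseq (Nat.sqrt k).-1 None)
      (nseq (Nat.sqrt k) null) clean 0 0)), hm s r = hm s b, r <> 0 &
      forall a, kd s a = KPriv t <-> a = r].

Lemma target_step (s : state) b v r k q i h' : 0 < T -> tree_inv s -> kd s b = KPub ->
  onth (hp s) b = Some (Rebuild K V (Some v) null q i) -> frozen (hp s) (Some v) k ->
  mine s b r k -> replaced (hp s) b (Rebuild K V (Some v) (Some r) q i) h' ->
  exists s', [/\ hp s' = h', stepped t s s' & same_own t s s'].
Proof.
move=> T0 I Pb Eb Fr Mn R.
have [_ _ _ [uq [Eq Pq _]]] := rebuild_parts I Pb Eb.
have ehm : ((hm s b).1, (hm s b).2) = hm s b by case: (hm s b).
have [Kr Hnr Hw Hn [Hc Hup]] : [/\ kd s r = KPriv t,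
  forall a d x q i, kd s a = KPriv t -> onth (hp s) a <> Some (Rebuild K V d x q i),
  forall u, onth (hp s) r = Some (Inner V u) -> hm s r = hm s b /\ r <> 0,
  if k < T then
    [/\ weight (hp s) 0 (Some r) k, weight (hp s) 1 (Some r) (maxn 1 k) &
      forall u, onth (hp s) r = Some (Inner V u) -> complete u]
  else exists u, [/\ onth (hp s) r = Some (Inner V u), initSize u = k,
    size (children u) = Nat.sqrt k & forall j c e, e < 2 ->
      nth null (children u) j = Some c -> weight (hp s) e (Some c) (share k j)] &
  (forall a u, kd s a = KPriv t -> onth (hp s) a = Some (Inner V u) -> complete u \/ a = r) /\
  forall a u, kd s a = KPriv t -> onth (hp s) a = Some (Inner V u) ->
  [\/ kd s (hm s a).1 = KPriv t, kd s (hm s a).1 = KPub | kd s (hm s a).1 = KSub b]].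
  move: Mn; rewrite /mine; case: ltnP => [lt [t0 [[pk [ph r0] pw prt pn] Hw]]|ge [Er Hr r0 Kr]].
    split=> //.
    - by move=> a d x q' i' /pn + E; rewrite E.
    - by move=> u _; rewrite ph.
    - split.
      + by have := pw 0; rewrite Hw; case: (k =P 0) => [{1}-> //|//].
      + have := pw 1; rewrite Hw; case: (k =P 0) => [-> //|/eqP].
        by rewrite -lt0n => /maxn_idPr ->.
      + by move=> u E; have := pn r pk; rewrite E => -[].
    - split=> a u /pn + E; rewrite E => -[C H]; first by left.
      by case: H => [|->]; [exact: Or31|exact: Or32].
  have Kr' : kd s r = KPriv t by apply/Kr.
  split=> //.
  - by move=> a d x q' i' /Kr ->; rewrite Er.
  - exists (MkInner k 0 (nseq (Nat.sqrt k).-1 None) (nseq (Nat.sqrt k) null) clean 0 0).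
    rewrite /= size_nseq; split=> // j c e _; by rewrite nth_nseq; case: ifP.
  - split=> a u /Kr -> _; first by right.
    by apply: Or32; rewrite Hr.
pose s' : state := State h' (hand_over s t b) (an s) (hm s) (dn s) (eg s) (ic s).
exists s'; split=> //; split.
- exact: (target_inv I Hnr Pb Eb R Kr Hw Fr Hn Hc Hup).
- exact: (target_ext t Eb R).
- by move=> t' Nt; apply: (target_rely Pb Eb R).
Qed.

Lemma wp_finish b v w k s : 0 < T -> tree_inv s -> idle s t -> pub_rebuild s b v ->
  frozen (hp s) (Some v) k -> new_target (hp s) b = Some w ->
  wp t (if T <= k then
      bind (act (Peek K V (Some w))) (fun y =>
      if y is VInner _ _ _ len then
        bind (call (@FillLoop _ K V (Some b) (Some w) k len)) (fun x =>
        if x then bind (fillMissing K V (Some b) (Some w) k (iota 0 len)) (fun _ => Ret K V (Some w))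
        else Ret K V (Some w))
      else Ret K V (Some w))
    else Ret K V (Some w))
    (fun r s => idle s t /\ exists b' w, [/\ Some b = Some b', r = Some w,
       new_target (hp s) b' = Some w & ready s w]) s.
Proof.
move=> T0 I Id Pr Fr Nt.
have [ltw Kw _ _ [k' Fr' Nk]] := new_inv_of I Pr Nt.
have Ek : k' = k by apply: weight_det (frozen_keys Fr') (frozen_keys Fr).
rewrite {}Ek {k' Fr'} in Nk.
case: leqP => lekT.
  have B : building s b v w k (Nat.sqrt k).
    split=> //; move: Nk; rewrite /new_size ltnNge lekT /= => -[u [Eu _ Sz _]].
    by exists u.
  apply: wp_read => // s1 y R1 I1 Ey.
  have Id1 := engaged_rely R1 Id; have B1 := building_ext (r_ext R1) B.
  have [u1 [Eu1 Sz1 _ _]] := building_inner I1 B1.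
  rewrite (node_at_peek Eu1 Ey) /= Sz1.
  apply: wp_call; first by split=> //; exists b, v, w.
  move=> ok s2 X2 I2 [Id2 [w' [[Ew'] Hok]]]; rewrite -{w'}Ew' in Hok.
  have B2 := building_ext X2 B1; have [_ _ _ Nt2 _] := B2.
  case: ok Hok => Hok; last first.
    by split=> //; exists b, w; split=> //; left.
  apply: (wp_bind (Q' := fun _ s => idle s t /\
      (kd s w = KPub \/ forall i, i < Nat.sqrt k -> built s w i))) => //.
    by apply: (wp_fillMissing T0 I2 Id2 B2).
  move=> _ s3 X3 I3 [Id3 H3].
  have B3 := building_ext X3 B2; have [_ _ _ Nt3 _] := B3.
  split=> //; exists b, w; split=> //; case: H3 => [|H3]; first by left.
  right; have [u3 [Eu3 Sz3 _ Kw3]] := building_inner I3 B3.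
  exists (Inner V u3); split=> //; split.
    have [u2 [Eu2 D2]] := Hok; have [u3' + le] := ext_inner X3 Eu2.
    rewrite Eu3 => -[Euu]; rewrite -{u3'}Euu in le.
    have Kd : kd s3 w <> KDead by case: Kw3 => ->.
    apply/eqP; rewrite eqn_leq (nd_deg (i_node I3 Kd Eu3)) /=.
    by rewrite (le_size le) -D2 (le_deg le).
  move=> j; rewrite Sz3 => /H3 [u [+ ?]].
  by rewrite Eu3 => -[->].
split=> //; exists b, w; split=> //; case: Kw => Kw; last by left.
right; move: Nk; rewrite /new_size lekT => /(_ Kw) [_ _ H].
case Ew: (onth (hp s) w) => [x|]; last by move: ltw; rewrite -onthTE Ew.
exists x; split=> //; case: x Ew => [|? ?|u|? ? ? ?] Ew //; first exact: H.
by case: (i_noreb I Kw Ew).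
Qed.

Lemma mine_rely (s s' : state) b r k : tree_inv s -> kd s b = KPub -> rely t s s' ->
  mine s b r k -> mine s' b r k.
Proof.
move=> I Pb R; have [_ Hb] := pub_an (r_ext R) Pb; rewrite /mine Hb; case: ifP => _.
  by move=> [t0 [PT H]]; exists t0; split=> //; apply: (private_tree_rely I R PT).
move=> [Er Hr r0 Kr]; have Kr' : kd s r = KPriv t by apply/Kr.
have [-> _ ->] := r_priv R Kr'; split=> // a.
by rewrite (r_kd R).
Qed.

Lemma wp_createIdealCollaborative b v k s : 0 < T -> tree_inv s -> idle s t ->
  pub_rebuild s b v -> frozen (hp s) (Some v) k ->
  wp t (createIdealCollaborative K V T (Some b) k)
    (fun r s => idle s t /\ exists b' w, [/\ Some b = Some b', r = Some w,
       new_target (hp s) b' = Some w & ready s w]) s.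
Proof.
move=> T0 I Id Pr Fr; rewrite /createIdealCollaborative.
apply: wp_read => // s1 x R1 I1 Ex.
have X1 := r_ext R1; have Id1 := engaged_rely R1 Id; have Pr1 := pub_rebuild_ext X1 Pr.
have Fr1 := frozen_le (x_heap X1) Fr.
have [Pb1 [w1 [q1 [i1 Eb1]]]] := Pr1.
rewrite (node_at_peek Eb1 Ex) {x Ex} /=.
apply: (wp_bind (Q' := fun r s => [/\ idle s t, pub_rebuild s b v, frozen (hp s) (Some v) k &
    exists2 r0, r = Some r0 & mine s b r0 k])) => //.
  case: ifP => lt.
    apply: wp_act => s2 R2 I2 r h3 [es [t0 [En Idl Eal]]].
    have X2 := r_ext R2; have Id2 := engaged_rely R2 Id1; have Pr2 := pub_rebuild_ext X2 Pr1.
    have Fr2 := frozen_le (x_heap X2) Fr1.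
    have [Pb2 [w2 [q2 [i2 Eb2]]]] := Pr2.
    have [_ _ _ [uq [Eq Pq ltq]]] := rebuild_parts I2 Pb2 Eb2.
    have lek : 0 + k <= k by [].
    have [G Hsz Hw] := ideal_entries Fr2 En lek Idl.
    have sh : shared (kd s2 (hm s2 b).1) by rewrite Pq.
    have [s3 [r0 [E3 Er S3 O3 PT3]]] := alloc_tree_step t I2 G (esym Eal) Eq ltq sh.
    exists s3; split=> //; have X3 := st_ext S3; split.
    - exact: engaged_own X3 O3 Id2.
    - exact: pub_rebuild_ext X3 Pr2.
    - exact: frozen_le (x_heap X3) Fr2.
    - exists r0 => //; rewrite /mine lt; exists t0; split=> //.
      by have [_ ->] := pub_an X3 Pb2.
  apply: wp_act => s2 R2 I2 r h3 [-> ->].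
  have X2 := r_ext R2; have Id2 := engaged_rely R2 Id1; have Pr2 := pub_rebuild_ext X2 Pr1.
  have Fr2 := frozen_le (x_heap X2) Fr1.
  have [Pb2 [w2 [q2 [i2 Eb2]]]] := Pr2.
  have [_ _ _ [uq [Eq Pq ltq]]] := rebuild_parts I2 Pb2 Eb2.
  have sh : shared (kd s2 (hm s2 b).1) by rewrite Pq.
  set u := MkInner _ _ _ _ _ _ _.
  have Hx : exists v, [/\ onth (hp s2) (hm s2 b).1 = Some (Inner V v), (hm s2 b).2 < size (children v),
     shared (kd s2 (hm s2 b).1),
     exists k, u = MkInner k 0 (nseq (Nat.sqrt k).-1 None) (nseq (Nat.sqrt k) null) clean 0 0 &
       0 < initSize u].
    exists uq; split=> //; first by exists k.
    (* Here [0 < T <= k], so the blank node has [Nat.sqrt k >= 1] slots; with no slots it would have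
       no leaf. *)
    by rewrite /=; apply: leq_trans T0 _; rewrite leqNgt lt.
  have [s3 [E3 S3 O3 K3 H3]] :=
    @alloc_node_step s2 t (Inner V u) (hm s2 b).1 (hm s2 b).2 I2 Hx.
  exists s3; split=> //; have X3 := st_ext S3; split.
  - exact: engaged_own X3 O3 Id2.
  - exact: pub_rebuild_ext X3 Pr2.
  - exact: frozen_le (x_heap X3) Fr2.
  - exists (size (hp s2)) => //; rewrite /mine lt; have [_ ->] := pub_an X3 Pb2.
    rewrite E3 onth_rcons_last H3; split=> //; first by case: (hm s2 b).
    by have := onth_ltn Eb2; lia.
move=> r s2 X2 I2 [Id2 Pr2 Fr2 [r0 -> Mn2]].
apply: wp_act => s3 R3 I3 ok h4 [d Gn Hok].
have X3 := r_ext R3; have Id3 := engaged_rely R3 Id2; have Pr3 := pub_rebuild_ext X3 Pr2.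
have Fr3 := frozen_le (x_heap X3) Fr2.
have [Pb3 [w3 [q3 [i3 Eb3]]]] := Pr3.
have Mn3 := mine_rely I2 Pr2.1 R3 Mn2.
have Ed : w3 = d by move: Gn; rewrite /= Eb3 => -[].
case: ok Hok => -[Ev Eh].
  rewrite Ed Ev in Eb3.
  have R : replaced (hp s3) b (Rebuild K V (Some v) (Some r0) q3 i3) h4.
    by rewrite Eh; apply: (replaced_update _ Eb3).
  have [s4 [E4 S4 O4]] := target_step T0 I3 Pb3 Eb3 Fr3 Mn3 R.
  exists s4; split=> //; have X4 := st_ext S4.
  apply: wp_finish => //.
  - exact: S4.
  - exact: engaged_own X4 O4 Id3.
  - exact: pub_rebuild_ext X4 Pr3.
  - exact: frozen_le (x_heap X4) Fr3.
  - by rewrite /new_target E4 R.2 eqxx.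
exists s3; rewrite Eh; split=> //; first exact: stepped_refl.
apply: wp_read => // s4 nt R4 I4 [Gn4 _].
have X4 := r_ext R4; have Pr4 := pub_rebuild_ext X4 Pr3.
(* The CAS failed, so the field already holds some [w0], which never changes again. *)
case: d Ed Ev Gn => [w0|] Ed Ev Gn //.
have Nt4 : new_target (hp s4) b = Some w0.
  by apply: (new_target_ext X4); rewrite /new_target Eb3 Ed.
have [_ [w4 [q4 [i4 Eb4]]]] := Pr4.
have -> : nt = Some w0.
  by move: Nt4 Gn4; rewrite /new_target /= Eb4 => -> [].
apply: (wp_finish T0 I4 _ Pr4 _ Nt4).
- exact: engaged_rely R4 Id3.
- exact: frozen_le (x_heap X4) Fr3.
Qed.

End Replacing.

Lemma wp_mono (t : 'I_p) A (m : prog A) (Q Q' : A -> state -> Prop) (s : state) :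
  (forall r s, Q r s -> Q' r s) -> wp t m Q s -> wp t m Q' s.
Proof.
move=> H; elim: m s => [x|c k IH|f k IH] s /=; rewrite /wp /=; first exact: H.
- move=> Hk s1 R1 I1 r h2 E; have [s2 [? ? ?]] := Hk s1 R1 I1 r h2 E.
  by exists s2; split=> //; apply: IH.
- by move=> [P Hk]; split=> // r s1 X1 I1 P1; apply/IH/Hk.
Qed.

Lemma install_step (t : 'I_p) (s : state) b v w uq h' : tree_inv s ->
  pub_rebuild s b v -> new_target (hp s) b = Some w -> ready s w ->
  onth (hp s) (hm s b).1 = Some (Inner V uq) -> (hm s b).2 < size (children uq) ->
  nth null (children uq) (hm s b).2 = Some b -> status uq = clean ->
  replaced (hp s) (hm s b).1 (Inner V (set_child uq (hm s b).2 (Some w))) h' -> 0 < T ->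
  exists s', [/\ hp s' = h', stepped t s s' & same_own t s s'].
Proof.
move=> I Pr Nt Rd Eq lti Ec st R T0.
have [ltw Kw Sw Hw [k Fr Nk]] := new_inv_of I Pr Nt.
have [Pb [w' [q' [i' Eb]]]] := Pr.
have [_ _ Pv [uq' [Eq' Pq _]]] := rebuild_parts I Pb Eb.
have ehm : ((hm s b).1, (hm s b).2) = hm s b by case: (hm s b).
have Sb : slot (hp s) (hm s b) = Some b by rewrite /slot Eq.
have KS : kd s w = KSub b by case: Kw => // /Sw; rewrite Sb.
set q := (hm s b).1 in Eq lti R Pq ehm Eq' *; set i := (hm s b).2 in lti Ec R ehm *.
pose s' : state := State h' (move_kind (KSub b) KPub (kd s)) (an s) (hm s) (dn s) (eg s) (ic s).
have k0u : KSub b <> KPub /\ KSub b <> KDead by [].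
have Kd : kd s w <> KDead by rewrite KS.
have NP : kd s w <> KPub by rewrite KS.
have C1 a u : kd s a = KSub b -> onth (hp s) a = Some (Inner V u) -> complete u.
  move=> Ka Ea; have Ka' : kd s a <> KDead by rewrite Ka.
  have [//|] := nd_sub (i_node I Ka' Ea) Ka.
  rewrite Nt => -[Ewa]; case: Rd => [/NP //|[x [Ex Hx]]].
  by move: Hx; move: Ea; rewrite -Ewa Ex => -[->].
have C2 a u : kd s a = KSub b -> onth (hp s) a = Some (Inner V u) ->
    kd s (hm s a).1 = KSub b \/ kd s (hm s a).1 = KPub.
  move=> Ka Ea; have Ka' : kd s a <> KDead by rewrite Ka.
  have [Ea0|/eqP a0] := eqVneq a 0.
    by have [u0 [_ P0 _]] := i_root I; move: Ka; rewrite Ea0 P0.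
  by have [x [_ _ _]] := nd_up (i_node I Ka' Ea) a0; rewrite Ka.
have C3 a d x y j : kd s a = KSub b -> onth (hp s) a = Some (Rebuild K V d x y j) ->
  exists v, [/\ d = Some v /\ x = null, y = Some (hm s a).1 /\ j = (hm s a).2,
    hm s v = hm s a /\ v <> 0, (exists u, onth (hp s) v = Some (Inner V u)) /\ kd s v = KPub &
    hm s v = (q, i)].
  by move=> Ka Ea; case: (i_noreb I Ka Ea).
have C4 : match onth (hp s) w return Prop with
  | Some (Inner _) => hm s w = (q, i) /\ w <> 0
  | Some (Rebuild _ _ _ _) => hm s w = (q, i)
  | Some _ => True
  | None => False end.
  case Ew: (onth (hp s) w) => [[|? ?|u|? ? ? ?]|] //.
  - by rewrite ehm; apply: Hw Ew.
  - by case: (i_noreb I KS Ew).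
  - by move: ltw; rewrite -onthTE Ew.
have C6 op : KSub b = KSub op -> hm s op = (q, i) by move=> [<-].
have okw : ok_ptr s (Some w).
  move=> x /=; case Ew: (onth (hp s) w) => [[|? ?|u|? ? ? ?]|] //.
    by move=> [<-]; split=> //; exists u.
  by case: (i_noreb I KS Ew).
have Ww e : e < 2 -> weight (hp s) e (Some w) (if e == 0 then k else maxn 1 k).
  move=> lte; move: Nk; rewrite /new_size; case: ltnP => [_ /(_ KS) [W0 W1 _]|ge].
    by case: e lte => [|[|]].
  move=> [u [Eu Eis Sz /(_ KS) H]].
  have k0 : 0 < k by apply: leq_trans ge.
  have -> : (if e == 0 then k else maxn 1 k) = sumn (mkseq (share k) (Nat.sqrt k)).
    by rewrite sum_share // (maxn_idPr k0); case: eqP.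
  apply: (@weight_inner _ _ _ (children u)); rewrite ?size_mkseq //.
    by rewrite /skel /= Eu.
  move=> j ltj; have [_ /(_ j ltj)] := C1 w u KS Eu.
  case Ej: (nth null (children u) j) => [c|] // _.
  by rewrite nth_mkseq -?Sz //; apply: H Ej.
have Ww' e : e < 2 -> weight h' e (Some w) (if e == 0 then k else maxn 1 k).
  move=> lte; apply: (weight_off_path I Pq Eq) (Ww e lte) => //.
    by move=> c nc; rewrite /skel /= R.2; case: eqP nc.
  move=> x; rewrite /= ; case Ew: (onth (hp s) w) => [[|? ?|u|? ? ? ?]|] //.
    by move=> [<-] /(on_path_inner I Pq Eq) [].
  by case: (i_noreb I KS Ew).
have Wv e x : weight (hp s) e (Some v) x -> weight (hp s) e (nth null (children uq) i) x.
  by move=> W; rewrite Ec; apply: (@weight_rebuild _ _ _ (Some v)); rewrite // /skel /= Eb.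
have [l Wl lel] := frozen_leaves Fr.
have R0 x' : weight h' 0 (Some w) x' ->
   exists2 x, weight (hp s) 0 (nth null (children uq) i) x & x <= x' + 0.
  move=> /weight_det /(_ (Ww' 0 isT)) ->; exists k; last by rewrite addn0.
  exact: Wv (frozen_keys Fr).
have R1 x' : weight h' 1 (Some w) x' ->
   exists2 x, weight (hp s) 1 (nth null (children uq) i) x & x' <= x + 0.
  by move=> /weight_det /(_ (Ww' 1 isT)) ->; exists l; [exact: Wv|rewrite addn0].
have E1 a : a <> 0 -> on_path s q a -> #|eg s a| = #|eg s a| + 0 by rewrite addn0.
have E2 a : ~ on_path s q a -> eg s a = eg s a by [].
have w0 u : onth (hp s) w = Some (Inner V u) -> w <> 0 by case/Hw.
(* The new child is compared with the old contents of the slot: [initSize <= k], as an unpublished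
   node has no slack, and [k <= l] for the [l] leaves there, which obey [bd_slot]. *)
have C7 : q <> 0 -> forall x u', inner_child (hp s) (Some w) = Some x ->
  onth (hp s) x = Some (Inner V u') ->
  initSize u' <= slot_bound (initSize uq) + slack s q + 0.
  move=> q0 x u'; rewrite /=; case Ew: (onth (hp s) w) => [[|? ?|u|? ? ? ?]|] //; last first.
    by case: (i_noreb I KS Ew).
  move=> [<-]; rewrite Ew => -[<-].
  have Bw := bd_low (inv_bound I (w0 u Ew) Kd Ew) (Ww 0 isT).
  have Bq := bd_slot (inv_bound I q0 (tracked_pub Pq) Eq) lti (Wv 1 l Wl).
  have [z1 z2 _] := i_ghost0 I NP.
  move: Bw; rewrite {1}/slack z1 z2 cards0 !addn0 /= => Bw.
  apply: leq_trans Bq; apply: leq_trans Bw (leq_trans (leq_maxr 1 k) lel).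
have C8 : q <> 0 -> initSize uq <= 4 -> match onth (hp s) w return Prop with
    | Some (Inner u') => initSize u' <= 4 /\ 1 < size (children u')
    | Some (Rebuild _ _ _ _) => False
    | _ => True
    end.
  move=> q0 le4; have := bd_small (inv_bound I q0 (tracked_pub Pq) Eq) le4 Ec.
  by rewrite Eb.
exists s'; split=> //; split.
- exact: (slot_inv I Pq Eq lti st R k0u C1 C2 C3 KS C4 C6 R0 R1 E1 E2 C7 C8).
- exact: (slot_ext _ Eq lti st R k0u KS).
- by move=> t' Nt'; apply: (slot_rely Pq Eq lti st R k0u KS).
Qed.

Section Body.
Variable t : 'I_p.
Hypothesis T0 : 0 < T.

Lemma ready_ext (s s' : state) w b : tree_inv s' -> ext s s' ->
  kd s w = KSub b \/ kd s w = KPub -> ready s w -> ready s' w.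
Proof.
move=> I' X Kw [P|[x [Ex Hx]]]; first by left; apply: (x_pub X).
have [x' Ex' le] := x_heap X Ex; right; exists x'; split=> //.
case: x Ex Hx le => [|? ?|u|? ? ? ?] Ex Hx //=; try by move=> ->.
move=> [u' Exu le]; rewrite Exu in Ex' *.
have Kd : kd s' w <> KDead.
  by case: Kw => [/(x_sub X) [] ->|/(x_pub X) ->].
case: Hx => D C; split.
  apply/eqP; rewrite eqn_leq (nd_deg (i_node I' Kd Ex')) /=.
  by rewrite (le_size le) -D (le_deg le).
by move=> j; rewrite (le_size le) => /C /(le_nonnull le).
Qed.

Lemma wp_helpRebuild b v s : tree_inv s -> idle s t -> pub_rebuild s b v ->
  wp t (helpRebuild K V (Some b)) (fun _ s => idle s t) s.
Proof.
move=> I Id Pr.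
apply: wp_read => // s1 x R1 I1 Ex.
have Id1 := engaged_rely R1 Id; have Pr1 := pub_rebuild_ext (r_ext R1) Pr.
have [Pb1 [w1 [q [i Eb1]]]] := Pr1.
rewrite (node_at_peek Eb1 Ex) /= {x Ex}.
have [-> -> _ _] := rebuild_parts I1 Pb1 Eb1.
apply: wp_call; first by split=> //; apply: (target_markable I1 Pr1).
move=> k s2 X2 I2 [Id2 Fr2]; have Pr2 := pub_rebuild_ext X2 Pr1.
apply: wp_call; first by split=> //; exists b, v.
move=> r s3 X3 I3 [Id3 [b' [w [[<-] -> Nt3 Rd3]]]].
have Pr3 := pub_rebuild_ext X3 Pr2.
apply: wp_act => s4 R4 I4 res h5 [c [st [Gc Gs Hres]]].
have X4 := r_ext R4; have Id4 := engaged_rely R4 Id3.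
have Pr4 := pub_rebuild_ext X4 Pr3; have Nt4 := new_target_ext X4 Nt3.
have [_ Kw3 _ _ _] := new_inv_of I3 Pr3 Nt3.
have Rd4 := ready_ext I4 X4 Kw3 Rd3.
have [_ Hb] := pub_an (ext_trans X2 (ext_trans X3 X4)) Pb1.
rewrite -Hb in Gc Gs Hres.
case: res Hres => Hres; last 2 first.
- by case: Hres => _ ->; exists s4; split=> //; exact: stepped_refl.
- by case: Hres => _ ->; exists s4; split=> //; exact: stepped_refl.
case: Hres => Ev Ev' Eh.
have [uq [Eq lti Ec]] := get_child Gc; have [us Eus Est] := get_status Gs.
rewrite Eq in Eus; case: Eus => Eus; rewrite -{us}Eus in Est.
rewrite {}Ev in Ec; rewrite {}Ev' in Est.
have R : replaced (hp s4) (hm s4 b).1 (Inner V (set_child uq (hm s4 b).2 (Some w))) h5.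
  by rewrite Eh /=; apply: (replaced_inner _ Eq).
have [s5 [E5 S5 O5]] := install_step t I4 Pr4 Nt4 Rd4 Eq lti Ec Est R T0.
exists s5; split=> //; exact: engaged_own (st_ext S5) O5 Id4.
Qed.

Lemma wp_body (f : proc) (s : state) : tree_inv s -> pre t f s ->
  wp t (body T f) (fun r s => post t r s) s.
Proof.
move=> I; case: f => [m|m n path|k|k n|u q i|op|c|c deg|op k|op nt k len].
- move=> Id; apply: wp_tail; last by [].
  have [u [Eu P0 A0]] := i_root I.
  exists 0; split=> //; last by rewrite A0.
    by split=> //; exists u.
  by rewrite A0.
- exact: wp_modifyFrom.
- by move=> Id; apply: wp_tail.
- exact: wp_lookupFrom.
- exact: wp_startRebuild.
- by move=> [Id [b [v [-> Pr]]]]; apply: wp_helpRebuild Pr.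
- by move=> [Id M]; apply: wp_markAndCount.
- by move=> [Id [b [cs [-> M le]]]]; apply: wp_markLoop M le.
- by move=> [Id [b [v [-> Pr Fr]]]]; apply: wp_createIdealCollaborative Fr.
- move=> [Id [b [v [w [-> -> B]]]]].
  apply: wp_mono (wp_fillLoop T0 I Id B) => r s' [Id' H]; split=> //.
  by exists w.
Qed.

End Body.

(** * Reachable states and depth *)

Lemma thread_step_inv (h h' : heap) (q q' : prog unit) : thread_step T h q h' q' ->
  match q with
  | Ret _ => h' = h /\ ((exists m, q' = call (Modify m)) \/
      exists k, q' = bind (call (@Lookup _ K V k)) (fun _ => Ret K V tt))
  | Do c k => exists2 r, exec h r h' & q' = k r
  | Call f k => h' = h /\ q' = bind (body T f) k
  end.
Proof.
case=> [h0 c k r h1 E|h0 f k|h0 m|h0 k] //; first by exists r.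
- by split=> //; left; exists m.
- by split=> //; right; exists k.
Qed.

Definition initial_state : state :=
  State (memory (initial K V p)) (fun a => if a == 0 then KPub else KDead)
    (fun _ => [::]) (fun _ => (0, 0)) (fun _ => 0) (fun _ => set0) (fun _ => set0).

Lemma initial_inv : tree_inv initial_state.
Proof.
have tr a : kd initial_state a <> KDead -> a = 0 by rewrite /=; case: eqP.
split; first split=> //=.
- by move=> a /tr ->.
- by eexists.
- move=> a u /tr -> /= [<-]; split=> //=.
  + by move=> [|[|j]] b //= [<-].
  + by move=> _; split=> // -[|j].
- by move=> [|[|b]].
- by move=> [|[|b]].
- by move=> a u a0 /tr.
Qed.

(** Soundness of [wp]. [wp_body] assumes the specifications of the calls inside a body; this is not
    circular, because each call is unfolded by a step of the execution and the induction is on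
    executions. *)
Lemma reachable_inv (c : config K V p) : 0 < T -> reachable T c ->
  exists s : state, [/\ hp s = memory c, tree_inv s &
    forall t, wp t (threads c t) (fun _ s => idle s t) s].
Proof.
move=> T0; elim=> {c} [|c t h' q' _ [s [Eh I W]] Hs].
  exists initial_state; split=> //; first exact: initial_inv.
  by move=> t y; rewrite /= !inE.
rewrite -Eh in Hs; have := thread_step_inv Hs; have Wt := W t.
suff main : (exists s', [/\ hp s' = h', stepped t s s' & wp t q' (fun _ s => idle s t) s']) ->
    exists s0 : state, [/\ hp s0 = h', tree_inv s0 &
      forall t0, wp t0 (if t0 == t then q' else threads c t0) (fun _ s => idle s t0) s0].
  move=> H; apply: main; case: (threads c t) Wt H => [[]|pr k|f k] Wt.
  - move=> [Eh' Hq]; exists s; split=> //; first exact: stepped_refl.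
    by case: Hq => [[m ->]|[k ->]]; [apply: wp_tail|apply: wp_call].
  - by move=> [r Ex ->]; apply: (Wt s (rely_refl t s) I r h' Ex).
  - move=> [Eh' ->]; exists s; split=> //; first exact: stepped_refl.
    case: Wt => P Hk; exact: (wp_bind I (wp_body T0 I P) Hk).
move=> [s' [E' S' W']]; exists s'; split=> //; first exact: S'.
move=> t0; case: eqP => [->//|Nt].
have Rl := st_rely S' Nt.
by apply: (wp_rely I Rl) (W t0) => _; apply: engaged_rely.
Qed.

(** * From the invariant to the depth *)

Section Bound.
Variable s : state.
Hypothesis I : tree_inv s.

(** Describes pointers met when descending below the sentinel, which is excluded because it has no
    bounds. *)
Definition in_tree (c : ptr) : Prop := exists b x, [/\ c = Some b, onth (hp s) b = Some x &
  match x with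
  | Inner _ => kd s b = KPub /\ b <> 0
  | Rebuild _ _ _ _ => kd s b = KPub
  | _ => True
  end].

Lemma in_tree_child a u j : kd s a = KPub -> onth (hp s) a = Some (Inner V u) ->
  j < size (children u) -> in_tree (nth null (children u) j).
Proof.
move=> P E ltj; have N := i_node I (tracked_pub P) E.
case Ec: (nth null (children u) j) => [b|]; last by have [_ /(_ j ltj)] := nd_pub N P.
have := nd_child N Ec; rewrite /child_inv; case Eb: (onth _ b) => [x|] // H.
exists b, x; split=> //; case: x Eb H => [|? ?|v|? ? ? ?] Eb //; last by case.
by rewrite P => -[? _ ?].
Qed.

Lemma in_tree_target b t w q i : kd s b = KPub -> onth (hp s) b = Some (Rebuild K V t w q i) ->
  exists v u, [/\ t = Some v, onth (hp s) v = Some (Inner V u), kd s v = KPub & v <> 0].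
Proof.
move=> P E; have [v [-> _ [_ v0] [[u Ev] Pv _] _]] := i_reb I P E.
by exists v, u.
Qed.

Lemma in_tree_leaf_path c l : weight (hp s) 1 c l -> in_tree c ->
  1 <= l /\ exists d, leaf_path (hp s) c d.
Proof.
elim=> {c l} [c E|c E|c cs ks E sz W IH|c t k E _ IH] [b [x [Ec Eb H]]]; rewrite Ec in E *.
- split=> //; exists 0; apply: leaf_path_empty; move: E; rewrite /skel /= Eb.
  by case: (x).
- move: E; rewrite /skel /= Eb; case: (x) Eb => [|k v|?|? ? ? ?] Eb //= _.
  by split=> //; exists 0; apply: (@leaf_path_single _ _ _ _ _ k v); rewrite /= Eb.
- move: E; rewrite /skel /= Eb; case: x Eb H => [|? ?|u|? ? ? ?] Eb //= [P b0] [Ecs].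
  have pos := nd_pos (i_node I (tracked_pub P) Eb); rewrite Ecs in pos.
  have [] := IH 0 pos; first by rewrite -Ecs; apply: (in_tree_child P Eb); rewrite Ecs.
  move=> l1 [d Hd]; split; first by apply: leq_trans l1 (leq_nth_sumn _ _).
  by exists d.+1; apply: (@leaf_path_inner _ _ _ _ _ u 0); rewrite /= ?Ecs ?Eb.
- move: E; rewrite /skel /= Eb; case: x Eb H => [|? ?|u|t' w q i] Eb //= P [Et].
  have [v [u [Ev Eu Pv v0]]] := in_tree_target P Eb.
  have [] := IH; first by rewrite -Et Ev; exists v, (Inner V u).
  move=> l1 [d Hd]; split=> //; exists d.+1.
  by apply: (@leaf_path_rebuild _ _ _ _ _ t' w q i); rewrite /= ?Eb ?Et.
Qed.

Lemma sumn_two (ks : seq nat) i : (forall j, j < size ks -> 1 <= nth 0 ks j) ->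
  i < size ks -> 1 < size ks -> nth 0 ks i + 1 <= sumn ks.
Proof.
case: ks => [|x [|y ks]] // H lti _.
case: i lti => [|i] lti /=; first by have := H 1 isT; rewrite /=; lia.
have := H 0 isT; have := leq_nth_sumn (y :: ks) i; rewrite /=; lia.
Qed.

(* Below a node of initial size at most 4 every node has two children, and a
   node with a single child has such an initial size: hence a path contains
   at most one node that does not branch. *)
Lemma leaf_path_leaves c d : leaf_path (hp s) c d -> forall l, weight (hp s) 1 c l -> in_tree c ->
  [/\ d <= 2 * l,
    (forall b u, c = Some b -> onth (hp s) b = Some (Inner V u) -> d + 1 <= 2 * l) &
    (forall b x, c = Some b -> onth (hp s) b = Some x -> 
      match x with Inner u => initSize u <= 4 /\ 1 < size (children u)
      | Rebuild _ _ _ _ => False | _ => True end -> d + 2 <= 2 * l)].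
Proof.
elim=> {c d} [c E|c k v E|c u i d E lti _ IH|c t w q i d E _ IH] l W ct.
- have [l1 _] := in_tree_leaf_path W ct; split=> *; lia.
- have [l1 _] := in_tree_leaf_path W ct; split=> *; lia.
- have [b [x [Ec Eb H]]] := ct; rewrite Ec /= Eb in E; case: E => E.
  rewrite E in Eb H; have [P b0] := H.
  move: W; rewrite Ec => /weight_inv; rewrite {1}/skel /= Eb /= => -[ks [-> sz Wk]].
  have in_c j : j < size (children u) -> in_tree (nth null (children u) j).
    exact: in_tree_child P Eb.
  have [a1 a2 a3] := IH _ (Wk i lti) (in_c i lti).
  have B := inv_bound I b0 (tracked_pub P) Eb.
  have le := leq_nth_sumn ks i.
  have two : 1 < size (children u) -> nth 0 ks i + 1 <= sumn ks.
    move=> lt2; apply: sumn_two; rewrite ?sz // => j ltj.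
    by have [] := in_tree_leaf_path (Wk j ltj) (in_c j ltj).
  have small : initSize u <= 4 -> d + 2 <= 2 * nth 0 ks i.
    have [b' [x' [Ec' Eb' H']]] := in_c i lti.
    by move=> le4; have := bd_small B le4 Ec'; rewrite Eb'; apply: a3 Ec' Eb'.
  (* Two edges per leaf: an Inner node may be entered through a Rebuild node, whose edge adds no
     leaf. *)
  have main : d.+1 + 1 <= 2 * sumn ks.
    by case: (bd_size B) => [/two|/small]; lia.
  split=> //; first by lia.
  move=> b' x' [<-]; rewrite Eb => -[<-] [/small ? /two]; lia.
- have [b [x [Ec Eb H]]] := ct; rewrite Ec /= Eb in E; case: E => E.
  rewrite E in Eb H.
  have [v [uv [Ev Eu Pv v0]]] := in_tree_target H Eb.
  move: W; rewrite Ec => /weight_inv; rewrite {1}/skel /= Eb /= => W.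
  have ct' : in_tree t by rewrite Ev; exists v, (Inner V uv).
  have [a1 a2 _] := IH _ W ct'; have a := a2 v uv Ev Eu.
  split; first by lia.
    by move=> b' u' [<-]; rewrite Eb.
  by move=> b' x' [<-]; rewrite Eb => -[<-].
Qed.

Lemma slack_le a u : a <> 0 -> kd s a = KPub -> onth (hp s) a = Some (Inner V u) ->
  4 * slack s a <= initSize u + 4 * p.
Proof.
move=> a0 P E; have B := inv_bound I a0 (tracked_pub P) E.
have le : #|eg s a| <= p by rewrite -[leqRHS]card_ord max_card.
rewrite /slack mulnDr leq_add ?leq_mul2l //.
by case: (bd_dn B) => [->//|/ltnW].
Qed.

(** A generous value from which on [4 * Nat.sqrt x + 4 * p + 12 <= x] holds. *)
Definition wide := 100 * (p + 1).

Lemma slot_bound_half x y : wide <= x -> 4 * y <= x + 4 * p -> 2 * (slot_bound x + y) <= x.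
Proof.
rewrite /wide /slot_bound => le1 le2.
have [le3 _] := Nat.sqrt_spec x (Nat.le_0_l x).
have : 4 * Nat.sqrt x + 4 * p + 12 <= x; last by lia.
have [lt8|ge8] := ltnP (Nat.sqrt x) 8; first by lia.
have : 8 * Nat.sqrt x <= x; last by lia.
have : 8 * Nat.sqrt x <= Nat.sqrt x * Nat.sqrt x by rewrite leq_mul2r ge8 orbT.
lia.
Qed.

(** Initial sizes halve along the path down to [wide], at two edges per Inner node because of
    Rebuild nodes. A node of initial size at most [wide] has at most [wide + wide / 4 + p] leaves,
    and two edges for each of them stay within [5 * wide]. The final 1 is for a Rebuild node on
    top. *)
Lemma leaf_path_log c d : leaf_path (hp s) c d -> forall m l, weight (hp s) 1 c l -> in_tree c ->
  (forall v u, inner_child (hp s) c = Some v -> onth (hp s) v = Some (Inner V u) ->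
     initSize u <= 2 ^ m * wide) ->
  d <= 2 * m + 5 * wide + 1 /\
  forall b u, c = Some b -> onth (hp s) b = Some (Inner V u) -> d <= 2 * m + 5 * wide.
Proof.
elim=> {c d} [c E|c k v E|c u i d E lti Lp IH|c t w q i d E _ IH] m l W ct Hm.
- by split=> *; lia.
- by split=> *; lia.
- have [b [x [Ec Eb H]]] := ct; rewrite Ec /= Eb in E; case: E => E.
  rewrite E in Eb H; have [P b0] := H.
  have B := inv_bound I b0 (tracked_pub P) Eb.
  have szu : initSize u <= 2 ^ m * wide by apply: (Hm b) => //; rewrite Ec /= Eb.
  have sl := slack_le b0 P Eb.
  suff main : d.+1 <= 2 * m + 5 * wide by split=> [|b' u' _ _]; lia.
  have [lew|gtw] := leqP (initSize u) wide.
    have Lp' : leaf_path (hp s) c d.+1 by rewrite Ec; apply: leaf_path_inner lti Lp.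
    have [_ /(_ b u Ec Eb) le _] := leaf_path_leaves Lp' W ct.
    rewrite Ec in W; have := bd_up B W; move: lew sl; rewrite /wide; lia.
  case: m Hm szu => [|m] Hm szu; first by move: szu; rewrite expn0 mul1n leqNgt gtw.
  move: W; rewrite Ec => /weight_inv; rewrite {1}/skel /= Eb /= => -[ks [_ sz Wk]].
  have in_c := in_tree_child P Eb lti.
  have [|a1 _] := IH m _ (Wk i lti) in_c; last by lia.
  move=> v u' Ev Eu'; have := bd_child B Ev Eu'.
  have := slot_bound_half (ltnW gtw) sl.
  by move: szu; rewrite expnS; lia.
- have [b [x [Ec Eb H]]] := ct; rewrite Ec /= Eb in E; case: E => E.
  rewrite E in Eb H.
  have [v [uv [Ev Eu Pv v0]]] := in_tree_target H Eb.
  move: W; rewrite Ec => /weight_inv; rewrite {1}/skel /= Eb /= => W.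
  have ct' : in_tree t by rewrite Ev; exists v, (Inner V uv).
  have [|_ a2] := IH m _ W ct'.
    move=> v' u'; rewrite Ev /= Eu => -[<-] Eu'; apply: (Hm v) => //.
    by rewrite Ec /= Eb.
  have a := a2 v uv Ev Eu; split; first by lia.
  by move=> b' u' [<-]; rewrite Eb.
Qed.

Lemma leaf_path_inner_inv c d u : leaf_path (hp s) c d -> node_at (hp s) c = Some (Inner V u) ->
  exists i d', [/\ d = d'.+1, i < size (children u) &
    leaf_path (hp s) (nth null (children u) i) d'].
Proof.
by case=> [c' ->|c' k v ->|c' u' i d' -> lti Lp [<-]|c' t w q i d' -> _] //; exists i, d'.
Qed.

(** The constant: [2 * (trunc_log 2 n + 2) + 500 * (p + 1) + 2] is at most
    [1010 * (p + trunc_log 2 n)] because [p >= 1]. No term in the logarithm of [p] remains, as the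
    halving stops at [wide]. *)
Lemma leaf_path_root d n l : 0 < p -> leaf_path (hp s) (Some 0) d ->
  weight (hp s) 0 (Some 0) n -> weight (hp s) 1 (Some 0) l ->
  d <= 1010 * (p + trunc_log 2 n).
Proof.
move=> p0 Lp W0 W1; have [u [E P _]] := i_root I.
have [i [d' [-> lti Lp']]] := leaf_path_inner_inv Lp E.
have in_c := in_tree_child P E lti.
have sk : skel (hp s) (Some 0) = Some (SInner (children u)).
  by rewrite /skel (_ : node_at _ _ = Some (Inner V u)).
move: W0 => /weight_inv; rewrite sk => -[ns [En _ Wn]].
move: W1 => /weight_inv; rewrite sk => -[ls [_ _ Wl]].
have len : nth 0 ns i <= n by rewrite En leq_nth_sumn.
have [|le _] := leaf_path_log Lp' (m := trunc_log 2 n + 2) (Wl i lti) in_c.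
  move=> v uv Ev Euv.
  have [v0 Kv _ _ _] := inner_child_inv I (tracked_pub P) E Ev.
  rewrite P in Kv; have B := inv_bound I v0 (tracked_pub Kv) Euv.
  have sl := slack_le v0 Kv Euv.
  have Wv : weight (hp s) 0 (Some v) (nth 0 ns i).
    have := Wn i lti; move: Ev; case: (nth null (children u) i) => [b|] //=.
    case Eb: (onth (hp s) b) => [[|? ?|ub|t w q j]|] //; first by move=> [<-].
    by move=> Et /weight_inv; rewrite /skel /= Eb /= Et.
  have lo := bd_low B Wv.
  have n_lt : n < 2 ^ (trunc_log 2 n).+1 by apply: trunc_log_ltn.
  (* From [initSize <= n + slack] and [4 * slack <= initSize + 4 * p]. The two extra powers of 2 and
     the factor [wide] cover this bound. *)
  have le2 : initSize uv <= 2 * n + 2 * p by lia.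
  have pos : 0 < 2 ^ (trunc_log 2 n).+1 by rewrite expn_gt0.
  rewrite addn2 expnS -mulnA; move: le2 n_lt pos; rewrite /wide.
  by move: (2 ^ _) => N; nia.
by move: le; rewrite /wide; lia.
Qed.

End Bound.

(** Classical, since [leaf_path] comes without a decision procedure. *)
Lemma bounded_max (P : nat -> Prop) b : (exists n, P n) -> (forall n, P n -> n <= b) ->
  exists2 m, P m & forall n, P n -> n <= m.
Proof.
elim: b => [|b IH] [n Pn] H.
  by exists 0 => //; have := H n Pn; rewrite leqn0 => /eqP <-.
have [Pb|Nb] := classic (P b.+1); first by exists b.+1.
apply: IH; first by exists n.
move=> k Pk; have := H k Pk; rewrite leq_eqVlt => /predU1P [Ek|//].
by rewrite Ek in Pk.
Qed.

Lemma depth_bound (n : nat) (c : config K V p) : 0 < T -> 0 < p -> reachable T c ->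
  contains_keys c n ->
  exists2 d, has_depth c d & d <= 1010 * (p + trunc_log 2 n).
Proof.
move=> T0 p0 Rc [es En szn]; have [s [Eh I _]] := reachable_inv T0 Rc.
rewrite /has_depth -Eh in En *.
have W0 := entries_keys En; have [l W1] := entries_leaves En.
rewrite szn in W0.
have bnd d : leaf_path (hp s) root_ptr d -> d <= 1010 * (p + trunc_log 2 n).
  by move=> Lp; apply: (leaf_path_root I p0 Lp W0 W1).
have [u [E P _]] := i_root I.
have pos := nd_pos (i_node I (tracked_pub P) E).
have [|d Hd max] := @bounded_max (leaf_path (hp s) root_ptr) _ _ bnd.
  have sk : skel (hp s) (Some 0) = Some (SInner (children u)).
    by rewrite /skel (_ : node_at _ _ = Some (Inner V u)).
  move: W1 => /weight_inv; rewrite sk => -[ls [_ _ Wl]].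
  have [_ [d Hd]] := in_tree_leaf_path I (Wl 0 pos) (in_tree_child I P E pos).
  exists d.+1; exact: leaf_path_inner pos Hd.
by exists d => //; apply: bnd.
Qed.

End Execution.

(* [T] is the constant COLLABORATION_THRESHOLD; [trunc_log 2 n] is the integer
   part of the binary logarithm of [n], and 0 for [n = 0]. *)
Theorem lemma4p1 (T : nat) (T_gt0 : 0 < T) :
  exists C : nat,
    forall (disp : Order.disp_t) (K : orderType disp) (V : Type)
           (p n : nat) (c : config K V p),
      0 < p ->
      reachable T c ->
      contains_keys c n ->
      exists2 d, has_depth c d & d <= C * (p + trunc_log 2 n).
Proof.
exists 1010 => disp K V p n c p_gt0; exact: depth_bound.
Qed.
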